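(* Let $k\ge 2$, $m\ge 1$, $\Delta\ge 3$ and $n\ge 2$ be integers, and let $T$ be a $k$-uniform hypertree in $\mathbb{T}_k(m,\Delta,n)$ whose distance spectral radius is maximum among all hypertrees in $\mathbb{T}_k(m,\Delta,n)$. Then $T\cong C_k(m^*,\Delta,\lfloor n/2\rfloor,\lceil n/2\rceil)$, where $m^*=m-n(\Delta-2)$.
   Context: A hypergraph $G$ is $k$-uniform if every edge is a $k$-element subset of $V(G)$. The degree $d_G(v)$ of a vertex is the number of edges containing it. A path from $u$ to $v$ is a sequence $(v_0,e_1,v_1,\dots,e_p,v_p)$ with $v_0=u$, $v_p=v$, $v_{i-1},v_i\in e_i$, $v_{i-1}\ne v_i$, all $v_i$ and all $e_i$ distinct; its length is $p$. A cycle is such a sequence with at least two distinct edges, all $v_i,e_i$ distinct except $v_0=v_p$. A hypergraph is connected if any two vertices are joined by a path; a hypertree is a connected hypergraph with no cycles. The distance $d_G(u,v)$ is the length of a shortest path from $u$ to $v$ ($d_G(u,u)=0$); the distance matrix is $D(G)=(d_G(u,v))_{u,v\in V(G)}$, and the distance spectral radius $\rho(G)$ of a connected hypergraph $G$ is the largest eigenvalue of $D(G)$. A $k$-uniform loose path $P^k_m$ with $m$ edges is a $k$-uniform hypertree whose vertices and edges can be labeled $(u_0,e_1,u_1,\dots,u_{m-1},e_m,u_m)$ so that $u_1,\dots,u_{m-1}$ have degree $2$ and all other vertices have degree $1$. A $k$-uniform hyperstar $S^k_l$ is a $k$-uniform hypertree with $l$ edges all sharing a common vertex (its center); attaching $S^k_l$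 at a vertex $v$ means taking a vertex-disjoint copy and identifying its center with $v$ ($S^k_0$ is a single vertex). For integers $\Delta\ge 3$ and $a,b\ge 0$ with $a+b<m$, $C_k(m,\Delta,a,b)$ is the $k$-uniform hypertree obtained from $P^k_m=(u_0,e_1,u_1,\dots,e_m,u_m)$ by attaching a copy of $S^k_{\Delta-2}$ at $u_i$ for every $i$ with $1\le i\le a$ or $m-b\le i\le m-1$. $\mathbb{T}_k(m,\Delta,n)$ denotes the set of $k$-uniform hypertrees with $m$ edges, maximum degree $\Delta$, and exactly $n$ vertices of degree $\Delta$. *)

(* Defs.v *)
From HB Require Import structures.
From mathcomp Require Import all_boot all_order all_algebra.
From mathcomp Require Import reals.
Set Implicit Arguments.
Unset Strict Implicit.
Unset Printing Implicit Defensive.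
Import Order.TTheory GRing.Theory Num.Theory.

Section Hyper.
Variables (V : finType) (E : {set {set V}}).

Definition hdeg (v : V) : nat := #|[set e in E | v \in e]|.

Definition kuniform (k : nat) : Prop := forall e, e \in E -> #|e| = k.

(* Path (u = v_0, e_1, v_1, ..., e_p, v_p = v), with vertex list u :: vs
   and edge list es; its length is size es. *)
Definition is_hpath (u v : V) (vs : seq V) (es : seq {set V}) : bool :=
  [&& size vs == size es, uniq (u :: vs), uniq es, all (mem E) es,
      last u vs == v &
      all (fun t : V * V * {set V} => (t.1.1 \in t.2) && (t.1.2 \in t.2)) (zip (zip (u :: vs) vs) es)].

(* Cycle (v_0, e_1, v_1, ..., e_p, v_p = v_0), p >= 2, v_1..v_p distinct,
   edges distinct. *)
Definition is_hcycle (u : V) (vs : seq V) (es : seq {set V}) : bool :=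
  [&& 2 <= size es, size vs == size es, uniq vs, uniq es, all (mem E) es,
      last u vs == u &
      all (fun t : V * V * {set V} => (t.1.1 \in t.2) && (t.1.2 \in t.2)) (zip (zip (u :: vs) vs) es)].

Definition hconnected : Prop :=
  forall u v : V, exists vs es, is_hpath u v vs es.

Definition hypertree : Prop :=
  hconnected /\ ~ (exists u vs es, is_hcycle u vs es).

Definition has_path_len (u v : V) (p : nat) : bool :=
  [exists vs : p.-tuple V, exists es : p.-tuple {set V}, is_hpath u v vs es].

(* distance = length of a shortest path (paths have length < #|V|) *)
Definition hdist (u v : V) : nat := find (has_path_len u v) (iota 0 #|V|.+1).

Definition dist_mx (R : realType) : 'M[R]_#|V| :=
  \matrix_(i, j) (hdist (enum_val i) (enum_val j))%:R%R.

Definition is_dsr (R : realType) (r : R) : Prop :=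
  eigenvalue (dist_mx R) r /\ forall a, eigenvalue (dist_mx R) a -> (a <= r)%R.

Definition maxdeg : nat := \max_(v : V) hdeg v.

Definition in_class (k m Delta n : nat) : Prop :=
  [/\ kuniform k, hypertree, #|E| = m, maxdeg = Delta &
      #|[set v : V | hdeg v == Delta]| = n].

End Hyper.

Definition hiso (V V' : finType) (E : {set {set V}}) (E' : {set {set V'}}) : Prop :=
  exists f : V -> V', bijective f /\ forall e : {set V}, (e \in E) = (f @: e \in E').

(* The hypertree C_k(m, Delta, a, b). Raw vertices:
   inl (inl i)           = u_i, 0 <= i <= m
   inl (inr (i, j))      = j-th internal vertex of edge e_{i+1}, 0 <= i < m
   inr ((i, j), l)       = l-th non-center vertex of j-th edge of the star
                           attached at u_i (only if u_i is attached). *)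
Section Ck.
Variables (k m Delta a b : nat).

Definition CVpre : finType :=
  ('I_m.+1 + ('I_m * 'I_(k - 2)) + ('I_m.+1 * 'I_(Delta - 2) * 'I_(k - 1)))%type.

Definition attached (i : nat) : bool :=
  ((0 < i) && (i <= a)) || ((m - b <= i) && (i < m)).

Definition CVvalid (x : CVpre) : bool :=
  match x with
  | inr (i, _, _) => attached i
  | _ => true
  end.

Definition CV : finType := {x : CVpre | CVvalid x}.

Definition pedge (i : nat) (x : CVpre) : bool :=
  match x with
  | inl (inl j) => (val j == i) || (val j == i.+1)
  | inl (inr (j, _)) => val j == i
  | inr _ => false
  end.

Definition sedge (i j : nat) (x : CVpre) : bool :=
  match x with
  | inl (inl i0) => val i0 == i
  | inl (inr _) => false
  | inr (i', j', _) => (val i' == i) && (val j' == j)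
  end.

Definition C_edges : {set {set CV}} :=
  [set [set x : CV | pedge i (val x)] | i : 'I_m] :|:
  [set [set x : CV | sedge (val p.1) (val p.2) (val x)]
     | p in [set p : 'I_m.+1 * 'I_(Delta - 2) | attached p.1]].

End Ck.

(* Main.v *)
(* Let x be the Perron vector of the distance matrix of an extremal hypertree.
   Moving a set B of branches from a vertex w to a vertex w' changes distances only
   between B and its complement, and by the same amount d(a,w') - d(a,w) for every
   vertex a outside B, whatever the vertex of B.  Hence extremality says that the
   x-weighted transmission over the complement of B is strictly smaller at w' than
   at w whenever the move preserves the class.

   Transmissions are convex along paths, which excludes degrees strictly between 2
   and Delta.  Moving all branches behind a vertex to a deepest leaf of another
   branch excludes three vertices of degree at least 2 in one edge and three
   non-pendant edges at one vertex, so the hypertree is a path with stars attached;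
   convexity along this path puts the stars at its two ends.  If the left end had at
   least two stars more than the right one, moving the innermost left star to the
   right end would increase the spectral radius: the mass equations along the path
   show that, before and after the move, the Perron vector is larger at the target
   position, and comparing the two Perron vectors directly gives the increase. *)
Require Import Defs.
From HB Require Import structures.
From mathcomp Require Import all_boot all_order all_algebra.
From mathcomp Require Import perm reals.
From mathcomp Require classical_sets.
From mathcomp Require Import zify ring lra.
Import Order.TTheory GRing.Theory Num.Theory.
Set Implicit Arguments.
Unset Strict Implicit.
Unset Printing Implicit Defensive.

(** * Hypertrees and separating edges *)

(** The Rayleigh quotient of a single Perron vector [x] suffices as long as outer transmissions can
    be estimated directly. It fails for balancing the two ends: passing from [x w' - x w] to outer
    transmissions costs the mass of the moved branch times [d(w, w')], with an unfavourable sign.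
    Pairing [x] with the Perron vector of the moved hypertree cancels this cost, because there the
    branch hangs at [w'] and the same term occurs with the opposite sign. The price is that weights
    must be compared in both hypertrees, so the reflection inequality is proved for any spine with
    suitably monotone degrees, without extremality.

    Distances are counted by separating edges, so that a move can be treated edge by edge: an edge
    disjoint from [B] sees the branch as one vertex, an edge meeting [B] sees everything else as one
    vertex. *)

Section Connection.
Variable V : finType.
Implicit Types (F G E : {set {set V}}) (e f : {set V}) (x y u v : V).

Definition adj F : rel V := fun x y => [exists f in F, (x \in f) && (y \in f)].
Definition conn F x y := connect (adj F) x y.
Definition sep E e x y := ~~ conn (E :\ e) x y.
(* In a hypertree every path from x to y uses exactly the edges separating x
   from y (hpath_size), so counting these edges gives the distance. *)
Definition dist E x y := #|[set e in E | sep E e x y]|.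

(** Acyclicity is phrased by cuts instead of cycles: removing an edge must disconnect its own
    vertices. This is the form that the count in [dist] can use; [hypertree_tree] and
    [tree_hypertree] give the equivalence. *)
Definition is_tree E :=
  (forall x y, conn E x y) /\
  (forall e x y, e \in E -> x \in e -> y \in e -> x != y -> sep E e x y).

Lemma adj_sym F x y : adj F x y = adj F y x.
Proof. by apply: eq_existsb => f; rewrite [(x \in f) && _]andbC. Qed.

Lemma conn_sym F x y : conn F x y = conn F y x.
Proof. exact: (sym_connect_sym (adj_sym F)). Qed.

Lemma conn_refl F x : conn F x x.
Proof. exact: connect0. Qed.

Lemma conn_trans F y x z : conn F x y -> conn F y z -> conn F x z.
Proof. exact: connect_trans. Qed.

Lemma conn_edge F f x y : f \in F -> x \in f -> y \in f -> conn F x y.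
Proof.
by move=> fF xf yf; apply: connect1; apply/existsP; exists f; rewrite fF xf yf.
Qed.

(** The common form of the connectivity arguments below: [phi] folds a part of the hypertree onto
    one vertex, and then only single edges have to be checked. *)
Lemma conn_sim F G (phi : V -> V) :
  (forall f x y, f \in F -> x \in f -> y \in f -> conn G (phi x) (phi y)) ->
  forall x y, conn F x y -> conn G (phi x) (phi y).
Proof.
move=> H x y /connectP [p]; elim: p x => [|z p IH] x /=.
  by move=> _ ->; apply: conn_refl.
case/andP=> /existsP [f /and3P [fF xf zf]] pth ylast.
exact: conn_trans (H _ _ _ fF xf zf) (IH _ pth ylast).
Qed.

(* Splitting at the last visit of the edge f, which lets paths be built by
   induction on the number of edges without ever reusing one. *)
Lemma conn_last F f x y : conn F x y ->
  conn (F :\ f) x y \/ exists2 v, v \in f & conn (F :\ f) v y.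
Proof.
move=> /connectP [p]; elim: p x => [|z p IH] x /=.
  by move=> _ ->; left; apply: conn_refl.
case/andP=> /existsP [g /and3P [gF xg zg]] pth ylast.
case: (IH _ pth ylast) => [zy|]; last by right.
have [gf|gf] := eqVneq g f; first by right; exists z; rewrite // -gf.
left; apply: conn_trans zy; apply: (@conn_edge _ g) => //.
by rewrite !inE gf.
Qed.

Lemma conn_start F x y : x != y -> conn F x y ->
  exists2 f, f \in F & x \in f.
Proof.
move=> xy /connectP [[|z p] /=]; first by move=> _ yx; rewrite yx eqxx in xy.
by case/andP=> /existsP [f /and3P [fF xf _]] _ _; exists f.
Qed.

Lemma conn_setD1_all F f x : (forall y z, conn F y z) -> x \in f ->
  forall a, exists2 v, v \in f & conn (F :\ f) a v.
Proof.
move=> cF xf a; case: (@conn_last F f x a (cF _ _)) => [c|[v vf c]].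
  by exists x; rewrite // conn_sym.
by exists v; rewrite // conn_sym.
Qed.

Definition step_ok := fun t : V * V * {set V} => (t.1.1 \in t.2) && (t.1.2 \in t.2).

Lemma hpath_cons E u v w vs f es :
  is_hpath E u v (w :: vs) (f :: es) =
  [&& u \notin w :: vs, f \notin es, f \in E, u \in f, w \in f &
      is_hpath E w v vs es].
Proof.
rewrite /is_hpath /= eqSS; case: (size vs == size es) => /=; last by rewrite !andbF.
case: (u \notin _) => //=; case: (f \in es) => /=; first by rewrite !andbF.
case: (f \in E) => /=; last by rewrite !andbF.
case: (u \in f) => /=; last by rewrite !andbF.
case: (w \in f) => //=; by rewrite !andbF.
Qed.

Lemma hpath_nil E u v : is_hpath E u v [::] [::] = (u == v).
Proof. by rewrite /is_hpath /= andbT. Qed.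

Lemma walk_conn F u vs es : size vs = size es -> all (mem F) es ->
  all step_ok (zip (zip (u :: vs) vs) es) -> conn F u (last u vs).
Proof.
elim: vs u es => [|w vs IH] u [|f es] //=; first by move=> _ _ _; apply: conn_refl.
move=> [sz] /andP [fF esF] /andP [/andP [uf wf] ok].
exact: conn_trans (conn_edge fF uf wf) (IH _ _ sz esF ok).
Qed.

Lemma hpath_conn F u v vs es : is_hpath F u v vs es -> conn F u v.
Proof.
by case/and5P=> /eqP sz _ _ esF /andP [/eqP <- ok]; apply: walk_conn ok.
Qed.

Lemma hpath_mem_conn F u v w vs es :
  is_hpath F u v vs es -> w \in vs -> conn F u w.
Proof.
elim: vs u es => [|z vs IH] u [|f es] //.
rewrite hpath_cons inE => /and5P [_ _ fF uf /andP [zf hp]].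
have uz := conn_edge fF uf zf.
by case/orP=> [/eqP -> //|/(IH _ _ hp)]; apply: conn_trans.
Qed.

Lemma hpath_sub F G u v vs es : {subset F <= G} ->
  is_hpath F u v vs es -> is_hpath G u v vs es.
Proof.
move=> sFG /and5P [h1 h2 h3 h4 h5]; apply/and5P; split=> //.
by apply/allP => e /(allP h4) /sFG.
Qed.

Lemma conn_hpath F x y : conn F x y -> exists vs es, is_hpath F x y vs es.
Proof.
have [n] := ubnP #|F|; elim: n F x y => // n IH F x y ltF cxy.
have [<-|xy] := eqVneq x y; first by exists [::], [::]; rewrite hpath_nil.
have [f fF xf] := conn_start xy cxy.
have sub : {subset F :\ f <= F} by move=> g; rewrite inE => /andP [].
have lt1 : #|F :\ f| < n by move: ltF; rewrite (cardsD1 f) fF.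
have [cxy'|ncxy] := boolP (conn (F :\ f) x y).
  by have [vs [es h]] := IH _ _ _ lt1 cxy'; exists vs, es; apply: hpath_sub h.
case: (conn_last f cxy) => [/(negP ncxy) //|[v vf cvy]].
have [vs [es h]] := IH _ _ _ lt1 cvy.
exists (v :: vs), (f :: es); rewrite hpath_cons fF xf vf (hpath_sub sub h) !andbT.
apply/andP; split.
  apply/negP; rewrite inE => /orP [/eqP xv|xvs].
    by rewrite xv cvy in ncxy.
  have cvx := hpath_mem_conn h xvs.
  by case/negP: ncxy; apply: conn_trans cvy; rewrite conn_sym.
apply/negP => fes; case/and5P: h => _ _ _ /allP /(_ _ fes) /= + _.
by rewrite !inE eqxx.
Qed.

Lemma sep_sym E e x y : sep E e x y = sep E e y x.
Proof. by rewrite /sep conn_sym. Qed.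

Lemma sep_refl E e x : sep E e x x = false.
Proof. by rewrite /sep conn_refl. Qed.

Lemma sep_eq E e x y a : ~~ sep E e x y -> sep E e x a = sep E e y a.
Proof.
rewrite /sep negbK => cxy; congr (~~ _); apply/idP/idP => h.
  by apply: conn_trans h; rewrite conn_sym.
exact: conn_trans h.
Qed.

Lemma sep_other E e f x y : f \in E -> f != e -> x \in f -> y \in f ->
  ~~ sep E e x y.
Proof.
move=> fE fe xf yf; rewrite /sep negbK; apply: (@conn_edge _ f) => //.
by rewrite !inE fe.
Qed.

Lemma dist_sym E x y : dist E x y = dist E y x.
Proof. by congr #|pred_of_set _|; apply/setP => e; rewrite !inE sep_sym. Qed.

Lemma distE E x y : dist E x y = \sum_(e in E) sep E e x y.
Proof.
rewrite /dist -sum1_card -big_mkcondr /=.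
by apply: eq_bigl => e; rewrite inE.
Qed.

Lemma dist_refl E x : dist E x x = 0.
Proof. by rewrite distE big1 // => e _; rewrite sep_refl. Qed.

Lemma dist_triangle E y x z : dist E x z <= dist E x y + dist E y z.
Proof.
rewrite !distE -big_split /=; apply: leq_sum => e _.
have [h|/sep_eq ->] := boolP (sep E e x y); last by case: (sep E e y z).
by case: (sep E e x z).
Qed.

(** A path from [x] to [y] that avoids [e] would close up with [e] to a cycle. *)
Lemma hypertree_tree E : hypertree E -> is_tree E.
Proof.
move=> [cE acE]; split=> [x y|e x y eE xe ye xy].
  by have [vs [es]] := cE x y; apply: hpath_conn.
apply/negP => /conn_hpath [vs [es h]]; apply: acE.
case/and5P: (h) => /eqP sz uxvs ues esE /andP [/eqP lst ok].
exists y, (x :: vs), (e :: es).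
have sz0 : 0 < size es.
  rewrite -sz lt0n; apply/eqP => /size0nil vs0.
  by rewrite vs0 /= in lst; rewrite lst eqxx in xy.
rewrite /is_hcycle ltnS sz0 [size _]/= [size (e :: _)]/= eqSS sz eqxx uxvs [uniq _]/= ues [last _ _]/= lst eqxx /= eE xe ye !andbT /=.
apply/and3P; split=> //.
- by apply/negP => /(allP esE); rewrite /= !inE eqxx.
- by apply/allP => f /(allP esE); rewrite /= !inE => /andP [].
Qed.

Lemma tree_acyclic E : is_tree E -> ~ exists u vs es, is_hcycle E u vs es.
Proof.
move=> [_ sE] [u [[|v vs] [[|e es]]]]; rewrite /is_hcycle /= ?andbF // !ltnS.
case/and5P => sz2 /eqP [sz] /andP [vvs uvs] /andP [ees ues].
case/and3P=> /andP [eE esE] /eqP lst /andP [/andP [ue ve] ok].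
have vu : v != u.
  rewrite -lst; case: vs sz vvs {uvs lst ok} => [/esym/size0nil es0|w vs _ vvs /=].
    by rewrite es0 in sz2.
  by apply: contraNneq vvs => ->; apply: mem_last.
move: (sE _ _ _ eE ve ue vu); rewrite /sep -lst; case/negP.
apply: walk_conn sz _ ok; apply/allP => f fes /=; rewrite !inE.
have -> : f \in E by exact: (allP esE _ fes).
rewrite andbT; by apply: contraNneq ees => <-.
Qed.

Lemma tree_hypertree E : is_tree E -> hypertree E.
Proof.
move=> tE; split; last exact: tree_acyclic.
by move=> u v; case: tE => cE _; apply: conn_hpath (cE u v).
Qed.

(** The first edge separates [x] from [y] but not the second vertex from [y], and every other edge
    treats the first two vertices alike; so each step removes exactly one separating edge. *)
Lemma hpath_size E x y vs es : is_tree E -> is_hpath E x y vs es ->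
  size es = dist E x y.
Proof.
move=> [_ sE]; elim: vs es x => [|v vs IH] [|e es] x //.
  by rewrite hpath_nil => /eqP ->; rewrite dist_refl.
rewrite hpath_cons inE negb_or => /and5P [/andP [xv xvs] ees eE xe /andP [ve hp]].
have cvy : conn (E :\ e) v y.
  case/and5P: hp => /eqP sz _ _ esE /andP [/eqP <- ok]; apply: walk_conn sz _ ok.
  apply/allP => f fes /=; rewrite !inE; have -> : f \in E by exact: (allP esE _ fes).
  rewrite andbT.
  by apply: contraNneq ees => <-.
rewrite /= (IH _ _ hp) !distE (bigD1 e) //= [RHS](bigD1 e) //=.
have -> : sep E e v y = false by rewrite /sep cvy.
have -> : sep E e x y.
  have nvy : ~~ sep E e v y by rewrite /sep cvy.
  by rewrite sep_sym -(sep_eq x nvy) sep_sym sE.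
rewrite add0n add1n; congr _.+1; apply: eq_bigr => f /andP [fE fe].
by rewrite (@sep_eq E f x v y) // (sep_other eE) // eq_sym.
Qed.

Lemma hdist_dist E x y : is_tree E -> hdist E x y = dist E x y.
Proof.
move=> tE; have hasP p : has_path_len E x y p = (p == dist E x y).
  apply/existsP/eqP => [[vs /existsP [es h]]|->].
    by rewrite -(hpath_size tE h) size_tuple.
  case: (tE) => cE _; have [vs [es h]] := conn_hpath (cE x y).
  have se := hpath_size tE h; have /eqP sv : size vs == dist E x y.
    by rewrite -se; case/and5P: h.
  have sv' := introT eqP sv; have se' := introT eqP se.
  by exists (Tuple sv'); apply/existsP; exists (Tuple se').
have lt : dist E x y < #|V|.+1.
  case: (tE) => cE _; have [vs [es h]] := conn_hpath (cE x y).
  rewrite -(hpath_size tE h); case/and5P: h => /eqP <- /card_uniqP /= c _ _ _.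
  by apply: leq_trans (max_card (mem (x :: vs))); rewrite c.
rewrite /hdist (eq_find hasP) -[LHS]/(index (dist E x y) (iota 0 #|V|.+1)).
by rewrite -[X in index X]add0n -(nth_iota 0 0 lt) index_uniq ?size_iota ?iota_uniq ?add0n.
Qed.

End Connection.

(** * Sides of an edge, convexity of distances, branches *)

Section TreeGeometry.
Variables (V : finType) (E : {set {set V}}).
Hypothesis tE : is_tree E.
Implicit Types (e f B : {set V}) (x y z u v w a b : V).
Notation d := (dist E).

Lemma tree_conn x y : conn E x y. Proof. by case: tE. Qed.

Lemma tree_sep e x y : e \in E -> x \in e -> y \in e -> sep E e x y = (x != y).
Proof.
move=> eE xe ye; case: eqP => [->|/eqP xy] /=; first by rewrite sep_refl.
by case: tE => _; apply.
Qed.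

Lemma dist_eq0 x y : (d x y == 0) = (x == y).
Proof.
apply/eqP/eqP => [|->]; last exact: dist_refl.
have [vs [es h]] := conn_hpath (tree_conn x y); rewrite -(hpath_size tE h).
move=> /size0nil es0; case/and5P: h => /eqP; rewrite es0 => /size0nil -> _ _ _.
by case/andP=> /eqP.
Qed.

Lemma dist_gt0 x y : (0 < d x y) = (x != y).
Proof. by rewrite lt0n dist_eq0. Qed.

Lemma dist_edge e x y : e \in E -> x \in e -> y \in e -> d x y = (x != y).
Proof.
move=> eE xe ye; rewrite distE (bigD1 e) //= tree_sep // big1 ?addn0 // => f.
by case/andP=> fE fe; rewrite (negPf (@sep_other V E f e x y _ _ _ _)) // eq_sym.
Qed.

Lemma dist_step e x y a : e \in E -> x \in e -> y \in e ->
  d x a + sep E e y a = d y a + sep E e x a.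
Proof.
move=> eE xe ye; rewrite !distE !(bigD1 e eE) /=.
have -> : \sum_(i in E | i != e) nat_of_bool (sep E i x a) =
          \sum_(i in E | i != e) nat_of_bool (sep E i y a).
  apply: eq_bigr => f /andP [fE fe]; rewrite (@sep_eq V E f x y a) //.
  by apply: (@sep_other V E f e) => //; rewrite eq_sym.
by rewrite addnC addnA [in RHS]addnAC.
Qed.

(** The component of [y] once [e] is removed. For [y] ranging over [e] these sets partition the
    vertices, by [side_disj] and [side_cover]. *)
Definition side e y := [set v | ~~ sep E e y v].

Lemma mem_side e y v : (v \in side e y) = ~~ sep E e y v.
Proof. by rewrite inE. Qed.

Lemma side_self e y : y \in side e y.
Proof. by rewrite mem_side sep_refl. Qed.

Lemma side_edge e f y x x' : f \in E -> f != e -> x \in f -> x' \in f ->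
  (x \in side e y) = (x' \in side e y).
Proof.
move=> fE fe xf x'f; rewrite !mem_side ![sep E e y _]sep_sym.
by rewrite (@sep_eq V E e x x') // (sep_other fE).
Qed.

Lemma side_eq e x y : x \in side e y -> side e x = side e y.
Proof.
by move=> h; apply/setP => v; rewrite !mem_side (@sep_eq V E e y x) // -mem_side.
Qed.

Lemma side_edge_mem e y x : e \in E -> y \in e -> x \in e -> (x \in side e y) = (x == y).
Proof. by move=> eE ye xe; rewrite mem_side tree_sep // negbK eq_sym. Qed.

Lemma side_disj e y y' v : e \in E -> y \in e -> y' \in e -> y != y' ->
  v \in side e y -> v \in side e y' = false.
Proof.
move=> eE ye y'e yy' vy; apply/negP => vy'.
have := side_edge_mem eE ye y'e; rewrite eq_sym (negPf yy').
by rewrite -(side_eq vy) (side_eq vy') side_self.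
Qed.

Lemma side_cover e v : e \in E -> e != set0 -> exists2 y, y \in e & v \in side e y.
Proof.
move=> eE /set0Pn [x xe].
have [y ye c] := conn_setD1_all tree_conn xe v.
by exists y; rewrite // mem_side sep_sym /sep negbK.
Qed.

(** Fold the component of [z] off [e1] onto [z]. This fixes [a], keeps [e1] inside itself and
    collapses [e2], which lies in that component; so a path from [z] to [a] becomes one that avoids
    [e2]. *)
Lemma sep_excl e1 e2 z a : e1 \in E -> e2 \in E -> e1 != e2 -> z \in e1 -> z \in e2 ->
  sep E e1 z a -> ~~ sep E e2 z a.
Proof.
move=> e1E e2E e12 z1 z2 s1; rewrite /sep negbK.
pose phi v := if v \in side e1 z then z else v.
have phiz : phi z = z by rewrite /phi side_self.
have phia : phi a = a by rewrite /phi mem_side s1.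
rewrite -[X in conn _ X _]phiz -[X in conn _ _ X]phia.
apply: (@conn_sim V E _ phi) (tree_conn z a) => f x y fE xf yf.
have [fe1|fe1] := eqVneq f e1.
  have mem1 v : v \in e1 -> phi v \in e1 by rewrite /phi; case: ifP.
  by apply: (@conn_edge _ _ e1); rewrite ?mem1 -?fe1 ?inE // fe1 e12 e1E.
rewrite /phi (side_edge z fE fe1 xf yf); case: ifP => [_|ynz]; first exact: conn_refl.
apply: (@conn_edge _ _ f) => //; rewrite !inE fE andbT.
apply: contraFneq ynz => fe2.
by rewrite (@side_edge e1 f z y z) ?side_self // fe2.
Qed.

(** A step from [z] along [e1] can approach [a] by at most one, and only if [e1] separates [z] from
    [a]; then [e2] does not, and the step along [e2] moves away by one. *)
Lemma dist_convex e1 e2 z y1 y2 a :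
  e1 \in E -> e2 \in E -> e1 != e2 -> z \in e1 -> z \in e2 -> y1 \in e1 -> y2 \in e2 ->
  y1 != z -> y2 != z -> 2 * d z a <= d y1 a + d y2 a.
Proof.
move=> e1E e2E e12 z1 z2 y1e y2e y1z y2z.
have h1 := dist_step a e1E z1 y1e; have h2 := dist_step a e2E z2 y2e.
have key e y : e \in E -> z \in e -> y \in e -> y != z -> 1 <= sep E e z a + sep E e y a.
  move=> eE ze ye yz; have [//|nz] := boolP (sep E e z a).
  by rewrite sep_sym -(sep_eq y nz) tree_sep // eq_sym yz.
have h3 : sep E e1 z a + sep E e2 z a <= 1.
  have := @sep_excl e1 e2 z a e1E e2E e12 z1 z2.
  by case: (sep E e1 z a) => [/(_ isT)/negPf ->|_] //; case: (sep E e2 z a).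
have h4 := key _ _ e1E z1 y1e y1z; have h5 := key _ _ e2E z2 y2e y2z.
by move: h1 h2 h3 h4 h5; move: (nat_of_bool _) (nat_of_bool _) (nat_of_bool _) (nat_of_bool _) (d z a) (d y1 a) (d y2 a); clear; lia.
Qed.

(* B is a union of branches attached at w. *)
Definition hang w B := w \notin B /\
  forall f, f \in E -> [disjoint f & B] \/ f \subset w |: B.

Lemma hang_in w B f : hang w B -> f \in E -> ~~ [disjoint f & B] -> f \subset w |: B.
Proof. by case=> _ h fE; case: (h f fE) => // ->. Qed.

Lemma hang_conn_out w B u v (F : {set {set V}}) :
  hang w B -> u \notin B -> v \notin B ->
  (forall f, f \in E -> [disjoint f & B] -> f \in F) ->
  conn F u v.
Proof.
move=> hB uB vB hF; pose phi x := if x \in B then w else x.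
have phE x : x \notin B -> phi x = x by rewrite /phi => /negPf ->.
rewrite -(phE _ uB) -(phE _ vB).
apply: (@conn_sim V E F phi) (tree_conn u v) => f x y fE xf yf.
have [dfB|ndfB] := boolP [disjoint f & B].
  have nB t : t \in f -> t \notin B by move=> tf; rewrite (disjointFr dfB).
  by rewrite !phE ?nB //; apply: conn_edge (hF _ fE dfB) xf yf.
have sf := subsetP (hang_in hB fE ndfB).
have pw t : t \in f -> phi t = w.
  by move=> /sf; rewrite /phi !inE => /orP [/eqP ->|->] //; case: ifP.
by rewrite !pw //; apply: conn_refl.
Qed.

Lemma hang_conn_in w w' B u (F : {set {set V}}) :
  hang w B -> w' \notin B -> u \in B ->
  (forall f, f \in E -> ~~ [disjoint f & B] ->
     exists2 g, g \in F & forall x, x \in f -> (if x \in B then x else w') \in g) ->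
  conn F u w'.
Proof.
move=> hB w'B uB hF; pose phi x := if x \in B then x else w'.
have [wB _] := hB.
have -> : w' = phi w by rewrite /phi (negPf wB).
have -> : u = phi u by rewrite /phi uB.
apply: (@conn_sim V E F phi) (tree_conn u w) => f x y fE xf yf.
have [dfB|ndfB] := boolP [disjoint f & B].
  by rewrite /phi !(disjointFr dfB) //; apply: conn_refl.
by have [g gF hg] := hF f fE ndfB; apply: (conn_edge gF); apply: hg.
Qed.

Lemma hang_sep_out w B e u v : hang w B -> e \in E -> ~~ [disjoint e & B] ->
  u \notin B -> v \notin B -> sep E e u v = false.
Proof.
move=> hB eE deB uB vB; apply/negbTE; rewrite /sep negbK.
apply: (hang_conn_out hB) => // f fE df; rewrite !inE fE andbT.
by apply: contraNneq deB => <-.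
Qed.

Lemma hang_sep_in w B e u v : hang w B -> e \in E -> [disjoint e & B] ->
  u \in w |: B -> v \in w |: B -> sep E e u v = false.
Proof.
move=> hB eE deB.
have key x : x \in w |: B -> conn (E :\ e) x w.
  rewrite !inE => /orP [/eqP ->|xB]; first exact: conn_refl.
  have [wB _] := hB; apply: (hang_conn_in hB wB xB) => f fE ndf; exists f.
    by rewrite !inE fE andbT; apply: contraNneq ndf => ->.
  move=> y yf; have := subsetP (hang_in hB fE ndf) y yf.
  by rewrite !inE; case: ifP => // _ /orP [/eqP <-|].
move=> /key cu /key cv; apply/negbTE; rewrite /sep negbK.
by apply: conn_trans cu _; rewrite conn_sym.
Qed.

(** Edges disjoint from [B] cannot separate [w] from [b], and edges meeting [B] cannot separate [a]
    from [w]; so every separating edge contributes to exactly one summand. *)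
Lemma hang_dist w B a b : hang w B -> a \notin B -> b \in B ->
  d a b = d a w + d w b.
Proof.
move=> hB aB bB; have [wB _] := hB.
rewrite !distE -big_split /=; apply: eq_bigr => e eE.
have [deB|ndeB] := boolP [disjoint e & B].
  have swb : sep E e w b = false.
    by apply: (hang_sep_in hB) => //; rewrite !inE ?eqxx ?bB ?orbT.
  by rewrite swb addn0 sep_sym -(@sep_eq V E e w b a) ?swb // sep_sym.
have saw : sep E e a w = false by apply: (hang_sep_out hB).
by rewrite saw add0n (@sep_eq V E e a w b) // saw.
Qed.

(** The two kinds of branches at [y] that get moved besides stars: everything not reached through
    [e] here, and everything reached through [e] in [hang_sideC]. *)
Lemma hang_side e y : e \in E -> y \in e -> hang y (side e y :\ y).
Proof.
move=> eE ye; split; first by rewrite !inE eqxx.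
move=> f fE; have [->|fe] := eqVneq f e.
  left; apply/pred0P => x; apply/negbTE; rewrite /= !inE.
  apply/negP => /andP [xe /andP [xy]]; rewrite tree_sep // negbK eq_sym => /eqP yx.
  by rewrite yx eqxx in xy.
have [df|/pred0Pn [x /= /andP [xf]]] := boolP [disjoint f & side e y :\ y]; first by left.
rewrite in_setD1 => /andP [_ xs]; right; apply/subsetP => t tf; rewrite setD1K ?side_self //.
by rewrite (side_edge y fE fe tf xf).
Qed.

Lemma hang_sideC e y : e \in E -> y \in e -> hang y (~: side e y).
Proof.
move=> eE ye; split; first by rewrite inE side_self.
move=> f fE; have [->|fe] := eqVneq f e.
  right; apply/subsetP => x xe; rewrite in_setU1 inE side_edge_mem //.
  by case: (x == y).
have [df|/pred0Pn [x /= /andP [xf]]] := boolP [disjoint f & ~: side e y]; first by left.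
rewrite inE => xs; right; apply/subsetP => t tf; rewrite in_setU1 inE.
by rewrite (side_edge y fE fe tf xf) xs orbT.
Qed.

Lemma dist_across e y y' u v : e \in E -> y \in e -> y' \in e -> y != y' ->
  u \in side e y -> v \in side e y' -> d u v = d u y + 1 + d y' v.
Proof.
move=> eE ye y'e yy' uy vy'.
have uB : u \notin ~: side e y by rewrite in_setC negbK.
have vB : v \in ~: side e y.
  by rewrite in_setC (side_disj eE y'e ye _ vy') // eq_sym.
have vB' : v \notin ~: side e y' by rewrite in_setC negbK.
have yB' : y \in ~: side e y' by rewrite in_setC side_edge_mem.
rewrite (hang_dist (hang_sideC eE ye) uB vB) [d y v]dist_sym.
rewrite (hang_dist (hang_sideC eE y'e) vB' yB').
by rewrite (dist_edge eE y'e ye) eq_sym yy' [d y' v]dist_sym -addnA [1 + _]addnC.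
Qed.

Lemma deg1_edge z e f : hdeg E z = 1 -> e \in E -> f \in E -> z \in e -> z \in f -> e = f.
Proof.
move=> /eqP /cards1P [g Eg] eE fE ze zf.
have : e \in [set g in E | z \in g] by rewrite inE eE.
have : f \in [set g in E | z \in g] by rewrite inE fE.
by rewrite Eg !inE => /eqP -> /eqP ->.
Qed.

Lemma sep_leaf z e a : hdeg E z = 1 -> e \in E -> z \in e -> sep E e z a = (z != a).
Proof.
move=> z1 eE ze; case: eqP => [<-|/eqP za]; first by rewrite sep_refl.
apply/negP => /conn_start -/(_ za) [f]; rewrite !inE => /andP [fe fE] zf.
by rewrite (deg1_edge z1 fE eE) ?eqxx in fe.
Qed.

Lemma side_leaf z e : hdeg E z = 1 -> e \in E -> z \in e -> side e z = [set z].
Proof. by move=> z1 eE ze; apply/setP => v; rewrite mem_side sep_leaf // negbK in_set1 eq_sym. Qed.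

Lemma deg2_edges w : 1 < hdeg E w ->
  forall e, exists2 f, f \in E & (w \in f) && (f != e).
Proof.
move=> w2 e; rewrite /hdeg (cardsD1 e) in w2.
have : 0 < #|[set f in E | w \in f] :\ e| 
  by move: w2; case: (e \in _); rewrite ?add1n ?add0n ?ltnS // => /ltnW.
case/card_gt0P=> f; rewrite !inE => /andP [fe /andP [fE wf]].
by exists f; rewrite // wf fe.
Qed.

End TreeGeometry.

(** * Moving a branch *)

(** Edges at [w] that miss [B] must stay, hence the test. Edges deeper inside the branch do not
    contain [w], and the substitution leaves them unchanged. *)
Definition rep (V : finType) (w w' : V) (B e : {set V}) : {set V} :=
  if [disjoint e & B] then e else [set if v == w then w' else v | v in e].

Definition move_branch (V : finType) (w w' : V) (B : {set V}) (E : {set {set V}}) :=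
  [set rep w w' B e | e in E].

Section MoveBranch.
Variables (V : finType) (E : {set {set V}}).
Hypothesis tE : is_tree E.
Variables (w w' : V) (B : {set V}).
Hypothesis hB : hang E w B.
Hypothesis w'B : w' \notin B.
Hypothesis w'w : w' != w.
Implicit Types (e f : {set V}) (x y z u v a b : V).
Notation d := (dist E).
Notation rp := (rep w w' B).
Notation E' := (move_branch w w' B E).

Lemma rep_out e : [disjoint e & B] -> rp e = e.
Proof. by rewrite /rep => ->. Qed.

Lemma w_notin : w \notin B. Proof. by case: hB. Qed.

Lemma w'_notin_branch e : e \in E -> ~~ [disjoint e & B] -> w' \notin e.
Proof.
move=> eE /(hang_in hB eE) /subsetP sub; apply/negP => /sub.
by rewrite !inE (negPf w'w) (negPf w'B).
Qed.

Lemma mem_rep e x : e \in E -> ~~ [disjoint e & B] ->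
  (x \in rp e) = (x \in B) && (x \in e) || (x == w') && (w \in e).
Proof.
move=> eE nd; rewrite /rep (negPf nd); have sub := subsetP (hang_in hB eE nd).
apply/imsetP/orP => [[v ve ->]|[/andP [xB xe]|/andP [/eqP -> we]]].
- have [vw|vw] := eqVneq v w; first by right; rewrite eqxx -vw ve.
  by left; move: (sub v ve); rewrite !inE (negPf vw) ve => /= ->.
- exists x => //; case: eqP => // xw.
  by move: xB; rewrite xw (negPf w_notin).
- by exists w; rewrite ?eqxx.
Qed.

Lemma rep_disjoint e : e \in E -> [disjoint rp e & B] = [disjoint e & B].
Proof.
move=> eE; have [de|nd] := boolP [disjoint e & B]; first by rewrite rep_out.
apply/negbTE; case/pred0Pn: (nd) => x /= /andP [xe xB]; apply/pred0Pn; exists x.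
by rewrite /= mem_rep // xB xe.
Qed.

Lemma rep_inj : {in E &, injective rp}.
Proof.
move=> e f eE fE erf.
have := rep_disjoint eE; rewrite erf rep_disjoint // => dd.
have [de|nd] := boolP [disjoint e & B].
  by rewrite -(rep_out de) erf rep_out // dd.
have nf : ~~ [disjoint f & B] by rewrite dd.
apply/setP => x; have := congr1 (fun s : {set V} => x \in s) erf.
have := congr1 (fun s : {set V} => w' \in s) erf.
rewrite /= !mem_rep // eqxx (negPf w'B) /= => we.
have [->|xw] := eqVneq x w; first by rewrite we.
have [xB|xB] := boolP (x \in B).
  have /negPf -> : x != w' by apply: contraNneq w'B => <-.
  by rewrite !orbF.
have out g : g \in E -> ~~ [disjoint g & B] -> (x \in g) = false.
  move=> gE ng; apply/negP => /(subsetP (hang_in hB gE ng)).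
  by rewrite !inE (negPf xw) (negPf xB).
by rewrite !out.
Qed.

Lemma rep_card e : e \in E -> #|rp e| = #|e|.
Proof.
move=> eE; rewrite /rep; case: ifP => // /negbT nd; apply: card_in_imset => x y xe ye.
have w'e := w'_notin_branch eE nd.
case: (eqVneq x w) (eqVneq y w) => [->|xw] [->|yw] //.
- by move=> w'y; rewrite w'y ye in w'e.
- by move=> xw'; rewrite -xw' xe in w'e.
Qed.

Lemma rep_in e : e \in E -> rp e \in E'.
Proof. by move=> eE; apply: imset_f. Qed.

Lemma rep_in_D1 e f : e \in E -> f \in E -> f != e -> rp f \in E' :\ rp e.
Proof.
move=> eE fE fe; rewrite !inE rep_in // andbT.
by apply: contra fe => /eqP /rep_inj -> //.
Qed.

Lemma move_conn_out u v (F : {set {set V}}) : u \notin B -> v \notin B ->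
  (forall f, f \in E -> [disjoint f & B] -> f \in F) -> conn F u v.
Proof. exact: (hang_conn_out tE hB). Qed.

Lemma move_conn_in b (F : {set {set V}}) : b \in B ->
  (forall f, f \in E -> ~~ [disjoint f & B] -> rp f \in F) -> conn F b w'.
Proof.
move=> bB hF; apply: (hang_conn_in tE hB w'B bB) => f fE nd.
exists (rp f); first exact: hF.
move=> x xf; case: ifP => [xB|/negbT xB]; rewrite mem_rep //; first by rewrite xB xf.
have := subsetP (hang_in hB fE nd) x xf.
by rewrite !inE (negPf xB) orbF => /eqP xw; rewrite eqxx -xw xf orbT.
Qed.

(** What an edge can distinguish after the move: for an edge disjoint from [B] the whole branch sits
    at [w'], for an edge meeting [B] the whole outside is its old attachment vertex [w]. *)
Definition proj_out u := if u \in B then w' else u.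
Definition proj_in u := if u \in B then u else w.

Lemma move_sep_out e u v : e \in E -> [disjoint e & B] ->
  sep E' (rp e) u v = sep E e (proj_out u) (proj_out v).
Proof.
move=> eE de; congr (~~ _).
have pid x : x \notin B -> proj_out x = x by rewrite /proj_out => /negPf ->.
have pB x : proj_out x \notin B by rewrite /proj_out; case: ifP => [_|->].
apply/idP/idP => [|c].
  apply: (@conn_sim V _ _ proj_out) => g x y; rewrite !inE => /andP [ne /imsetP [f fE gf]].
  have fe : f != e by apply: contraNneq ne => <-; rewrite gf.
  rewrite gf; have [df|nf] := boolP [disjoint f & B].
    rewrite rep_out // => xf yf; rewrite !pid ?(disjointFr df) //.
    by apply: (@conn_edge _ _ f) => //; rewrite !inE fe.
  have pw z : z \in rp f -> proj_out z = w'.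
    rewrite mem_rep // /proj_out => /orP [/andP [-> //]|/andP [/eqP -> _]].
    by rewrite (negPf w'B).
  by move=> /pw -> /pw ->; apply: conn_refl.
have near x : conn (E' :\ rp e) x (proj_out x).
  have [xB|xB] := boolP (x \in B); last by rewrite pid // conn_refl.
  rewrite /proj_out xB; apply: (move_conn_in xB) => f fE nf.
  by apply: rep_in_D1 => //; apply: contraNneq nf => ->.
apply: conn_trans (near u) _; apply: conn_trans (_ : conn _ _ (proj_out v)) _; last first.
  by rewrite conn_sym.
(* The given connection lives in the original hypertree, where the branch hangs at [w], so detours
   into [B] are folded onto [w] and not onto [w']. *)
pose phi x := if x \in B then w else x.
have phiE x : x \notin B -> phi x = x by rewrite /phi => /negPf ->.
rewrite -(phiE _ (pB u)) -(phiE _ (pB v)).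
apply: (@conn_sim V _ _ phi) c => f x y; rewrite !inE => /andP [fe fE] xf yf.
have [df|nf] := boolP [disjoint f & B].
  rewrite !phiE ?(disjointFr df) //; apply: (@conn_edge _ _ f) => //.
  by rewrite -{1}(rep_out df) rep_in_D1.
have pw z : z \in f -> phi z = w.
  move/(subsetP (hang_in hB fE nf)); rewrite /phi !inE.
  by case/orP=> [/eqP ->|->] //; case: ifP.
by rewrite !pw //; apply: conn_refl.
Qed.

Lemma move_sep_in e u v : e \in E -> ~~ [disjoint e & B] ->
  sep E' (rp e) u v = sep E e (proj_in u) (proj_in v).
Proof.
move=> eE nde; congr (~~ _).
apply/idP/idP => [|c].
  apply: (@conn_sim V _ _ proj_in) => g x y; rewrite !inE => /andP [ne /imsetP [f fE gf]].
  have fe : f != e by apply: contraNneq ne => <-; rewrite gf.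
  rewrite gf; have [df|nf] := boolP [disjoint f & B].
    by rewrite rep_out // /proj_in => xf yf; rewrite !(disjointFr df) // conn_refl.
  have pw z : z \in rp f -> proj_in z \in f.
    rewrite mem_rep // /proj_in => /orP [/andP [-> //]|/andP [/eqP -> wf]].
    by rewrite (negPf w'B).
  by move=> /pw xf /pw yf; apply: (@conn_edge _ _ f) => //; rewrite !inE fe.
pose phi x := if x \in B then x else w'.
have near x : conn (E' :\ rp e) x (phi (proj_in x)).
  rewrite /phi /proj_in; have [xB|xB] := boolP (x \in B); first by rewrite xB conn_refl.
  rewrite (negPf w_notin); apply: move_conn_out => // f fE df.
  by rewrite -(rep_out df) rep_in_D1 //; apply: contraNneq nde => <-.
apply: conn_trans (near u) _; apply: conn_trans (_ : conn _ _ (phi (proj_in v))) _; last first.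
  by rewrite conn_sym.
apply: (@conn_sim V _ _ phi) c => f x y; rewrite !inE => /andP [fe fE] xf yf.
have [df|nf] := boolP [disjoint f & B].
  by rewrite /phi !(disjointFr df) // conn_refl.
apply: (@conn_edge _ _ (rp f)); first exact: rep_in_D1.
all: rewrite mem_rep // /phi.
  have := subsetP (hang_in hB fE nf) x xf; rewrite !inE; case: ifP => [-> //|/= _].
    by rewrite xf.
  by rewrite orbF => /eqP xw; rewrite eqxx -xw xf orbT.
have := subsetP (hang_in hB fE nf) y yf; rewrite !inE; case: ifP => [-> //|/= _].
  by rewrite yf.
by rewrite orbF => /eqP xw; rewrite eqxx -xw yf orbT.
Qed.

Lemma move_tree : is_tree E'.
Proof.
split=> [x y|g x y /imsetP [e eE ->]].
  have toA u : conn E' u w'.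
    have [uB|uB] := boolP (u \in B); first by apply: (move_conn_in uB) => f fE _; apply: rep_in.
    by apply: move_conn_out => // f fE df; rewrite -(rep_out df) rep_in.
  by apply: conn_trans (toA x) _; rewrite conn_sym.
have [de|nd] := boolP [disjoint e & B].
  rewrite move_sep_out // rep_out // /proj_out => xe ye xy.
  by rewrite !(disjointFr de) // (tree_sep tE).
rewrite move_sep_in // => xe ye xy.
have pe z : z \in rp e -> proj_in z \in e.
  rewrite mem_rep // /proj_in => /orP [/andP [-> //]|/andP [/eqP -> wf]].
  by rewrite (negPf w'B).
rewrite (tree_sep tE eE) ?pe //; apply: contra xy => /eqP.
move: xe ye; rewrite !mem_rep // /proj_in.
case/orP=> [/andP [xB _]|/andP [/eqP -> _]]; rewrite ?xB ?(negPf w'B);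
  case/orP=> [/andP [yB _]|/andP [/eqP -> _]]; rewrite ?yB ?(negPf w'B) //.
- by move=> ->.
- by move=> xw; rewrite xw (negPf w_notin) in xB.
- by move=> wy; rewrite -wy (negPf w_notin) in yB.
Qed.

Lemma move_distE u v : dist E' u v =
  \sum_(e in E | [disjoint e & B]) sep E e (proj_out u) (proj_out v) +
  \sum_(e in E | ~~ [disjoint e & B]) sep E e (proj_in u) (proj_in v).
Proof.
rewrite distE big_imset /=; last exact: rep_inj.
rewrite (bigID (fun e => [disjoint e & B])) /=.
by congr (_ + _); apply: eq_bigr => e /andP [eE de]; congr nat_of_bool; [apply: move_sep_out | apply: move_sep_in].
Qed.

Lemma dist_split u v : d u v =
  \sum_(e in E | [disjoint e & B]) sep E e u v +
  \sum_(e in E | ~~ [disjoint e & B]) sep E e u v.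
Proof. by rewrite distE (bigID (fun e => [disjoint e & B])). Qed.

Lemma move_dist_out u v : u \notin B -> v \notin B -> dist E' u v = d u v.
Proof.
move=> uB vB; rewrite move_distE dist_split /proj_out /proj_in (negPf uB) (negPf vB).
congr (_ + _); apply: eq_bigr => e /andP [eE nd].
by rewrite sep_refl (hang_sep_out tE hB).
Qed.

Lemma move_dist_in u v : u \in B -> v \in B -> dist E' u v = d u v.
Proof.
move=> uB vB; rewrite move_distE dist_split /proj_out /proj_in uB vB.
congr (_ + _); apply: eq_bigr => e /andP [eE nd].
by rewrite sep_refl (hang_sep_in tE hB) // !inE ?uB ?vB orbT.
Qed.

Lemma move_dist a b : a \notin B -> b \in B -> dist E' a b = d a w' + d w b.
Proof.
move=> aB bB; rewrite move_distE !dist_split /proj_out /proj_in (negPf aB) bB.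
rewrite -addnA; congr (_ + _).
rewrite [X in _ = X + _]big1 => [|e /andP [eE nd]]; last by rewrite (hang_sep_out tE hB).
rewrite [X in _ = _ + (X + _)]big1 // => e /andP [eE de].
by rewrite (hang_sep_in tE hB) // !inE ?eqxx ?bB ?orbT.
Qed.

Definition nmoved := #|[set e in E | (w \in e) && ~~ [disjoint e & B]]|.

Lemma move_hdegE v : hdeg E' v = #|[set e in E | v \in rp e]|.
Proof.
rewrite /hdeg -(card_in_imset (f := rp) (D := [set e in E | v \in rp e])).
  congr #|pred_of_set _|; apply/setP => g; rewrite inE; apply/andP/imsetP => [[]|].
    by move=> /imsetP [e eE ->] ve; exists e; rewrite // inE eE.
  by move=> [e]; rewrite inE => /andP [eE ve] ->; rewrite rep_in.
by move=> e f; rewrite !inE => /andP [eE _] /andP [fE _]; apply: rep_inj.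
Qed.

Lemma move_hdeg v : v != w -> v != w' -> hdeg E' v = hdeg E v.
Proof.
move=> vw vw'; rewrite move_hdegE; congr #|pred_of_set _|; apply/setP => e; rewrite !inE.
have [eE|//] := boolP (e \in E); have [de|nd] := boolP [disjoint e & B].
  by rewrite rep_out.
rewrite mem_rep // (negPf vw') orbF /=; apply/andb_idl => ve.
by move: (subsetP (hang_in hB eE nd) v ve); rewrite !inE (negPf vw).
Qed.

Lemma move_hdeg_w : hdeg E' w + nmoved = hdeg E w.
Proof.
rewrite move_hdegE /hdeg -(cardsID [set e : {set V} | [disjoint e & B]] [set e in E | w \in e]).
congr (_ + _); congr #|pred_of_set _|; apply/setP => e; rewrite !inE.
  have [eE|//] := boolP (e \in E); have [de|nd] := boolP [disjoint e & B].
    by rewrite rep_out // andbT.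
  by rewrite mem_rep // (negPf w_notin) andbF eq_sym (negPf w'w).
by case: (e \in E); case: (w \in e); rewrite //= ?andbF ?andbT.
Qed.

Lemma move_hdeg_w' : hdeg E' w' = hdeg E w' + nmoved.
Proof.
rewrite move_hdegE -(cardsID [set e : {set V} | [disjoint e & B]] [set e in E | _]).
congr (_ + _); congr #|pred_of_set _|; apply/setP => e; rewrite !inE;
  have [eE|] := boolP (e \in E); rewrite ?andbF //; have [de|nd] := boolP [disjoint e & B].
- by rewrite rep_out // andbT.
- by rewrite !andbF (negPf (w'_notin_branch eE nd)).
- by rewrite andbF.
- by rewrite mem_rep // (negPf w'B) eqxx andbT.
Qed.

Lemma move_card : #|E'| = #|E|.
Proof. exact: card_in_imset rep_inj. Qed.

Lemma move_uniform k : kuniform E k -> kuniform E' k.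
Proof. by move=> uE g /imsetP [e eE ->]; rewrite rep_card // uE. Qed.

End MoveBranch.

(** * Rayleigh quotients and the Perron vector *)

Section SymmetricForms.
Local Open Scope ring_scope.
Variables (R : realType) (n : nat).
Implicit Types (A M : 'M[R]_n) (u v y z : 'rV[R]_n) (t c : R).

Definition bil A u v : R := (u *m A *m v^T) 0 0.
Definition dotv u v : R := (u *m v^T) 0 0.

Lemma dotvE u v : dotv u v = \sum_i u 0 i * v 0 i.
Proof. by rewrite /dotv mxE; apply: eq_bigr => i _; rewrite mxE. Qed.

Lemma bilE A u v : bil A u v = \sum_i \sum_j u 0 i * A i j * v 0 j.
Proof.
rewrite /bil mxE exchange_big; apply: eq_bigr => j _; rewrite !mxE big_distrl.
by apply: eq_bigr => i _.
Qed.

Lemma bil_dot A u v : bil A u v = dotv (u *m A) v.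
Proof. by []. Qed.

Lemma dotvC u v : dotv u v = dotv v u.
Proof. by rewrite !dotvE; apply: eq_bigr => i _; rewrite mulrC. Qed.

Lemma bilC A u v : A^T = A -> bil A u v = bil A v u.
Proof. by move=> sA; rewrite bil_dot dotvC /dotv trmx_mul sA mulmxA. Qed.

Lemma dotv_ge0 v : 0 <= dotv v v.
Proof. by rewrite dotvE; apply: sumr_ge0 => i _; rewrite -expr2 sqr_ge0. Qed.

Lemma dotv_eq0 v : dotv v v = 0 -> v = 0.
Proof.
rewrite dotvE => /eqP; rewrite psumr_eq0 => [/allP h|i _]; last by rewrite -expr2 sqr_ge0.
apply/rowP => i; rewrite mxE; apply/eqP; rewrite -sqrf_eq0 expr2.
by have := h i; rewrite mem_index_enum => /(_ isT).
Qed.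

Lemma dotv_gt0 v : v != 0 -> 0 < dotv v v.
Proof.
by move=> v0; rewrite lt_neqAle dotv_ge0 andbT eq_sym; apply: contra v0 => /eqP/dotv_eq0 ->.
Qed.

Lemma bil_bound A : exists2 c, 0 < c & forall v, bil A v v <= c * dotv v v.
Proof.
exists (1 + \sum_i \sum_j `|A i j|) => [|v].
  by rewrite ltr_wpDr // sumr_ge0 // => i _; rewrite sumr_ge0.
rewrite mulrDl mul1r ler_wpDl ?dotv_ge0 // bilE big_distrl; apply: ler_sum => i _.
rewrite big_distrl; apply: ler_sum => j _ /=.
have comp k : v 0 k ^+ 2 <= dotv v v.
  rewrite dotvE (bigD1 k) //= -expr2 lerDl sumr_ge0 // => l _.
  by rewrite -expr2 sqr_ge0.
have ci := comp i; have cj := comp j.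
have -> : v 0 i * A i j * v 0 j = A i j * (v 0 i * v 0 j) by ring.
apply: (le_trans (ler_norm _)); rewrite normrM ler_wpM2l //.
have s1 := sqr_ge0 (v 0 i - v 0 j); have s2 := sqr_ge0 (v 0 i + v 0 j).
by rewrite ler_norml; apply/andP; split; lra.
Qed.

Lemma bil_shift A y z t : A^T = A ->
  bil A (y - t *: z) (y - t *: z) = bil A y y - 2 * t * bil A y z + t ^+ 2 * bil A z z.
Proof.
move=> sA; have zy : bil A z y = bil A y z by apply: bilC.
have trB : (y - t *: z)^T = y^T - t *: z^T by rewrite linearB linearZ.
rewrite /bil in zy *; rewrite trB !mulmxBl !mulmxBr -!scalemxAl -!scalemxAr.
rewrite !mxE in zy *; rewrite zy; ring.
Qed.

(** Positivity at [y - t z] with [z = y M] gives [0 <= - 2 t |z|^2 + t^2 c |z|^2], where [c] bounds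
    the form; [t = 1/c] minimizes the right-hand side. *)
Lemma psd_kernel M y : M^T = M -> (forall v, 0 <= bil M v v) -> bil M y y = 0 -> y *m M = 0.
Proof.
move=> sM pM y0; apply: dotv_eq0; apply/eqP; rewrite eq_le dotv_ge0 andbT.
set z := y *m M; have [c c0 cM] := bil_bound M.
have := pM (y - c^-1 *: z); rewrite bil_shift // y0 add0r.
have -> : bil M y z = dotv z z by [].
have h := cM z; set s := dotv z z in h *.
have c1 : c * c^-1 = 1 by rewrite divff ?gt_eqF.
have ci : 0 < c^-1 by rewrite invr_gt0.
have : c^-1 ^+ 2 * bil M z z <= c^-1 * s.
  have -> : c^-1 * s = c^-1 ^+ 2 * (c * s).
    by rewrite expr2 -!mulrA [c^-1 * (c * s)]mulrA [c^-1 * c]mulrC c1 mul1r.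
  by rewrite ler_wpM2l ?sqr_ge0.
move=> h1 h2; rewrite -(pmulr_rle0 _ ci); lra.
Qed.

(** Positivity at [y - t z], now with [z = y M^-1] and [t = 1/c] for a bound [c] of the form of
    [M^-1], leaves [|y|^2 / c] as a lower bound. *)
Lemma psd_invertible M : M^T = M -> (forall v, 0 <= bil M v v) -> M \in unitmx ->
  exists2 c, 0 < c & forall v, c * dotv v v <= bil M v v.
Proof.
move=> sM pM uM; have [c c0 cN] := bil_bound (invmx M).
exists c^-1 => [|y]; first by rewrite invr_gt0.
have sN : (invmx M)^T = invmx M by rewrite trmx_inv sM.
set z := y *m invmx M.
have := pM (y - c^-1 *: z); rewrite bil_shift //.
have -> : bil M y z = dotv y y.
  by rewrite bilC // bil_dot /z mulmxKV.
have -> : bil M z z = bil (invmx M) y y.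
  by rewrite bil_dot /z mulmxKV // dotvC.
have h := cN y; have s0 := dotv_ge0 y; set s := dotv y y in h s0 *.
have c1 : c * c^-1 = 1 by rewrite divff ?gt_eqF.
have ci : 0 < c^-1 by rewrite invr_gt0.
have : c^-1 ^+ 2 * bil (invmx M) y y <= c^-1 * s.
  have -> : c^-1 * s = c^-1 ^+ 2 * (c * s).
    by rewrite expr2 -!mulrA [c^-1 * (c * s)]mulrA [c^-1 * c]mulrC c1 mul1r.
  by rewrite ler_wpM2l ?sqr_ge0.
lra.
Qed.

Lemma bil_scalar_sub A a v : bil (a%:M - A) v v = a * dotv v v - bil A v v.
Proof.
rewrite /bil /dotv mulmxBr mulmxBl mul_mx_scalar -scalemxAl !mxE; ring.
Qed.

(* If the shifted form were invertible it would be bounded below, and the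
   supremum of the Rayleigh quotients could be lowered. *)
Lemma rayleigh_max A : (0 < n)%N -> A^T = A ->
  exists l : R, (forall v, bil A v v <= l * dotv v v) /\
    exists2 v : 'rV[R]_n, v != 0 & v *m A = l *: v.
Proof.
move=> n0 sA; have [c c0 cA] := bil_bound A.
pose S : classical_sets.set R := fun a => exists2 v : 'rV[R]_n, v != 0 & a = bil A v v / dotv v v.
have ubS b : (forall v, bil A v v <= b * dotv v v) -> classical_sets.ubound S b.
  by move=> hb a [v v0 ->]; rewrite ler_pdivrMr ?dotv_gt0.
have SN0 : classical_sets.nonempty S.
  pose v : 'rV[R]_n := const_mx 1; exists (bil A v v / dotv v v), v => //.
  apply/eqP => /rowP /(_ (Ordinal n0)); rewrite !mxE => /eqP.
  by rewrite oner_eq0.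
have hub : classical_sets.has_ubound S by exists c; apply: ubS.
pose l := sup S; have lA v : bil A v v <= l * dotv v v.
  have [->|v0] := eqVneq v 0.
    by rewrite /bil /dotv !mul0mx !mxE mulr0.
  rewrite -ler_pdivrMr ?dotv_gt0 //; apply: ub_le_sup hub _ _.
  by exists v.
exists l; split=> //.
have sM : (l%:M - A)^T = l%:M - A by rewrite linearB /= tr_scalar_mx sA.
have pM v : 0 <= bil (l%:M - A) v v by rewrite bil_scalar_sub subr_ge0.
have [uM|/negP nM] := boolP (l%:M - A \in unitmx).
  have [c' c'0 hc] := psd_invertible sM pM uM.
  have : l <= l - c'.
    apply: ge_sup SN0 _; apply: ubS => v; have := hc v.
    rewrite bil_scalar_sub; lra.
  by rewrite lerBrDr gerDl leNgt c'0.
have /det0P [v v0 vM] : \det (l%:M - A) == 0.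
  by move/negP: nM; rewrite unitmxE unitfE negbK.
exists v => //; apply/esym/eqP; rewrite -subr_eq0 -mul_mx_scalar -mulmxBr.
by rewrite vM.
Qed.

End SymmetricForms.

Section Perron.
Local Open Scope ring_scope.
Variables (R : realType) (V : finType) (E : {set {set V}}).
Implicit Types (x y : V -> R).

Definition dform y : R := \sum_u \sum_v y u * y v * (dist E u v)%:R.
Definition sqnorm y : R := \sum_u y u ^+ 2.
Definition transmission x u : R := \sum_v x v * (dist E u v)%:R.

Definition perron (r : R) x :=
  (forall v, 0 < x v) /\ forall u, transmission x u = r * x u.

Definition rowf y : 'rV[R]_#|V| := \row_i y (enum_val i).

Hypothesis tE : is_tree E.

Lemma sum_enum_val (F : V -> R) : \sum_u F u = \sum_(i < #|V|) F (enum_val i).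
Proof. by rewrite (reindex (@enum_val V (mem V))) //=; apply/onW_bij/enum_val_bij. Qed.

Lemma dist_mxE i j : dist_mx E R i j = (dist E (enum_val i) (enum_val j))%:R.
Proof. by rewrite mxE hdist_dist. Qed.

Lemma dist_mx_sym : (dist_mx E R)^T = dist_mx E R.
Proof. by apply/matrixP => i j; rewrite mxE !dist_mxE dist_sym. Qed.

Lemma dform_bil y : dform y = bil (dist_mx E R) (rowf y) (rowf y).
Proof.
rewrite bilE /dform sum_enum_val; apply: eq_bigr => i _; rewrite sum_enum_val.
by apply: eq_bigr => j _; rewrite dist_mxE !mxE; ring.
Qed.

Lemma sqnorm_dot y : sqnorm y = dotv (rowf y) (rowf y).
Proof. by rewrite dotvE /sqnorm sum_enum_val; apply: eq_bigr => i _; rewrite !mxE expr2. Qed.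

Lemma rowf_surj (v : 'rV[R]_#|V|) : rowf (fun u => v 0 (enum_rank u)) = v.
Proof. by apply/rowP => i; rewrite mxE enum_valK. Qed.

Lemma transmission_eigen r y : (rowf y *m dist_mx E R = r *: rowf y) <->
  forall u, transmission y u = r * y u.
Proof.
have key i : (rowf y *m dist_mx E R) 0 i = transmission y (enum_val i).
  rewrite mxE /transmission sum_enum_val; apply: eq_bigr => j _.
  by rewrite dist_mxE mxE dist_sym.
split=> [h u|h]; last by apply/rowP => i; rewrite key h !mxE.
by have := congr1 (fun v : 'rV__ => v 0 (enum_rank u)) h; rewrite /= key !mxE enum_rankK.
Qed.

Lemma dform_max_eigen r y : (forall z, dform z <= r * sqnorm z) ->
  dform y = r * sqnorm y -> forall u, transmission y u = r * y u.
Proof.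
move=> hr hy; apply/transmission_eigen.
apply/esym/eqP; rewrite -subr_eq0 -mul_mx_scalar -mulmxBr; apply/eqP.
apply: psd_kernel => [|v|].
- by rewrite linearB /= tr_scalar_mx dist_mx_sym.
- by rewrite bil_scalar_sub subr_ge0 -(rowf_surj v) -dform_bil -sqnorm_dot.
- by rewrite bil_scalar_sub -dform_bil -sqnorm_dot hy subrr.
Qed.

(** Distances are nonnegative, so taking absolute values of a top eigenvector does not lower the
    form and yields another maximizer. If it vanished at [u], its transmission there would be zero,
    hence so would every entry. The Rayleigh bound is exported because [move_max] tests the moved
    hypertree with a foreign vector. *)
Lemma perron_exists : (1 < #|V|)%N ->
  exists r x, [/\ perron r x, is_dsr E r & forall y, dform y <= r * sqnorm y].
Proof.
move=> V1; have V0 := ltnW V1.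
have [r [hr [v v0 vr]]] := rayleigh_max V0 dist_mx_sym.
have hr' y : dform y <= r * sqnorm y by rewrite dform_bil sqnorm_dot.
pose y u := v 0 (enum_rank u); pose x u := `|y u|.
have eqx : sqnorm x = sqnorm y.
  by apply: eq_bigr => u _; rewrite real_normK // num_real.
have fy : dform y = r * sqnorm y.
  rewrite dform_bil sqnorm_dot rowf_surj bil_dot vr.
  by rewrite /dotv -scalemxAl mxE.
have fx : dform x = r * sqnorm x.
  apply/eqP; rewrite eq_le hr' eqx -fy /=; apply: ler_sum => a _; apply: ler_sum => b _.
  by rewrite ler_wpM2r // /x -normrM ler_norm.
have ex := dform_max_eigen hr' fx.
have xge u : 0 <= x u by apply: normr_ge0.
have xpos u : 0 < x u.
  rewrite lt_neqAle xge andbT eq_sym; apply/eqP => xu0.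
  have := ex u; rewrite xu0 mulr0 => /eqP; rewrite psumr_eq0 => [/allP h|b _]; last first.
    by rewrite mulr_ge0.
  case/negP: v0; apply/eqP/rowP => i; rewrite mxE.
  have := h (enum_val i); rewrite mem_index_enum => /(_ isT).
  rewrite implyTb mulf_eq0 pnatr_eq0 dist_eq0 //.
  have yi : v 0 i = y (enum_val i) by rewrite /y enum_valK.
  rewrite yi; case/orP=> [|/eqP ui]; first by rewrite /x normr_eq0 => /eqP.
  by move/eqP: xu0; rewrite ui /x normr_eq0 => /eqP.
exists r, x; split=> //; split.
  apply/eigenvalueP; exists v => //.
move=> a /eigenvalueP [z za z0].
have := hr z; rewrite bil_dot za /dotv -scalemxAl mxE -/(dotv z z).
by rewrite ler_pM2r // dotv_gt0.
Qed.

End Perron.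

Lemma is_dsr_unique (R : realType) (V : finType) (E : {set {set V}}) (r r' : R) :
  is_dsr E r -> is_dsr E r' -> r = r'.
Proof. by move=> [e h] [e' h']; apply/le_anti/andP; split; [apply: h' | apply: h]. Qed.

(** * Change of the distance form under a move *)

Section MoveForm.
Local Open Scope ring_scope.
Variables (R : realType) (V : finType) (E : {set {set V}}).
Hypothesis tE : is_tree E.
Implicit Types (x y : V -> R).

Definition mass x (B : {set V}) : R := \sum_(b in B) x b.
Definition outer_tr F x (B : {set V}) v : R := \sum_(a in ~: B) x a * (dist F v a)%:R.
Definition bform F x y : R := \sum_u \sum_v x u * y v * (dist F u v)%:R.

Lemma bform_eigen (F : {set {set V}}) x y s : (forall u, transmission F y u = s * y u) ->
  bform F x y = s * \sum_u x u * y u.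
Proof.
move=> ey; rewrite /bform mulr_sumr; apply: eq_bigr => u _.
rewrite mulrCA -ey /transmission mulr_sumr; apply: eq_bigr => v _.
by rewrite mulrA.
Qed.

Lemma bform_sym (F : {set {set V}}) x y : bform F x y = bform F y x.
Proof.
rewrite /bform exchange_big; apply: eq_bigr => u _; apply: eq_bigr => v _.
by rewrite dist_sym; ring.
Qed.

Lemma sum_setID (B : {set V}) (F : V -> R) :
  \sum_u F u = \sum_(u in B) F u + \sum_(u in ~: B) F u.
Proof.
rewrite (bigID (mem B)) /=; congr (_ + _).
by apply: eq_bigl => u; rewrite in_setC.
Qed.

Variables (w w' : V) (B : {set V}).
Hypothesis hB : hang E w B.
Hypothesis w'B : w' \notin B.
Hypothesis w'w : w' != w.
Notation E' := (move_branch w w' B E).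

(** The two summands come from the two orders of a pair with exactly one vertex in [B]; they differ
    since [x] and [y] may be different vectors. *)
Lemma bform_move x y : bform E' x y - bform E x y =
  mass x B * (outer_tr E y B w' - outer_tr E y B w) +
  mass y B * (outer_tr E x B w' - outer_tr E x B w).
Proof.
have key z t : \sum_(u in B) \sum_(v in ~: B) z u * t v * ((dist E' u v)%:R - (dist E u v)%:R)
   = mass z B * (outer_tr E t B w' - outer_tr E t B w).
  rewrite /mass mulr_suml; apply: eq_bigr => b bB.
  rewrite /outer_tr -sumrB mulr_sumr; apply: eq_bigr => a; rewrite in_setC => aB.
  rewrite dist_sym (move_dist tE hB w'B aB bB) [dist E b a]dist_sym.
  rewrite (hang_dist tE hB aB bB) !natrD ![dist E a _]dist_sym; ring.
rewrite /bform -sumrB.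
under eq_bigr => u _ do rewrite -sumrB.
under eq_bigr => u _ do under eq_bigr => v _ do rewrite -mulrBr.
rewrite (sum_setID B) -[X in _ = X + _]key.
have -> : mass y B * (outer_tr E x B w' - outer_tr E x B w) =
  \sum_(u in ~: B) \sum_(v in B) x u * y v * ((dist E' u v)%:R - (dist E u v)%:R).
  rewrite exchange_big -key; apply: eq_bigr => u _; apply: eq_bigr => v _.
  by rewrite ![dist _ u v]dist_sym [y u * _]mulrC.
congr (_ + _); apply: eq_bigr => u uB; rewrite (sum_setID B).
  rewrite big1 ?add0r // => v vB.
  by rewrite (move_dist_in tE hB w'B) // subrr mulr0.
rewrite in_setC in uB; rewrite [X in _ + X]big1 ?addr0 // => v; rewrite in_setC => vB.
by rewrite (move_dist_out tE hB w'B) // subrr mulr0.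
Qed.

Lemma outer_tr_diff x : outer_tr E x B w' - outer_tr E x B w =
  transmission E x w' - transmission E x w - mass x B * (dist E w' w)%:R.
Proof.
have wB : w \notin B by case: hB.
rewrite /transmission !(sum_setID B) -!/(outer_tr _ _ _ _).
have -> : \sum_(v in B) x v * (dist E w' v)%:R =
  \sum_(v in B) x v * (dist E w v)%:R + mass x B * (dist E w' w)%:R.
  rewrite /mass mulr_suml -big_split; apply: eq_bigr => v vB /=.
  rewrite (hang_dist tE hB w'B vB) natrD; ring.
ring.
Qed.

(** In [E'] the branch is nearer to [w'], in [E] it is nearer to [w]; hence the mass term has the
    sign opposite to [outer_tr_diff]. *)
Lemma outer_tr_diff' x : outer_tr E x B w' - outer_tr E x B w =
  transmission E' x w' - transmission E' x w + mass x B * (dist E w' w)%:R.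
Proof.
have wB : w \notin B by case: hB.
rewrite /transmission !(sum_setID B).
have outE v : v \notin B -> \sum_(a in ~: B) x a * (dist E' v a)%:R = outer_tr E x B v.
  move=> vB; apply: eq_bigr => a; rewrite in_setC => aB.
  by rewrite (move_dist_out tE hB w'B).
rewrite !outE //.
have -> : \sum_(v in B) x v * (dist E' w v)%:R =
  \sum_(v in B) x v * (dist E' w' v)%:R + mass x B * (dist E w' w)%:R.
  rewrite /mass mulr_suml -big_split; apply: eq_bigr => v vB /=.
  rewrite !(move_dist tE hB w'B) // !natrD dist_refl [dist E w w']dist_sym; ring.
ring.
Qed.

(* Evaluating the form of D(E') - D(E) at the two Perron vectors leaves only
   their values at w and w'. *)
Lemma bform_move_perron r x r' x' : perron E r x -> perron E' r' x' ->
  (r' - r) * \sum_u x u * x' u =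
  mass x B * (r' * (x' w' - x' w)) + mass x' B * (r * (x w' - x w)).
Proof.
move=> [_ ex] [_ ex'].
have := bform_move x x'; rewrite (bform_eigen x ex') [bform E x x']bform_sym (bform_eigen x' ex).
have -> : \sum_u x' u * x u = \sum_u x u * x' u by apply: eq_bigr => u _; rewrite mulrC.
rewrite outer_tr_diff' outer_tr_diff !ex !ex' => h.
rewrite mulrBl; rewrite h; ring.
Qed.

End MoveForm.

Definition max_dsr (R : realType) (k m Delta n : nat) (r : R) : Prop :=
  forall (V' : finType) (E' : {set {set V'}}) (r' : R),
    in_class E' k m Delta n -> is_dsr E' r' -> (r' <= r)%R.

(** * The inequality that extremality imposes on a move *)

Section MoveMax.
Local Open Scope ring_scope.
Variables (R : realType) (k m Delta n : nat) (V : finType) (E : {set {set V}}).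
Variables (r : R) (x : V -> R).
Hypotheses (k2 : (2 <= k)%N) (m1 : (1 <= m)%N) (n1 : (1 <= n)%N).
Hypothesis cE : in_class E k m Delta n.
Hypothesis maxE : max_dsr k m Delta n r.
Hypothesis pE : perron E r x.

Lemma class_tree : is_tree E.
Proof. by case: cE => _ h _ _ _; apply: hypertree_tree. Qed.

Lemma class_card e : e \in E -> #|e| = k.
Proof. by case: cE => h _ _ _ _; apply: h. Qed.

Lemma class_card_gt1 : (1 < #|V|)%N.
Proof.
case: cE => uE _ cm _ _; move: m1; rewrite -cm => /card_gt0P [e eE].
by apply: leq_trans (max_card (mem e)); rewrite (uE _ eE).
Qed.

Lemma class_deg_le v : (hdeg E v <= Delta)%N.
Proof. by case: cE => _ _ _ <- _; apply: (leq_bigmax (F := hdeg E)). Qed.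

Variables (w w' : V) (B : {set V}).
Hypothesis hB : hang E w B.
Hypothesis w'B : w' \notin B.
Hypothesis w'w : w' != w.
Notation E' := (move_branch w w' B E).

Lemma move_class : (forall v, (hdeg E' v <= Delta)%N) ->
  #|[set v | hdeg E' v == Delta]| = n -> in_class E' k m Delta n.
Proof.
have tE := class_tree; case: cE => uE _ cm _ _ le card_n; split=> //.
- exact: move_uniform.
- by apply: tree_hypertree; apply: move_tree.
- by rewrite move_card.
have /card_gt0P [v] : (0 < #|[set v | hdeg E' v == Delta]|)%N by rewrite card_n.
rewrite inE => /eqP dv; apply/eqP; rewrite eqn_leq; apply/andP; split.
  by apply/bigmax_leqP => u _.
by rewrite -dv /maxdeg; apply: (leq_bigmax (F := hdeg E')).
Qed.

(** The move exchanges the degrees of [w] and [w'], so the new degree function is the old one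
    composed with a transposition. *)
Lemma move_class_swap : hdeg E w = (hdeg E w' + nmoved E w B)%N -> in_class E' k m Delta n.
Proof.
move=> sw; have tE := class_tree.
have dw : hdeg E' w = hdeg E w'.
  by have := move_hdeg_w hB w'B w'w; rewrite sw => /eqP; rewrite eqn_add2r => /eqP.
have dw' : hdeg E' w' = hdeg E w by rewrite (move_hdeg_w' hB w'B w'w) sw.
have dv v : hdeg E' v = hdeg E (tperm w w' v).
  case: tpermP => [->|->|/eqP vw /eqP vw'] //.
  by rewrite (move_hdeg hB w'B).
apply: move_class => [v|]; first by rewrite dv class_deg_le.
case: cE => _ _ _ _ <-; rewrite -(card_imset _ (@perm_inj _ (tperm w w'))).
congr #|pred_of_set _|; apply/setP => v; rewrite inE.
apply/imsetP/idP => [[u]|dvD].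
  by rewrite inE dv => h ->.
by exists (tperm w w' v); rewrite ?tpermK // inE dv tpermK.
Qed.

(** If the outer transmission did not drop, [x] would attain the Rayleigh maximum of the moved
    hypertree with the same value [r], and so be its eigenvector. The two eigenvalue equations at
    [w] then differ by the mass of [B] times [d(w, w')], which is positive. *)
Lemma move_max : B != set0 -> in_class E' k m Delta n ->
  outer_tr E x B w' < outer_tr E x B w.
Proof.
move=> /set0Pn [b0 b0B] cE'; have tE := class_tree; rewrite ltNge; apply/negP => hle.
have tE' : is_tree E' by case: cE' => _ h _ _ _; apply: hypertree_tree.
have [r' [x' [[pos' ex'] dE' ray']]] := perron_exists R tE' class_card_gt1.
have r'r : r' <= r := maxE cE' dE'.
have [pos ex] := pE.
have sq : sqnorm x = \sum_u x u * x u by apply: eq_bigr => u _; rewrite expr2.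
have sqpos : 0 < sqnorm x.
  rewrite /sqnorm (bigD1 b0) //= ltr_wpDr ?exprn_gt0 // sumr_ge0 // => u _.
  by rewrite sqr_ge0.
have massB : 0 < mass x B.
  by rewrite /mass (bigD1 b0) //= ltr_wpDr // sumr_ge0 // => u _; apply: ltW.
have h := bform_move tE hB w'B x x.
rewrite (bform_eigen (F := E) x ex) -sq in h.
have ge : 0 <= bform E' x x - r * sqnorm x.
  by rewrite h; apply: addr_ge0; apply: mulr_ge0; rewrite ?subr_ge0 // ltW.
have le' := ray' x; rewrite -[dform E' x]/(bform E' x x) in le'.
have rr' : r' = r.
  apply/le_anti; rewrite r'r /=.
  rewrite -(ler_pM2r sqpos); lra.
have eq' : dform E' x = r' * sqnorm x.
  apply/le_anti; rewrite ray' /= rr' -[dform E' x]/(bform E' x x); lra.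
have := dform_max_eigen tE' ray' eq' w; rewrite rr' -ex.
have wB : w \notin B by case: hB.
rewrite /transmission !(sum_setID B).
have -> : \sum_(a in ~: B) x a * (dist E' w a)%:R = \sum_(a in ~: B) x a * (dist E w a)%:R.
  apply: eq_bigr => a; rewrite in_setC => aB.
  by rewrite (move_dist_out tE hB w'B).
have -> : \sum_(v in B) x v * (dist E' w v)%:R =
  \sum_(v in B) x v * (dist E w v)%:R + mass x B * (dist E w' w)%:R.
  rewrite /mass mulr_suml -big_split; apply: eq_bigr => v vB /=.
  rewrite (move_dist tE hB w'B) // natrD [dist E w w']dist_sym; ring.
have : 0 < mass x B * (dist E w' w)%:R :> R.
  by rewrite mulr_gt0 // ltr0n dist_gt0.
lra.
Qed.

End MoveMax.

(** * Degrees and branching in an extremal hypertree *)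

Section ExtremalTree.
Local Open Scope ring_scope.
Variables (R : realType) (k m Delta n : nat) (V : finType) (E : {set {set V}}).
Variables (r : R) (x : V -> R).
Hypotheses (k2 : (2 <= k)%N) (m1 : (1 <= m)%N) (n1 : (1 <= n)%N) (D3 : (3 <= Delta)%N).
Hypothesis cE : in_class E k m Delta n.
Hypothesis maxE : max_dsr k m Delta n r.
Hypothesis pE : perron E r x.
Notation tE := (class_tree cE).
Notation V1 := (class_card_gt1 k2 m1 cE).
Notation d := (dist E).
Notation side := (side E).
Notation X := (\sum_u x u).
Notation T := (transmission E x).
Notation mu := (mass x).

Lemma x_gt0 v : 0 < x v. Proof. by case: pE. Qed.
Lemma x_ge0 v : 0 <= x v. Proof. exact/ltW/x_gt0. Qed.
Lemma trE v : T v = r * x v. Proof. by case: pE. Qed.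

Lemma mass_ge0 (S : {set V}) : 0 <= mu S.
Proof. by apply: sumr_ge0 => v _; apply: x_ge0. Qed.

Lemma mass1 v : mu [set v] = x v.
Proof. by rewrite /mass big_set1. Qed.

Lemma massU (S S' : {set V}) : [disjoint S & S'] -> mu (S :|: S') = mu S + mu S'.
Proof.
move=> dS; rewrite /mass -bigU //=.
by apply: eq_bigl => v; rewrite inE.
Qed.

Lemma mass_sub (S S' : {set V}) : S \subset S' -> mu S <= mu S'.
Proof.
move=> sS; rewrite -(setID S' S) massU; last first.
  by rewrite -setI_eq0; apply/eqP/setP => v; rewrite !inE; case: (v \in S); rewrite ?andbF.
by move/setIidPr: sS => ->; rewrite lerDl mass_ge0.
Qed.

Lemma mass_le_tot S : mu S <= X.
Proof.
by rewrite (sum_setID S) lerDl; apply: sumr_ge0 => v _; apply: x_ge0.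
Qed.

Lemma massC S : mu (~: S) = X - mu S.
Proof. by rewrite (sum_setID S) /mass; ring. Qed.

Lemma mass_ge1 v (S : {set V}) : v \in S -> x v <= mu S.
Proof. by move=> vS; rewrite -mass1; apply: mass_sub; rewrite sub1set. Qed.

(** Lets a pointwise inequality between distances and indicators be summed against [x] into one
    between outer transmissions and masses. *)
Lemma mass_ind (S B : {set V}) : [disjoint S & B] ->
  \sum_(a in ~: B) x a * (a \in S)%:R = mu S.
Proof.
move=> dS; rewrite big_mkcond /mass [RHS]big_mkcond; apply: eq_bigr => a _ /=.
rewrite in_setC; have [aS|aS] := boolP (a \in S).
  by rewrite (disjointFr dS) // mulr1.
by rewrite mulr0; case: ifP.
Qed.

Lemma mass_ind_tot (S : {set V}) : \sum_a x a * (a \in S)%:R = mu S.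
Proof.
rewrite /mass [RHS]big_mkcond; apply: eq_bigr => a _ /=.
by case: (a \in S); rewrite ?mulr1 ?mulr0.
Qed.

Lemma deg_gt0 v : (0 < hdeg E v)%N.
Proof.
have /card_gt1P [a [b [_ _ ab]]] : (1 < #|V|)%N := V1.
have [u uv] : exists u, v != u.
  by case: (eqVneq v a) => [->|va]; [exists b | exists a].
have [f fE vf] := conn_start uv (tree_conn tE v u).
by apply/card_gt0P; exists f; rewrite inE fE.
Qed.

Lemma deg1 v : ~~ (1 < hdeg E v)%N -> hdeg E v = 1%N.
Proof. by move=> h; apply/eqP; rewrite eqn_leq deg_gt0 leqNgt h. Qed.

Lemma edge_other e v : e \in E -> exists2 u, u \in e & u != v.
Proof.
move=> eE; have : (1 < #|e|)%N by rewrite (class_card cE eE).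
case/card_gt1P => a [b [ae be ab]].
by case: (eqVneq a v) => [av|]; [exists b; rewrite // -av eq_sym | exists a].
Qed.

Lemma r_gt0 : 0 < r.
Proof.
have /card_gt0P [v _] : (0 < #|V|)%N by apply: ltnW V1.
have /card_gt0P [f] := deg_gt0 v; rewrite inE => /andP [fE vf].
have [u uf uv] := edge_other v fE.
have : 0 < r * x v; last by rewrite pmulr_lgt0 ?x_gt0.
rewrite -trE /transmission (bigD1 u) //= ltr_pwDl //.
  by rewrite mulr_gt0 ?x_gt0 // ltr0n (dist_gt0 tE) eq_sym.
by apply: sumr_ge0 => a _; rewrite mulr_ge0 ?x_ge0.
Qed.

Lemma tr_lower v : X - x v <= T v.
Proof.
rewrite /transmission (bigD1 v) //= [X in _ <= X](bigD1 v) //= dist_refl mulr0 add0r addrAC subrr add0r.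
by apply: ler_sum => a av; rewrite ler_peMr ?x_ge0 // ler1n (dist_gt0 tE) eq_sym.
Qed.

Lemma tr_lip u v : T u <= T v + (d u v)%:R * X.
Proof.
rewrite mulr_sumr -big_split; apply: ler_sum => a _ /=.
rewrite [_%:R * x a]mulrC -mulrDr ler_wpM2l ?x_ge0 // -natrD ler_nat addnC.
exact: dist_triangle.
Qed.

(** Vertices behind neither [u] nor [v] are equidistant from both; those behind one of them are one
    step nearer to it. *)
Lemma tr_edge e u v : e \in E -> u \in e -> v \in e ->
  T u + mu (side e u) = T v + mu (side e v).
Proof.
move=> eE ue ve; rewrite -!mass_ind_tot -!big_split; apply: eq_bigr => a _ /=.
rewrite -!mulrDr; congr (_ * _); rewrite -!natrD; congr (_%:R).
have := dist_step a eE ue ve; rewrite !mem_side.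
by case: (sep E e u a); case: (sep E e v a) => /=; move: (d u a) (d v a); clear; lia.
Qed.

Lemma tr_leaf e z b : e \in E -> z \in e -> b \in e -> hdeg E z = 1%N ->
  T z + x z = T b + mu (side e b).
Proof. by move=> eE ze be z1; rewrite -(tr_edge eE ze be) side_leaf // mass1. Qed.

(** Strictness comes from the term [a = z], which is present because [z] lies outside [B]: it is
    zero on the left and positive on the right. *)
Lemma outer_convex e1 e2 z y1 y2 (B : {set V}) :
  e1 \in E -> e2 \in E -> e1 != e2 -> z \in e1 -> z \in e2 -> y1 \in e1 -> y2 \in e2 ->
  y1 != z -> y2 != z -> z \notin B ->
  2 * outer_tr E x B z < outer_tr E x B y1 + outer_tr E x B y2.
Proof.
move=> e1E e2E e12 z1 z2 y1e y2e y1z y2z zB.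
have zB' : z \in ~: B by rewrite in_setC.
rewrite /outer_tr mulr_sumr -big_split /= (bigD1 z) //= [X in _ < X](bigD1 z) //=.
apply: ltr_leD.
  rewrite dist_refl mulr0 mulr0 (dist_edge tE e1E y1e z1) (dist_edge tE e2E y2e z2).
  by rewrite y1z y2z addr_gt0 // mulr1 x_gt0.
apply: ler_sum => a _; rewrite mulrCA -mulrDr ler_wpM2l ?x_ge0 //.
by rewrite -natrM -natrD ler_nat; apply: (dist_convex tE a e1E e2E).
Qed.

(* Otherwise move one branch at w to a vertex maximizing the outer transmission:
   by convexity that vertex is a leaf. *)
Lemma deg_trichotomy w : [|| hdeg E w == 1%N, hdeg E w == 2%N | hdeg E w == Delta].
Proof.
apply: contraT; rewrite !negb_or => /and3P [w1 w2 wD].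
have w3 : (2 < hdeg E w)%N by have := deg_gt0 w; lia.
have wlt : (hdeg E w < Delta)%N by rewrite ltn_neqAle wD (class_deg_le cE).
have [e eE /andP [we _]] := deg2_edges (ltnW w3) set0.
have hB := hang_sideC tE eE we; set B := ~: side e w in hB.
have wS : w \in side e w by apply: side_self.
pose z := [arg max_(a > w in side e w) outer_tr E x B a]%O.
have [zS zmax] : z \in side e w /\ forall a, a \in side e w -> outer_tr E x B a <= outer_tr E x B z.
  by rewrite /z; case: arg_maxP.
have zB : z \notin B by rewrite in_setC negbK.
have ez : z \in e -> z = w.
  by move=> ze; apply/eqP; rewrite -(side_edge_mem tE eE).
have [z1|z2] := leqP (hdeg E z) 1; last first.
  (* If [z = w], two edges remain without [e] because [w] has degree at least 3; any other [z]
     behind [w] does not lie on [e]. *)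
  have /card_gt1P [e1 [e2]] : (1 < #|[set f in E | z \in f] :\ e|)%N.
    have [zw|zw] := eqVneq z w.
      by move: w3; rewrite /hdeg (cardsD1 e) inE eE we zw.
    move: z2; rewrite /hdeg (cardsD1 e) inE eE /=.
    by have [/ez/eqP|] := boolP (z \in e); rewrite ?(negPf zw).
  rewrite !inE => -[/and3P [e1e e1E z1] /and3P [e2e e2E z2'] e12].
  have [y1 y1e y1z] := edge_other z e1E; have [y2 y2e y2z] := edge_other z e2E.
  have y1S : y1 \in side e w by rewrite (side_edge _ e1E e1e y1e z1).
  have y2S : y2 \in side e w by rewrite (side_edge _ e2E e2e y2e z2').
  have := outer_convex e1E e2E e12 z1 z2' y1e y2e y1z y2z zB.
  have := zmax _ y1S; have := zmax _ y2S; lra.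
have zd : hdeg E z = 1%N by apply: deg1; rewrite -leqNgt.
have zw : z != w by apply: contraTneq w3 => <-; rewrite zd.
have [u ue uw] := edge_other w eE.
have uB : u \in B by rewrite in_setC (side_edge_mem tE eE).
have nm : nmoved E w B = 1%N.
  apply/eqP/cards1P; exists e; apply/setP => f; rewrite !inE.
  apply/and3P/eqP => [[fE wf nd]|->].
    apply: contraNeq nd => fe; apply/pred0P => t /=; rewrite in_setC.
    by apply/negP => /andP [tf]; rewrite (side_edge w fE fe tf wf) wS.
  by split=> //; apply/pred0Pn; exists u; rewrite /= ue.
have dw := move_hdeg_w hB zB zw; have dz := move_hdeg_w' hB zB zw.
rewrite nm in dw dz; set E' := move_branch w z B E in dw dz.
have dv v : v != w -> v != z -> hdeg E' v = hdeg E v by apply: (move_hdeg hB zB).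
have cls : in_class E' k m Delta n.
  apply: (move_class n1 cE hB zB zw) => [v|].
    have [->|vw] := eqVneq v w; first by rewrite -/E' (leq_trans _ (ltnW wlt)) // -dw leq_addr.
    have [->|vz] := eqVneq v z; first by rewrite -/E' dz zd ltnW.
    by rewrite -/E' dv // (class_deg_le cE).
  case: cE => _ _ _ _ <-; congr #|pred_of_set _|; apply/setP => v; rewrite !inE -/E'.
  have [->|vw] := eqVneq v w; first by rewrite !ltn_eqF // (leq_ltn_trans _ wlt) // -dw leq_addr.
  have [->|vz] := eqVneq v z; first by rewrite dz zd !ltn_eqF // ltnW.
  by rewrite dv.
have : B != set0 by apply/set0Pn; exists u.
move=> B0; have := move_max k2 m1 cE maxE pE hB zB zw B0 cls.
by rewrite ltNge zmax.
Qed.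

(* Moving all branches at y other than e to the leaf z swaps two degrees. *)
Lemma leaf_outer_lt e y z : e \in E -> y \in e -> (1 < hdeg E y)%N ->
  z \notin side e y -> hdeg E z = 1%N ->
  outer_tr E x (side e y :\ y) z < outer_tr E x (side e y :\ y) y.
Proof.
move=> eE ye y2 zS z1; have hB := hang_side tE eE ye; set B := side e y :\ y in hB *.
have zB : z \notin B by rewrite in_setD1 (negPf zS) andbF.
have zy : z != y by apply: contraNneq zS => ->; apply: side_self.
have meet f : f \in E -> y \in f -> f != e -> exists2 u, u \in f & u \in B.
  move=> fE yf fe; have [u uf uy] := edge_other y fE; exists u => //.
  by rewrite in_setD1 uy (side_edge y fE fe uf yf) side_self.
have nm : (nmoved E y B).+1 = hdeg E y.
  rewrite /hdeg (cardsD1 e) inE eE ye; congr _.+1; congr #|pred_of_set _|.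
  apply/setP => f; rewrite !inE; apply/and3P/and3P => [[fE yf nd]|[fe fE yf]].
    split=> //; apply: contraNneq nd => ->; apply/pred0P => t /=; rewrite in_setD1.
    apply/negP => /andP [te /andP [ty]]; rewrite (side_edge_mem tE eE ye te).
    by rewrite (negPf ty).
  split=> //; have [u uf uB] := meet f fE yf fe.
  by apply/pred0Pn; exists u; rewrite /= uf.
have B0 : B != set0.
  have [f fE /andP [yf fe]] := deg2_edges y2 e; have [u _ uB] := meet f fE yf fe.
  by apply/set0Pn; exists u.
apply: (move_max k2 m1 cE maxE pE hB zB zy B0).
by apply: (move_class_swap n1 cE hB zB zy); rewrite z1 add1n nm.
Qed.

Lemma dist_pred z y : z != y -> exists f b,
  [/\ f \in E, z \in f, b \in f & (d b y).+1 = d z y].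
Proof.
move=> zy; have [vs [es h]] := conn_hpath (tree_conn tE z y).
have := hpath_size tE h; case: vs es h => [|b vs] [|f es] //.
  by rewrite hpath_nil (negPf zy).
rewrite hpath_cons => /and5P [_ _ fE zf /andP [bf hp]] <-.
by exists f, b; rewrite /= (hpath_size tE hp).
Qed.

(* The deepest vertex z behind y lies in a pendant edge f with base b. *)
Lemma deepest e y : e \in E -> y \in e -> (1 < hdeg E y)%N ->
  exists f b z, [/\ f \in E, z \in f, b \in f, z != b & f \subset side e y] /\
  (d y b).+1 = d y z /\
  forall a, a \in f -> a != b -> hdeg E a = 1%N /\ d y a = d y z.
Proof.
move=> eE ye y2; have yS : y \in side e y by apply: side_self.
pose z := [arg max_(a > y in side e y) d y a].
have [zS zmax] : z \in side e y /\ forall a, a \in side e y -> (d y a <= d y z)%N.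
  by rewrite /z; case: arg_maxnP => // i iS h; split=> // a; apply: h.
have zy : z != y.
  have [f fE /andP [yf fe]] := deg2_edges y2 e; have [u uf uy] := edge_other y fE.
  have uS : u \in side e y by rewrite (side_edge y fE fe uf yf).
  have := zmax u uS; rewrite (dist_edge tE fE yf uf) [y == u]eq_sym uy.
  by rewrite (dist_gt0 tE) eq_sym.
have [f [b [fE zf bf dbz]]] := dist_pred zy.
have fe : f != e.
  by apply: contra zy => /eqP fe; rewrite -(side_edge_mem tE eE ye) // -fe.
have fS : f \subset side e y.
  by apply/subsetP => t tf; rewrite (side_edge y fE fe tf zf).
have zb : z != b.
  by apply/eqP => zb; have : (d b y < d z y)%N; [rewrite -dbz | rewrite zb ltnn].
have st a : a \in f -> (d b y + sep E f a y = d a y + sep E f b y)%N.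
  by move=> af; apply: (dist_step y fE bf af).
have sbn : sep E f b y = false.
  by have := st z zf; rewrite -dbz; case: (sep E f b y) => //;
    case: (sep E f z y) => /=; move: (d b y); clear; lia.
have sa a : a \in f -> a != b -> sep E f a y.
  move=> af ab; rewrite sep_sym -(@sep_eq _ E f b y a) ?sbn //.
  by rewrite (tree_sep tE fE) // eq_sym.
have da a : a \in f -> a != b -> d y a = d y z.
  move=> af ab; rewrite ![d y _]dist_sym -dbz; have := st a af.
  by rewrite sbn sa // addn0 addn1.
have ay a : a \in f -> a != b -> a != y.
  by move=> af ab; rewrite eq_sym -(dist_gt0 tE) da // (dist_gt0 tE) eq_sym.
exists f, b, z; split=> //; split=> [|a]; first by rewrite ![d y _]dist_sym.
move=> af ab; split; last exact: da.
(* A second edge at [a] would lead away from [y], to a vertex deeper than [z]. *)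
apply: deg1; apply/negP => a2; have [g gE /andP [ag gf]] := deg2_edges a2 f.
have [c cg ca] := edge_other a gE.
have aS : a \in side e y by apply: (subsetP fS).
have ge : g != e.
  apply: contra (ay a af ab) => /eqP ge; rewrite -(side_edge_mem tE eE ye) // -ge //.
have cS : c \in side e y by rewrite (side_edge y gE ge cg ag).
have := zmax c cS; rewrite -(da a af ab) ![d y _]dist_sym.
have := dist_step y gE ag cg.
have fg : f != g by rewrite eq_sym.
have nag := sep_excl tE fE gE fg af ag (sa a af ab).
rewrite (negPf nag) addn0 => <-.
have -> : sep E g c y.
  by rewrite sep_sym -(@sep_eq _ E g a y c) // (tree_sep tE gE) // eq_sym.
by rewrite addn1 ltnn.
Qed.

End ExtremalTree.

(** * At most two vertices of degree at least 2 in an edge *)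

Section ExtremalShape.
Local Open Scope ring_scope.
Variables (R : realType) (k m Delta n : nat) (V : finType) (E : {set {set V}}).
Variables (r : R) (x : V -> R).
Hypotheses (k2 : (2 <= k)%N) (m1 : (1 <= m)%N) (n1 : (1 <= n)%N).
Hypothesis cE : in_class E k m Delta n.
Hypothesis maxE : max_dsr k m Delta n r.
Hypothesis pE : perron E r x.
Notation tE := (class_tree cE).
Notation V1 := (class_card_gt1 k2 m1 cE).
Notation d := (dist E).
Notation side := (side E).
Notation X := (\sum_u x u).
Notation T := (transmission E x).
Notation mu := (mass x).
Let xnn v : 0 <= x v := x_ge0 pE v.
Let Tr v : T v = r * x v := trE pE v.

Lemma leaf_dist e z b a : e \in E -> z \in e -> b \in e -> hdeg E z = 1%N -> a != z ->
  (forall c, c \in e -> c != b -> hdeg E c = 1%N) -> a \notin e :\ b ->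
  d z a = (d b a).+1.
Proof.
move=> eE ze be z1 az leaf ae; have := dist_step a eE ze be.
rewrite (sep_leaf a z1) // eq_sym az addn1 => <-.
suff -> : sep E e b a = false by rewrite addn0.
apply/negbTE; rewrite -mem_side.
have e0 : e != set0 by apply/set0Pn; exists z.
have [c ce aS] := side_cover tE a eE e0.
have [<- //|cb] := eqVneq c b.
by move: aS; rewrite (side_leaf (leaf c ce cb)) // inE => /eqP ac; rewrite ac in_setD1 cb ce in ae.
Qed.

Lemma edge_card_D1 e b : e \in E -> b \in e -> #|e :\ b| = k.-1.
Proof.
move=> eE be; have := class_card cE eE.
by rewrite (cardsD1 b) be => <-.
Qed.

(** The leaves of one pendant edge satisfy the same equation [tr_leaf], hence have equal weight. *)
Lemma pendant_mass e z b : e \in E -> z \in e -> b \in e -> z != b ->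
  (forall c, c \in e -> c != b -> hdeg E c = 1%N) -> mu (e :\ b) = k.-1%:R * x z.
Proof.
move=> eE ze be zb leaf.
rewrite -(edge_card_D1 eE be) mulr_natl -sumr_const; apply: eq_bigr => c.
rewrite in_setD1 => /andP [cb ce].
have h1 := tr_leaf x eE ze be (leaf z ze zb); have h2 := tr_leaf x eE ce be (leaf c ce cb).
have : (r + 1) * x c = (r + 1) * x z by rewrite !mulrDl !mul1r -!Tr h1 h2.
by apply: mulfI; rewrite gt_eqF // ltr_wpDl // ltW // (r_gt0 k2 m1 cE pE).
Qed.

(* The deepest leaf z behind w2 violates leaf_outer_lt for y = w1: if t_i is the
   mass behind w_i and z hangs at b, the gain is at least 2 x w1 + x b - x z,
   while x z <= x b + X / r and X <= 2 r x w1. *)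
Lemma three_in_edge_lt e w1 w2 w3 : e \in E -> w1 \in e -> w2 \in e -> w3 \in e ->
  w1 != w2 -> w1 != w3 -> w2 != w3 ->
  (1 < hdeg E w1)%N -> (1 < hdeg E w2)%N ->
  mu (side e w1) <= mu (side e w3) -> mu (side e w2) <= mu (side e w3) -> False.
Proof.
move=> eE e1 e2 e3 n12 n13 n23 dw1 dw2 t13 t23.
have [f [b [z [[fE zf bf zb fS] [dbz leaf]]]]] := deepest k2 m1 cE eE e2 dw2.
have [z1 _] := leaf z zf zb.
have zS : z \in side e w2 := subsetP fS z zf; have bS : b \in side e w2 := subsetP fS b bf.
set B := side e w1 :\ w1; set P := f :\ b; set L := d w2 z.
have zn : z \notin side e w1 by rewrite (side_disj tE eE e2 e1 _ zS) // eq_sym.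
have lt := leaf_outer_lt k2 m1 n1 cE maxE pE eE e1 dw1 zn z1; rewrite -/B in lt.
have PS : P \subset side e w2 by apply: subset_trans fS; apply: subD1set.
(* Case on the vertex [c] of [e] behind which [a] lies. Off the side of [w2], [z] is farther from
   [a] than [w1] by at least [L], and by [L + 1] if [a = w1]. On that side it is nearer by at most
   [L - 1], up to one unit on the pendant edge and another at [z] itself. *)
have pw a : a \notin B -> (d w1 a + L * (a \in side e w3) + L.+1 * (a == w1) <=
   d z a + L.-1 * (a \in side e w2) + (a \in P) + (a == z))%N.
  move=> aB; have e0 : e != set0 by apply/set0Pn; exists w1.
  have [c ce aS] := side_cover tE a eE e0.
  have notin c' : c' \in e -> c' != c -> (a \in side e c') = false.
    by move=> c'e c'c; apply: (side_disj tE eE ce c'e _ aS); rewrite eq_sym.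
  have L0 : (0 < L)%N by rewrite /L -dbz.
  case: (eqVneq c w2) => [cw2|cw2]; last first.
    have w2c : w2 != c by rewrite eq_sym.
    rewrite (notin w2) // muln0 addn0 (dist_across tE eE e2 ce w2c zS aS).
    rewrite [d z w2]dist_sym -/L.
    have [cw1|cw1] := eqVneq c w1.
      have aw1 : a = w1.
        by apply/eqP; move: aB; rewrite in_setD1 -cw1 aS andbT negbK.
      rewrite (notin w3) ?cw1 1?eq_sym // aw1 !dist_refl eqxx muln0 muln1 addn0 add0n addn1.
      by rewrite -!addnA leq_addr.
    have w1c : w1 != c by rewrite eq_sym.
    rewrite (dist_across tE eE e1 ce w1c (side_self _ _ _) aS) dist_refl add0n.
    have -> : (a == w1) = false.
      by apply/negP => /eqP aw; have := notin w1 e1 w1c; rewrite aw side_self.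
    rewrite muln0 !addn0; move: L0; case: (a \in side e w3); rewrite ?muln1 ?muln0;
      move: (L) (d c a) (nat_of_bool (a \in P)) (nat_of_bool (a == z)); clear; lia.
  have n32 : w3 != w2 by rewrite eq_sym.
  rewrite {}cw2 in aS notin *.
  have -> : (a == w1) = false.
    by apply/negP => /eqP aw; have := notin w1 e1 n12; rewrite aw side_self.
  rewrite (notin w3 e3 n32) aS !muln0 !addn0 muln1.
  rewrite (dist_across tE eE e1 e2 n12 (side_self _ _ _) aS) dist_refl add0n.
  have [aP|aP] := boolP (a \in P).
    move: aP; rewrite in_setD1 => /andP [ab af]; have [a1 ->] := leaf a af ab; rewrite -/L.
    rewrite (dist_edge tE fE zf af) eq_sym.
    by move: L0; case: (a == z) => /=; move: (L); clear; lia.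
  have az : a != z by apply: contraNneq aP => ->; rewrite in_setD1 zb zf.
  rewrite (leaf_dist fE zf bf z1 az _ aP); last by move=> c' c'f c'b; case: (leaf c' c'f c'b).
  rewrite (negPf az) !addn0; have := dist_triangle E b w2 a; rewrite /L -dbz /=.
  by move: (d w2 a) (d w2 b) (d b a); clear; lia.
have sm : outer_tr E x B w1 + L%:R * mu (side e w3) + L.+1%:R * x w1 <=
  outer_tr E x B z + L.-1%:R * mu (side e w2) + mu P + x z.
  move: pw; move: (L) (L.-1) (L.+1) => Lc Lb La pw.
  have dis c (S : {set V}) : c \in e -> c != w1 -> S \subset side e c -> [disjoint S & B].
    move=> ce cw1 sub; apply/pred0P => a /=; apply/negP => /andP [/(subsetP sub) aS].
    by rewrite in_setD1 (side_disj tE eE ce e1 cw1 aS) andbF.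
  have w2w1 : w2 != w1 by rewrite eq_sym.
  have w3w1 : w3 != w1 by rewrite eq_sym.
  have w1B : [disjoint [set w1] & B] by rewrite disjoints1 in_setD1 eqxx.
  have zB : [disjoint [set z] & B] by apply: (dis w2) => //; rewrite sub1set.
  rewrite -(mass_ind x (dis w3 _ e3 w3w1 (subxx _))) -(mass_ind x (dis w2 _ e2 w2w1 (subxx _))).
  rewrite -(mass_ind x (dis w2 _ e2 w2w1 PS)) -(mass1 x w1) -(mass_ind x w1B).
  rewrite -(mass1 x z) -(mass_ind x zB) /outer_tr !mulr_sumr -!big_split.
  apply: ler_sum => a; rewrite in_setC => aB /=; have := pw a aB.
  rewrite -(ler_nat R) !natrD !natrM => h; rewrite !in_set1.
  have := ler_wpM2l (xnn a) h; rewrite !mulrDr => h'.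
  rewrite !(mulrCA _ (x a)); exact: h'.
have rp := r_gt0 k2 m1 cE pE.
have LE : L%:R = L.-1%:R + 1 :> R by rewrite natr1 prednK // /L -dbz.
have L1 : (1 : R) <= L%:R by rewrite ler1n /L -dbz.
have t2P : x b + mu P <= mu (side e w2).
  rewrite -mass1 -massU; last by rewrite disjoints1 in_setD1 eqxx.
  by apply: (mass_sub pE); rewrite subUset sub1set bS.
have T1 := tr_lower cE pE w1; rewrite Tr in T1.
have Tz : T z <= T b + X.
  have := tr_lip pE z b; rewrite (dist_edge tE fE zf bf) zb mul1r; exact.
rewrite !Tr in Tz.
have t1w : x w1 <= mu (side e w1) by apply: (mass_ge1 pE); apply: side_self.
have Xge : mu (side e w1) + mu (side e w3) <= X.
  rewrite -massU; first exact: (mass_le_tot pE).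
  apply/pred0P => a /=; apply/negP => /andP [a1]; by rewrite (side_disj tE eE e1 e3 n13 a1).
(* As [x w1] is at most the mass behind [w1], which is at most that behind [w3], it is at most
   [X / 2]. So [X <= 2 (X - x w1) <= 2 r x w1]. *)
have key : r * x z <= r * (x b + 2 * x w1) by rewrite mulrDr; lra.
have {}key : x z <= x b + 2 * x w1 by rewrite ler_pM2l in key.
have m3 := mass_ge0 pE (side e w3).
have : L.-1%:R * mu (side e w2) <= L.-1%:R * mu (side e w3) by rewrite ler_wpM2l.
have : x w1 * 1 <= x w1 * L%:R by rewrite ler_wpM2l.
rewrite -natr1 LE in sm *; rewrite !mulrDl !mulrDr in sm *; lra.
Qed.

(** The vertex with the heaviest side takes the role of [w3]. *)
Lemma three_in_edge e w1 w2 w3 : e \in E -> w1 \in e -> w2 \in e -> w3 \in e ->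
  w1 != w2 -> w1 != w3 -> w2 != w3 ->
  (1 < hdeg E w1)%N -> (1 < hdeg E w2)%N -> (1 < hdeg E w3)%N -> False.
Proof.
move=> eE e1 e2 e3 n12 n13 n23 d1 d2 d3.
have n21 : w2 != w1 by rewrite eq_sym.
have n31 : w3 != w1 by rewrite eq_sym.
have n32 : w3 != w2 by rewrite eq_sym.
have [t12|t21] := leP (mu (side e w1)) (mu (side e w2)).
  have [t23|t32] := leP (mu (side e w2)) (mu (side e w3)).
    exact: (three_in_edge_lt eE e1 e2 e3 n12 n13 n23 d1 d2 (le_trans t12 t23) t23).
  exact: (three_in_edge_lt eE e1 e3 e2 n13 n12 n32 d1 d3 t12 (ltW t32)).
have [t13|t31] := leP (mu (side e w1)) (mu (side e w3)).
  exact: (three_in_edge_lt eE e1 e2 e3 n12 n13 n23 d1 d2 t13 (le_trans (ltW t21) t13)).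
exact: (three_in_edge_lt eE e2 e3 e1 n23 n21 n31 d2 d3 (ltW t21) (ltW t31)).
Qed.

End ExtremalShape.

(** * At most two non-pendant edges at a vertex *)

Section ExtremalBranching.
Local Open Scope ring_scope.
Variables (R : realType) (k m Delta n : nat) (V : finType) (E : {set {set V}}).
Variables (r : R) (x : V -> R).
Hypotheses (k2 : (2 <= k)%N) (m1 : (1 <= m)%N) (n1 : (1 <= n)%N).
Hypothesis cE : in_class E k m Delta n.
Hypothesis maxE : max_dsr k m Delta n r.
Hypothesis pE : perron E r x.
Notation tE := (class_tree cE).
Notation d := (dist E).
Notation side := (side E).
Notation X := (\sum_u x u).
Notation T := (transmission E x).
Notation mu := (mass x).

Lemma side_sub e e' w y : e \in E -> e' \in E -> e != e' -> w \in e -> w \in e' ->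
  y \in e' -> y != w -> side e' y \subset side e w.
Proof.
move=> eE e'E ee' we we' ye' yw; apply/subsetP => a aS.
have s' : sep E e' w a.
  by rewrite -[sep _ _ _ _]negbK -mem_side (side_disj tE e'E ye' we' yw aS).
by rewrite mem_side (sep_excl tE e'E eE _ we' we s') // eq_sym.
Qed.

Definition twigs (e : {set V}) w y := e :\ w :\ y.

Lemma in_twigs e w y c : (c \in twigs e w y) = [&& c != y, c != w & c \in e].
Proof. by rewrite /twigs !in_setD1. Qed.

Lemma side_twigs e w y : e \in E -> w \in e -> y \in e -> y != w ->
  (forall c, c \in e -> c != w -> c != y -> hdeg E c = 1%N) ->
  mu (side e w) = X - mu (side e y) - mu (twigs e w y).
Proof.
move=> eE we ye yw leaf.
have -> : side e w = ~: (side e y :|: twigs e w y).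
  apply/setP => a; rewrite in_setC in_setU in_twigs.
  have e0 : e != set0 by apply/set0Pn; exists w.
  have [c ce aS] := side_cover tE a eE e0.
  have [cw|cw] := eqVneq c w.
    rewrite cw in aS; rewrite aS (side_disj tE eE we ye _ aS) 1?eq_sym //=.
    symmetry; apply/negP => /and3P [_ aw ae].
    by move: aS; rewrite (side_edge_mem tE eE we ae) (negPf aw).
  rewrite (side_disj tE eE ce we cw aS).
  have [cy|cy] := eqVneq c y; first by rewrite -cy aS.
  move: aS; rewrite (side_leaf (leaf c ce cw cy)) // in_set1 => /eqP ->.
  by rewrite cy cw ce orbT.
rewrite massC massU; first by ring.
apply/pred0P => a /=; rewrite in_twigs; apply/negP => /and4P [aS ay aw ae].
by move: aS; rewrite (side_edge_mem tE eE ye ae) (negPf ay).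
Qed.

Lemma twigs_mass e w y : e \in E -> w \in e -> y \in e -> y != w ->
  (forall c, c \in e -> c != w -> c != y -> hdeg E c = 1%N) ->
  (r + 1) * mu (twigs e w y) = (k - 2)%:R * (r * x y + mu (side e y)).
Proof.
move=> eE we ye yw leaf.
have -> : (k - 2)%N = #|twigs e w y|.
  have := class_card cE eE; rewrite (cardsD1 w) we (cardsD1 y) in_setD1 yw ye /= => <-.
  by rewrite addnA addKn.
rewrite mulr_natl -sumr_const mulr_sumr; apply: eq_bigr => c.
rewrite in_twigs => /and3P [cy cw ce].
have := tr_leaf x eE ce ye (leaf c ce cw cy).
by rewrite !(trE pE) mulrDl mul1r.
Qed.

(* As in three_in_edge_lt with z the deepest leaf behind y2, at depth L: the gain
   is at least ((L + 1)(k - 1) + 1) x y1 + L x w - k x z, which is nonnegative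
   because x y2 <= x y1, r x z <= r x y2 + L X and k X <= r ((k - 1) x y1 + x w). *)
Lemma three_branches_lt w e1 e2 e3 y1 y2 y3 :
  e1 \in E -> e2 \in E -> e3 \in E -> e1 != e2 -> e1 != e3 -> e2 != e3 ->
  w \in e1 -> w \in e2 -> w \in e3 -> y1 \in e1 -> y2 \in e2 -> y3 \in e3 ->
  y1 != w -> y2 != w -> y3 != w ->
  (1 < hdeg E y1)%N -> (1 < hdeg E y2)%N ->
  (forall c, c \in e1 -> c != w -> c != y1 -> hdeg E c = 1%N) ->
  (forall c, c \in e2 -> c != w -> c != y2 -> hdeg E c = 1%N) ->
  mu (side e1 y1) <= mu (side e2 y2) -> mu (side e2 y2) <= mu (side e3 y3) -> False.
Proof.
move=> e1E e2E e3E n12 n13 n23 w1 w2 w3 ye1 ye2 ye3 yw1 yw2 yw3 dy1 dy2 lf1 lf2 t12 t23.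
have n21 : e2 != e1 by rewrite eq_sym.
have wy1 : w != y1 by rewrite eq_sym.
have wy2 : w != y2 by rewrite eq_sym.
have [f [b [z [[fE zf bf zb fS] [dbz leaf]]]]] := deepest k2 m1 cE e2E ye2 dy2.
have [z1 _] := leaf z zf zb.
have zS : z \in side e2 y2 := subsetP fS z zf; have bS : b \in side e2 y2 := subsetP fS b bf.
set B := side e1 y1 :\ y1; set P := f :\ b; set L := d y2 z.
have s21 : side e2 y2 \subset side e1 w := side_sub e1E e2E n12 w1 w2 ye2 yw2.
have s31 : side e3 y3 \subset side e1 w := side_sub e1E e3E n13 w1 w3 ye3 yw3.
have s32 : side e3 y3 \subset side e2 w := side_sub e2E e3E n23 w2 w3 ye3 yw3.
have s12 : side e1 y1 \subset side e2 w := side_sub e2E e1E n21 w2 w1 ye1 yw1.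
have disw1 a : a \in side e1 w -> (a \in side e1 y1) = false.
  by move=> aS; apply: (side_disj tE e1E w1 ye1 wy1 aS).
have y1w : (y1 \in side e1 w) = false := side_disj tE e1E ye1 w1 yw1 (side_self _ _ _).
have zn : z \notin side e1 y1 by rewrite (disw1 _ (subsetP s21 z zS)).
have lt := leaf_outer_lt k2 m1 n1 cE maxE pE e1E ye1 dy1 zn z1; rewrite -/B in lt.
have PS : P \subset side e2 y2 by apply: subset_trans fS; apply: subD1set.
have L0 : (0 < L)%N by rewrite /L -dbz.
set O := twigs e1 w y1.
have OS2 a : a \in O -> a \in side e2 w.
  rewrite in_twigs => /and3P [_ _ ae]; rewrite (side_edge w e1E n12 ae w1).
  exact: side_self.
(* Case on the vertex of [e2] behind which [a] lies, and for [a] behind [w] also on that of [e1].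
   Here [y1] is at distance 1 and [z] at distance [L + 1] from [w]; behind [y2] the vertex [z] is
   nearer by at most [L], with the same corrections on the pendant edge and at [z] as in
   [three_in_edge_lt]. *)
have pw a : a \notin B ->
  (d y1 a + L.+2 * (a == y1) + L.+1 * (a \in O) + L * (a == w) + L * (a \in side e3 y3) <=
   d z a + L * (a \in side e2 y2) + (a \in P) + (a == z))%N.
  move=> aB; have e10 : e1 != set0 by apply/set0Pn; exists w.
  have e20 : e2 != set0 by apply/set0Pn; exists w.
  have y1S2 : y1 \in side e2 w by apply: (subsetP s12); apply: side_self.
  have [c2 ce2 aS2] := side_cover tE a e2E e20.
  have dy1w : d y1 w = 1%N by rewrite (dist_edge tE e1E ye1 w1) yw1.
  have not2 : c2 != w -> [/\ (a == y1) = false, (a \in O) = false, (a == w) = false &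
      (a \in side e3 y3) = false].
    move=> c2w; have aw2 : (a \in side e2 w) = false := side_disj tE e2E ce2 w2 c2w aS2.
    split; apply: contraFF aw2.
    - by move/eqP ->.
    - exact: OS2.
    - by move/eqP ->; apply: side_self.
    - exact: (subsetP s32).
  have [c2y|c2y] := eqVneq c2 y2.
    have c2w : c2 != w by rewrite c2y.
    have [-> -> -> ->] := not2 c2w; rewrite c2y in aS2; rewrite aS2.
    rewrite (dist_across tE e2E w2 ye2 wy2 y1S2 aS2) dy1w !muln0 !addn0 muln1.
    have [aP|aP] := boolP (a \in P).
      move: aP; rewrite in_setD1 => /andP [ab af]; have [a1 ->] := leaf a af ab; rewrite -/L.
      rewrite (dist_edge tE fE zf af) [z == a]eq_sym.
      by case: (a == z) => /=; move: (L); clear; lia.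
    have az : a != z by apply: contraNneq aP => ->; rewrite in_setD1 zb zf.
    rewrite (leaf_dist cE fE zf bf z1 az _ aP); last by move=> c' c'f c'b; case: (leaf c' c'f c'b).
    rewrite (negPf az) !addn0; have := dist_triangle E b y2 a; rewrite /L -dbz.
    by move: (d y2 a) (d y2 b) (d b a); clear; lia.
  have y2c2 : y2 != c2 by rewrite eq_sym.
  rewrite (side_disj tE e2E ce2 ye2 c2y aS2) (dist_across tE e2E ye2 ce2 y2c2 zS aS2).
  rewrite [d z y2]dist_sym -/L.
  have [c2w|c2w] := eqVneq c2 w; last first.
    have [-> -> -> ->] := not2 c2w; have wc2 : w != c2 by rewrite eq_sym.
    rewrite (dist_across tE e2E w2 ce2 wc2 y1S2 aS2) dy1w !muln0 !addn0.
    move: L0; move: (L) (d c2 a) (nat_of_bool (a \in P)) (nat_of_bool (a == z)); clear; lia.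
  rewrite {}c2w {ce2 not2 c2y y2c2} in aS2 *.
  have [c1 ce1 aS1] := side_cover tE a e1E e10.
  have [c1y|c1y] := eqVneq c1 y1.
    have -> : a = y1 by apply/eqP; move: aB; rewrite in_setD1 -c1y aS1 andbT negbK.
    have -> : (y1 \in O) = false by rewrite in_twigs eqxx.
    have -> : (y1 \in side e3 y3) = false.
      by apply: contraFF y1w; apply: (subsetP s31).
    rewrite eqxx (negPf yw1) dist_refl dist_sym dy1w !muln0 !addn0 muln1 add0n.
    move: (L) (nat_of_bool _) (nat_of_bool _); clear; lia.
  have ay1 : (a == y1) = false.
    apply/negP => /eqP ay; have := side_disj tE e1E ce1 ye1 c1y aS1.
    by rewrite ay side_self.
  have y1c1 : y1 != c1 by rewrite eq_sym.
  rewrite ay1 (dist_across tE e1E ye1 ce1 y1c1 (side_self _ _ _) aS1) dist_refl muln0 addn0.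
  have [c1w|c1w] := eqVneq c1 w.
    rewrite {}c1w in aS1 *.
    have -> : (a \in O) = false.
      apply/negP; rewrite in_twigs => /and3P [_ aw ae].
      by move: aS1; rewrite (side_edge_mem tE e1E w1 ae) (negPf aw).
    rewrite muln0 !addn0 add0n.
    case: (eqVneq a w) => [->|_].
      rewrite (side_edge_mem tE e3E ye3 w3) [w == y3]eq_sym (negPf yw3).
      by rewrite muln1 muln0 addn0; move: (L) (d w w) (nat_of_bool _) (nat_of_bool _); clear; lia.
    rewrite muln0 addn0; case: (a \in side e3 y3); rewrite ?muln1 ?muln0;
      move: (L) (d w a) (nat_of_bool _) (nat_of_bool _); clear; lia.
  have wc1 : w != c1 by rewrite eq_sym.
  have naw : (a \in side e1 w) = false := side_disj tE e1E ce1 w1 c1w aS1.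
  rewrite (dist_across tE e1E w1 ce1 wc1 (side_self _ _ _) aS1) dist_refl.
  have -> : (a == w) = false by apply: contraFF naw => /eqP ->; apply: side_self.
  have -> : (a \in side e3 y3) = false by apply: contraFF naw; apply: (subsetP s31).
  rewrite !muln0 !addn0; move: L0; case: (a \in O); rewrite ?muln1 ?muln0;
    move: (L) (d c1 a) (nat_of_bool _) (nat_of_bool _); clear; lia.
have disB (S : {set V}) : S \subset ~: side e1 y1 -> [disjoint S & B].
  move=> sub; apply/pred0P => a /=; apply/negP => /andP [/(subsetP sub)].
  by rewrite in_setC in_setD1 => /negPf ->; rewrite andbF.
have sC (S : {set V}) : S \subset side e1 w -> [disjoint S & B].
  by move=> sub; apply: disB; apply/subsetP => a /(subsetP sub) /disw1 h; rewrite in_setC h.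
have sm : outer_tr E x B y1 + L.+2%:R * x y1 + L.+1%:R * mu O + L%:R * x w
    + L%:R * mu (side e3 y3) <= outer_tr E x B z + L%:R * mu (side e2 y2) + mu P + x z.
  move: pw; move: (L) (L.+1) (L.+2) => La Lb Lc pw.
  have y1B : [disjoint [set y1] & B] by rewrite disjoints1 in_setD1 eqxx.
  have wB : [disjoint [set w] & B] by apply: sC; rewrite sub1set side_self.
  have zB : [disjoint [set z] & B] by apply: sC; rewrite sub1set (subsetP s21).
  have OB : [disjoint O & B].
    apply: disB; apply/subsetP => a; rewrite in_twigs in_setC => /and3P [ay _ ae].
    by rewrite (side_edge_mem tE e1E ye1 ae).
  rewrite -(mass_ind x (sC _ s31)) -(mass_ind x (sC _ s21)) -(mass_ind x OB).
  rewrite -(mass_ind x (sC _ (subset_trans PS s21))).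
  rewrite -(mass1 x y1) -(mass_ind x y1B) -(mass1 x w) -(mass_ind x wB) -(mass1 x z) -(mass_ind x zB).
  rewrite /outer_tr !mulr_sumr -!big_split.
  apply: ler_sum => a; rewrite in_setC => aB /=; have := pw a aB.
  rewrite -(ler_nat R) !natrD !natrM => h; rewrite !in_set1.
  have := ler_wpM2l (x_ge0 pE a) h; rewrite !mulrDr => h'.
  rewrite !(mulrCA _ (x a)); exact: h'.
have rp := r_gt0 k2 m1 cE pE.
have leafP c : c \in f -> c != b -> hdeg E c = 1%N by move=> cf cb; case: (leaf c cf cb).
have PE : mu P = k.-1%:R * x z := pendant_mass k2 m1 cE pE fE zf bf zb leafP.
have xge := x_ge0 pE; have Tr := trE pE.
set t1 := mu (side e1 y1) in t12 *; set t2 := mu (side e2 y2) in t12 t23 sm *.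
set t3 := mu (side e3 y3) in t23 sm *.
have [t1y t2y] : x y1 <= t1 /\ x y2 <= t2.
  by split; apply: (mass_ge1 pE); apply: side_self.
have twig1 := twigs_mass e1E w1 ye1 yw1 lf1; have twig2 := twigs_mass e2E w2 ye2 yw2 lf2.
have side1 := side_twigs e1E w1 ye1 yw1 lf1; have side2 := side_twigs e2E w2 ye2 yw2 lf2.
have edge1 := tr_edge x e1E ye1 w1; have edge2 := tr_edge x e2E ye2 w2.
rewrite -/t1 -/O in twig1 side1 edge1; rewrite -/t2 in twig2 side2 edge2.
rewrite side1 !Tr in edge1; rewrite side2 !Tr in edge2.
set O2 := mu (twigs e2 w y2) in twig2 side2 edge2.
set K : R := (k - 2)%:R in twig1 twig2.
have K0 : 0 <= K by apply: ler0n.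
have K1 : k.-1%:R = K + 1 :> R by rewrite natr1; congr (_%:R); move: k2; clear; lia.
have yw : x w <= x y1.
  rewrite -(ler_pM2l rp).
  have : t2 <= mu (side e1 w) by apply: (mass_sub pE).
  rewrite side1; lra.
(* Subtract the edge equations of [e1] and [e2], which share the term at [w], and eliminate both
   twig masses: [x y1 - x y2] is a positive multiple of [t2 - t1]. *)
have y21 : x y2 <= x y1.
  have pos : 0 < r * (r + 1 + K).
    by rewrite mulr_gt0 // -addrA ltr_wpDr // addr_ge0 // ler01.
  rewrite -subr_ge0 -(pmulr_rge0 _ pos).
  have -> : r * (r + 1 + K) * (x y1 - x y2) = (t2 - t1) * (2 * (r + 1) + K).
    have e3' : r * x y1 - r * x y2 = 2 * (t2 - t1) + O2 - mu O by lra.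
    have : (r + 1) * (r * x y1 - r * x y2) = (r + 1) * (2 * (t2 - t1) + O2 - mu O) by rewrite e3'.
    have -> : (r + 1) * (2 * (t2 - t1) + O2 - mu O) =
       2 * (r + 1) * (t2 - t1) + (r + 1) * O2 - (r + 1) * mu O by ring.
    rewrite twig1 twig2 => h.
    have -> : r * (r + 1 + K) * (x y1 - x y2) = (r + 1) * (r * x y1 - r * x y2) + K * (r * x y1 - r * x y2) by ring.
    rewrite h; ring.
  apply: mulr_ge0; first by rewrite subr_ge0.
  by rewrite addr_ge0 // mulr_ge0 // addr_ge0 // ltW.
have Oy : K * x y1 <= mu O.
  have r1 : 0 < r + 1 by rewrite ltr_wpDr.
  rewrite -(ler_pM2l r1) twig1 mulrCA; apply: ler_wpM2l => //.
  rewrite mulrDl mul1r; lra.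
(* Vertices behind [y2] and [y3] are at distance at least 2 from [y1], which adds [t2 + t3] to the
   trivial bound [X - x y1]; moreover [t2 >= t1 >= x y1] and [t3 >= t1 >= x y1 >= x w]. *)
have Ty1 : X + x w <= r * x y1.
  have : X - x y1 + t2 + t3 <= T y1.
    have dS : [disjoint side e2 y2 & side e3 y3].
      apply/pred0P => a /=; apply/negP => /andP [a2 a3].
      have wy : w != y2 by rewrite eq_sym.
      by have := side_disj tE e2E w2 ye2 wy (subsetP s32 a a3); rewrite a2.
    rewrite /t2 /t3 -(mass_ind_tot x (side e2 y2)) -(mass_ind_tot x (side e3 y3)).
    rewrite -(mass1 x y1) -massC -mass_ind_tot -!big_split; apply: ler_sum => a _ /=.
    rewrite -!mulrDr ler_wpM2l // -!natrD ler_nat in_setC in_set1.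
    have [->|ay] := eqVneq a y1.
      have -> : (y1 \in side e2 y2) = false.
        by apply: contraFF y1w; apply: (subsetP s21).
      have -> : (y1 \in side e3 y3) = false.
        by apply: contraFF y1w; apply: (subsetP s31).
      by [].
    have far y e : e \in E -> w \in e -> y \in e -> w != y -> y1 \in side e w ->
        a \in side e y -> (2 <= d y1 a)%N.
      move=> eE we ye wy y1S aS; rewrite (dist_across tE eE we ye wy y1S aS).
      by rewrite (dist_edge tE e1E ye1 w1) yw1.
    have y1S2 : y1 \in side e2 w by apply: (subsetP s12); apply: side_self.
    have y1S3 : y1 \in side e3 w.
      have n31 : e3 != e1 by rewrite eq_sym.
      by apply: (subsetP (side_sub e3E e1E n31 w3 w1 ye1 yw1)); apply: side_self.
    have wy3 : w != y3 by rewrite eq_sym.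
    have [a2|a2] := boolP (a \in side e2 y2).
      by rewrite (disjointFr dS a2) (far y2 e2).
    have [a3|a3] := boolP (a \in side e3 y3); first by rewrite (far y3 e3).
    by rewrite !addn0 (dist_gt0 tE) eq_sym.
  rewrite Tr; lra.
have Tw := tr_lower cE pE w; rewrite Tr in Tw.
have Tz := tr_lip pE z y2; rewrite !Tr [d z y2]dist_sym -/L in Tz.
have L1 : (1 : R) <= L%:R by rewrite ler1n.
have LL : 0 <= L%:R :> R by apply: ler0n.
(* Add [K + 1] copies of the bound at [y1] to the bound [X - x w <= r x w] at [w]; recall that
   [K + 2 = k]. *)
have step : (K + 2) * X <= r * ((K + 1) * x y1 + x w).
  have : (K + 1) * (X + x w) <= (K + 1) * (r * x y1) by rewrite ler_wpM2l // addr_ge0 // ler01.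
  have : 0 <= K * x w by rewrite mulr_ge0.
  have -> : r * ((K + 1) * x y1 + x w) = (K + 1) * (r * x y1) + r * x w by ring.
  rewrite !mulrDl !mulrDr !mul1r; lra.
have fin : (K + 2) * x z <= (K + 2) * x y1 + L%:R * ((K + 1) * x y1 + x w).
  rewrite -(ler_pM2l rp).
  have h1 : (K + 2) * (r * x z) <= (K + 2) * (r * x y1 + L%:R * X).
    rewrite ler_wpM2l ?addr_ge0 // ?ler0n //.
    have : r * x y2 <= r * x y1 by rewrite ler_pM2l.
    lra.
  have h2 : L%:R * ((K + 2) * X) <= L%:R * (r * ((K + 1) * x y1 + x w)) by rewrite ler_wpM2l.
  have -> : r * ((K + 2) * x z) = (K + 2) * (r * x z) by ring.
  apply: (le_trans h1); have -> : (K + 2) * (r * x y1 + L%:R * X) =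
    (K + 2) * (r * x y1) + L%:R * ((K + 2) * X) by ring.
  have -> : r * ((K + 2) * x y1 + L%:R * ((K + 1) * x y1 + x w)) =
    (K + 2) * (r * x y1) + L%:R * (r * ((K + 1) * x y1 + x w)) by ring.
  by rewrite lerD2l.
have OL : L.+1%:R * (K * x y1) <= L.+1%:R * mu O by rewrite ler_wpM2l // ler0n.
have tL : L%:R * t2 <= L%:R * t3 by rewrite ler_wpM2l.
rewrite PE K1 in sm.
have E1 : L.+1%:R = L%:R + 1 :> R by rewrite natr1.
have E2 : L.+2%:R = L%:R + 2 :> R by rewrite -addn2 natrD.
rewrite E1 in OL sm; rewrite E2 in sm.
have : (L%:R + 2) * x y1 + (L%:R + 1) * (K * x y1) + L%:R * x w =
   (K + 2) * x y1 + L%:R * ((K + 1) * x y1 + x w) by ring.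
have : (K + 1) * x z + x z = (K + 2) * x z by ring.
lra.
Qed.

(** [three_in_edge] supplies the leaf hypotheses of [three_branches_lt], whose six instances cover
    all orders of the three masses. *)
Lemma three_branches w e1 e2 e3 y1 y2 y3 :
  e1 \in E -> e2 \in E -> e3 \in E -> e1 != e2 -> e1 != e3 -> e2 != e3 ->
  w \in e1 -> w \in e2 -> w \in e3 -> y1 \in e1 -> y2 \in e2 -> y3 \in e3 ->
  y1 != w -> y2 != w -> y3 != w ->
  (1 < hdeg E y1)%N -> (1 < hdeg E y2)%N -> (1 < hdeg E y3)%N -> False.
Proof.
move=> e1E e2E e3E n12 n13 n23 w1 w2 w3 ye1 ye2 ye3 yw1 yw2 yw3 dy1 dy2 dy3.
have dw : (1 < hdeg E w)%N.
  apply/card_gt1P; exists e1, e2; rewrite !inE e1E e2E w1 w2; split=> //.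
have lf e y : e \in E -> w \in e -> y \in e -> y != w -> (1 < hdeg E y)%N ->
    forall c, c \in e -> c != w -> c != y -> hdeg E c = 1%N.
  move=> eE we ye yw dy c ce cw cy; apply: (deg1 k2 m1 cE); apply/negP => dc.
  by apply: (three_in_edge k2 m1 n1 cE maxE pE eE we ye ce _ _ _ dw dy dc); rewrite eq_sym.
have lf1 := lf e1 y1 e1E w1 ye1 yw1 dy1.
have lf2 := lf e2 y2 e2E w2 ye2 yw2 dy2.
have lf3 := lf e3 y3 e3E w3 ye3 yw3 dy3.
have n21 : e2 != e1 by rewrite eq_sym.
have n31 : e3 != e1 by rewrite eq_sym.
have n32 : e3 != e2 by rewrite eq_sym.
have B12 := three_branches_lt e1E e2E e3E n12 n13 n23 w1 w2 w3 ye1 ye2 ye3 yw1 yw2 yw3 dy1 dy2 lf1 lf2.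
have B13 := three_branches_lt e1E e3E e2E n13 n12 n32 w1 w3 w2 ye1 ye3 ye2 yw1 yw3 yw2 dy1 dy3 lf1 lf3.
have B21 := three_branches_lt e2E e1E e3E n21 n23 n13 w2 w1 w3 ye2 ye1 ye3 yw2 yw1 yw3 dy2 dy1 lf2 lf1.
have B23 := three_branches_lt e2E e3E e1E n23 n21 n31 w2 w3 w1 ye2 ye3 ye1 yw2 yw3 yw1 dy2 dy3 lf2 lf3.
have B31 := three_branches_lt e3E e1E e2E n31 n32 n12 w3 w1 w2 ye3 ye1 ye2 yw3 yw1 yw2 dy3 dy1 lf3 lf1.
have B32 := three_branches_lt e3E e2E e1E n32 n31 n21 w3 w2 w1 ye3 ye2 ye1 yw3 yw2 yw1 dy3 dy2 lf3 lf2.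
have [t12|/ltW t21] := leP (mu (side e1 y1)) (mu (side e2 y2)).
  have [t23|/ltW t32] := leP (mu (side e2 y2)) (mu (side e3 y3)); first exact: B12.
  by have [t13|/ltW t31] := leP (mu (side e1 y1)) (mu (side e3 y3)); [apply: B13 | apply: B31].
have [t13|/ltW t31] := leP (mu (side e1 y1)) (mu (side e3 y3)); first exact: B21.
by have [t23|/ltW t32] := leP (mu (side e2 y2)) (mu (side e3 y3)); [apply: B23 | apply: B32].
Qed.

End ExtremalBranching.

(** * The spine of an extremal hypertree *)

(** With truncated subtraction, [(i - j) + (j - i)] is the absolute difference. The second clause
    leaves degree at most 1 to both ends and to all vertices off the spine. *)
Definition spine (V : finType) (E : {set {set V}}) (N : nat) (u : nat -> V) :=
  (forall i j, i <= N -> j <= N -> dist E (u i) (u j) = (i - j) + (j - i)) /\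
  (forall v, 1 < hdeg E v <-> exists2 i, 0 < i < N & v = u i).

Section SpineExists.
Variables (R : realType) (k m Delta n : nat) (V : finType) (E : {set {set V}}).
Variables (r : R) (x : V -> R).
Hypotheses (k2 : 2 <= k) (m1 : 1 <= m) (n1 : 1 <= n).
Hypothesis cE : in_class E k m Delta n.
Hypothesis maxE : max_dsr k m Delta n r.
Hypothesis pE : perron E r x.
Notation tE := (class_tree cE).
Notation d := (dist E).

Lemma dist1_edge a b : d a b = 1 -> exists e, [/\ e \in E, a \in e & b \in e].
Proof.
move=> ab; have anb : a != b by rewrite -(dist_gt0 tE) ab.
have [f [c [fE af cf]]] := dist_pred cE anb.
by rewrite ab => -[/eqP]; rewrite (dist_eq0 tE) => /eqP cb; exists f; rewrite -cb.
Qed.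

Lemma edge_unique e f a b : e \in E -> f \in E -> a \in e -> b \in e -> a \in f -> b \in f ->
  a != b -> e = f.
Proof.
move=> eE fE ae be af bf ab; apply: contraNeq ab => ef.
have fe : f != e by rewrite eq_sym.
have := sep_other fE fe af bf; rewrite (tree_sep tE eE ae be) negbK //.
Qed.

Lemma dist_edge_le e a b : e \in E -> a \in e -> b \in e -> d a b <= 1.
Proof. by move=> eE ae be; rewrite (dist_edge tE eE ae be) leq_b1. Qed.

Lemma closer_sep e a b t : e \in E -> a \in e -> b \in e -> d a t = (d b t).+1 ->
  sep E e a t /\ ~~ sep E e b t.
Proof.
move=> eE ae be h; have := dist_step t eE ae be; rewrite h.
by case: (sep E e a t); case: (sep E e b t) => //=; move: (d b t); clear; lia.
Qed.

Lemma same_level e a b y t : e \in E -> a \in e -> b \in e -> y \in e ->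
  d a t = (d b t).+1 -> y != b -> d y t = d a t.
Proof.
move=> eE ae be ye h yb; have [_ nb] := closer_sep eE ae be h.
have := dist_step t eE be ye; rewrite (negPf nb) addn0 => <-.
suff -> : sep E e y t by rewrite addn1 h.
by rewrite sep_sym -(sep_eq y nb) (tree_sep tE eE) // eq_sym.
Qed.

Lemma next_level e g w b y t : e \in E -> w \in e -> b \in e -> d w t = (d b t).+1 ->
  g \in E -> g != e -> w \in g -> y \in g -> y != w -> d y t = (d w t).+1.
Proof.
move=> eE we be h gE ge wg yg yw; have [sw _] := closer_sep eE we be h.
have eg : e != g by rewrite eq_sym.
have nw := sep_excl tE eE gE eg we wg sw.
have := dist_step t gE wg yg; rewrite (negPf nw) addn0 => <-.
suff -> : sep E g y t by rewrite addn1.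
by rewrite sep_sym -(sep_eq y nw) (tree_sep tE gE) // eq_sym.
Qed.

Lemma extend_dist y t : 1 < hdeg E y -> y != t -> exists c, d c t = (d y t).+1.
Proof.
move=> y2 yt; have [f [b [fE yf bf /esym h]]] := dist_pred cE yt.
have [g gE /andP [yg gf]] := deg2_edges y2 f.
have [c cg cy] := edge_other k2 cE y gE.
by exists c; apply: (next_level fE yf bf h gE gf yg cg cy).
Qed.

Lemma geodesic s t : exists u : nat -> V, [/\ u 0 = s, u (d s t) = t &
  forall i, i < d s t -> d (u i) (u i.+1) = 1].
Proof.
move e : (d s t) => N; elim: N s e => [|N IH] s e.
  exists (fun _ => s); split=> //.
  by apply/eqP; rewrite -(dist_eq0 tE) e.
have st : s != t by rewrite -(dist_gt0 tE) e.
have [f [b [fE sf bf h]]] := dist_pred cE st.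
have [u [u0 uN us]] : exists u : nat -> V, [/\ u 0 = b, u N = t &
  forall i, i < N -> d (u i) (u i.+1) = 1] by apply: IH; apply: succn_inj; rewrite h.
exists (fun i => if i is j.+1 then u j else s); split=> // -[_|i] /=; last exact: us.
rewrite u0 (dist_edge tE fE sf bf); case: eqP => // sb.
by move: h; rewrite sb => /eqP; rewrite (gtn_eqF (ltnSn _)).
Qed.

Lemma geodesic_dist s t (u : nat -> V) : u 0 = s -> u (d s t) = t ->
  (forall i, i < d s t -> d (u i) (u i.+1) = 1) ->
  forall i j, i <= d s t -> j <= d s t -> d (u i) (u j) = (i - j) + (j - i).
Proof.
move=> u0 uN us.
have up p i : i + p <= d s t -> d (u i) (u (i + p)) <= p.
  elim: p => [|p IH] ip; first by rewrite addn0 dist_refl.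
  rewrite addnS in ip *; apply: leq_trans (dist_triangle E (u (i + p)) _ _) _.
  by rewrite us // addn1 ltnS IH // ltnW.
have key i p : i + p <= d s t -> d (u i) (u (i + p)) = p.
  move=> ip; apply/eqP; rewrite eqn_leq up //=.
  have h1 : d s (u i) <= i by rewrite -u0 -[X in u X]add0n; apply: up; move: ip; clear; lia.
  have h2 : d (u (i + p)) t <= d s t - (i + p).
    rewrite -{1}uN; have := up (d s t - (i + p)) (i + p); rewrite subnKC //; exact.
  have h3 := dist_triangle E (u i) s t; have h4 := dist_triangle E (u (i + p)) (u i) t.
  move: h1 h2 ip h3 h4; move: (d s t) (d s (u i)) (d (u i) t) (d (u i) (u (i + p))) (d (u (i + p)) t).
  by clear; lia.
move=> i j iN jN; have [ij|/ltnW ji] := leqP i j.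
  rewrite -{1}(subnKC ij) key ?subnKC //.
  by have /eqP -> : i - j == 0 by rewrite subn_eq0.
rewrite dist_sym -{1}(subnKC ji) key ?subnKC //.
by have /eqP -> : j - i == 0; [rewrite subn_eq0 | rewrite addn0].
Qed.

(* A longest geodesic is a spine: a vertex of degree at least 2 off it would be
   excluded by three_in_edge or three_branches, or would give a longer geodesic. *)
Lemma spine_exists : exists N u, spine E N u.
Proof.
have /card_gt0P [v0 _] : 0 < #|V| by apply: ltnW (class_card_gt1 k2 m1 cE).
pose st := [arg max_(p > (v0, v0)) d p.1 p.2].
have dmax a b : d a b <= d st.1 st.2.
  by rewrite /st; case: arg_maxnP => // p _ h; apply: (h (a, b)).
move: st dmax => [s t] /= dmax; set N := d s t in dmax *.
have [u [u0 uN us]] := geodesic s t; have du := geodesic_dist u0 uN us; rewrite -/N in du us uN.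
have N0 : 0 < N.
  have [f [b [fE v0f bf h]]] : exists f b, [/\ f \in E, v0 \in f, b \in f & b != v0].
    have /card_gt0P [f] := deg_gt0 k2 m1 cE v0; rewrite inE => /andP [fE v0f].
    by have [b bf bv] := edge_other k2 cE v0 fE; exists f, b.
  by apply: leq_trans (dmax b v0); rewrite (dist_gt0 tE).
(* [N] is the diameter, and a vertex that is not a leaf has an edge leading one step farther
   away. *)
have far y a : 1 < hdeg E y -> d y a = N -> False.
  move=> y2 ya; have yna : y != a by rewrite -(dist_gt0 tE) ya.
  by have [c dc] := extend_dist y2 yna; have := dmax c a; rewrite dc ya ltnn.
exists N, u; split=> // v.
have edge i : i < N -> exists e, [/\ e \in E, u i \in e & u i.+1 \in e].
  by move=> iN; apply: dist1_edge; apply: us.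
have inner i : 0 < i < N -> 1 < hdeg E (u i).
  case/andP; case: i => // i _ iN.
  have [e [eE e1 e2]] := edge _ (ltnW iN); have [f [fE f1 f2]] := edge _ iN.
  apply/card_gt1P; exists e, f; rewrite !inE eE fE e2 f1; split=> //.
  apply/eqP => ef; rewrite -ef in f2; have := dist_edge_le eE e1 f2.
  by rewrite du ?(ltnW (ltnW iN)) //; clear; lia.
split=> [v2|[i iN ->]]; last exact: inner.
suff [i iN vi] : exists2 i, i <= N & v = u i.
  exists i => //; apply/andP; split.
    rewrite lt0n; apply/eqP => i0; apply: (far v t v2).
    by rewrite vi i0 -uN du // sub0n subn0.
  rewrite ltn_neqAle iN andbT; apply/eqP => i0; apply: (far v s v2).
  by rewrite vi i0 -u0 du // sub0n subn0 addn0.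
pose i0 := [arg min_(i < (ord0 : 'I_N.+1)) d (u i) v].
have imin (j : nat) : j <= N -> d (u i0) v <= d (u j) v.
  move=> jN; rewrite /i0; case: arg_minnP => // i1 _ h.
  have jN' : j < N.+1 by [].
  exact: (h (Ordinal jN')).
have iN : i0 <= N by rewrite -ltnS.
move: (nat_of_ord i0) iN imin => i iN imin {i0}.
have [<-|uiv] := eqVneq (u i) v; first by exists i.
exfalso.
(* [y] is the first vertex from the nearest spine vertex [u i] towards [v]; it is off the spine and
   not a leaf. *)
have [f [y [fE wf yf dy]]] := dist_pred cE uiv.
have off j : j <= N -> u j != y.
  by move=> jN; apply/eqP => uj; have := imin j jN; rewrite uj -dy ltnn.
have y2 : 1 < hdeg E y.
  have [-> //|yv] := eqVneq y v.
  have [g [c [gE yg cg dc]]] := dist_pred cE yv.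
  apply/card_gt1P; exists f, g; rewrite !inE fE gE yf yg; split=> //.
  apply/eqP => fg; rewrite -fg in cg; have := dist_triangle E c (u i) v.
  have := dist_edge_le fE wf cg; rewrite -dy -dc.
  by move: (d (u i) c) (d c v); clear; lia.
(* If [f] is the first or last edge of the geodesic, [y] is itself at distance [N] from the opposite
   end; otherwise [f] contains three vertices of degree at least 2. *)
have two j : j < N -> u j \in f -> u j.+1 \in f -> False.
  move=> jN jf j1f; have nj : u j != u j.+1 by rewrite -(dist_gt0 tE) us.
  have oj := off j (ltnW jN); have oj1 := off _ jN.
  have [j0|j0] := posnP j.
    apply: (far y t y2); have -> : N = d (u 0) t by rewrite -uN du // sub0n subn0.
    apply: (same_level fE _ j1f yf); rewrite 1?eq_sym -?j0 //.
    by rewrite -uN !du // ?(ltnW jN) // j0; move: N0; move: (N); clear; lia.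
  have [jN1|jN1] := eqVneq j.+1 N.
    apply: (far y s y2); have -> : N = d (u j.+1) s by rewrite -u0 du // subn0 sub0n addn0.
    apply: (same_level fE j1f jf yf); rewrite 1?eq_sym //.
    by rewrite -u0 !du // ?(ltnW jN) //; clear; lia.
  apply: (three_in_edge k2 m1 n1 cE maxE pE fE jf j1f yf nj oj oj1) => //.
    by apply: inner; rewrite j0.
  by apply: inner; rewrite /= ltn_neqAle jN1.
have wy : u i != y by apply: off.
have ypos : y != u i by rewrite eq_sym.
have i_pos : 0 < i.
  rewrite lt0n; apply/eqP => i_0; have [e [eE e0 e1]] := edge 0 N0.
  rewrite i_0 in wf; have s1 : ~~ (1 < hdeg E (u 0)).
    apply/negP => s2; apply: (far (u 0) t s2).
    by rewrite -uN du // sub0n subn0.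
  have ef := deg1_edge (deg1 k2 m1 cE s1) eE fE e0 wf.
  by apply: (two 0) => //; rewrite -ef.
have i_lt : i < N.
  rewrite ltn_neqAle iN andbT; apply/eqP => i_N.
  have N1 : N.-1 < N by rewrite prednK.
  have [e [eE e0 e1]] := edge N.-1 N1.
  rewrite i_N in wf; have s1 : ~~ (1 < hdeg E (u N)).
    apply/negP => s2; apply: (far (u N) s s2).
    by rewrite -u0 du // subn0 sub0n addn0.
  rewrite prednK // in e1; have ef := deg1_edge (deg1 k2 m1 cE s1) eE fE e1 wf.
  by apply: (two N.-1) => //; rewrite ?prednK // -ef.
have i1 : i.-1 < N by apply: leq_ltn_trans (leq_pred i) i_lt.
have [e1 [e1E e1i e1w]] := edge _ i1; rewrite prednK // in e1w.
have [e2 [e2E e2w e2i]] := edge _ i_lt.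
have fe1 : f != e1 by apply/eqP => fe; apply: (two i.-1); rewrite ?prednK ?fe.
have fe2 : f != e2 by apply/eqP => fe; apply: (two i); rewrite ?fe.
have e12 : e1 != e2.
  apply/eqP => ee; rewrite -ee in e2i; have := dist_edge_le e1E e1i e2i.
  by rewrite du // ?(ltnW i1) //; move: i_pos; clear; lia.
have du1 : d (u i) t = (d (u i.+1) t).+1.
  by rewrite -uN !du // ?(ltnW i_lt) //; move: i_lt; move: (N); clear; lia.
have du2 : d (u i) s = (d (u i.-1) s).+1.
  by rewrite -u0 !du // ?(ltnW i1) //; move: i_pos; clear; lia.
(* One step from an end, the neighbouring end is a leaf and [three_branches] does not apply, but [y]
   is then at distance [N] from the opposite end. *)
have [i_1|i_1] := eqVneq i 1.
  apply: (far y t y2); rewrite (next_level e2E e2w e2i du1 fE fe2 wf yf ypos).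
  by rewrite -uN du // ?(ltnW i_lt) // i_1; move: N0; move: (N); clear; lia.
have [i_N|i_N] := eqVneq i.+1 N.
  apply: (far y s y2); rewrite (next_level e1E e1w e1i du2 fE fe1 wf yf ypos).
  by rewrite -u0 du // ?(ltnW i_lt) // -i_N; clear; lia.
have d1 : u i.-1 != u i.
  by rewrite -(dist_gt0 tE) du // ?(ltnW i1) ?(ltnW i_lt) //; move: i_pos; clear; lia.
have d2 : u i.+1 != u i.
  by rewrite -(dist_gt0 tE) du // ?(ltnW i_lt) //; clear; lia.
have e1f : e1 != f by rewrite eq_sym.
have e2f : e2 != f by rewrite eq_sym.
apply: (three_branches k2 m1 n1 cE maxE pE e1E e2E fE e12 e1f e2f e1w e2w wf e1i e2i yf d1 d2 ypos _ _ y2).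
  by apply: inner; rewrite i1 andbT; move: i_pos i_1; clear; lia.
by apply: inner; rewrite /= ltn_neqAle i_N i_lt.
Qed.

End SpineExists.

Lemma convex_increasing (R : realType) (g : nat -> R) N p i q :
  (forall j, 0 < j < N -> (2 * g j < g j.-1 + g j.+1)%R) ->
  p < i -> i < q -> q <= N -> (g p <= g i)%R -> (g i < g q)%R.
Proof.
move=> conv.
have next j : p < j -> j < N -> (g p <= g j)%R -> (g j < g j.+1)%R.
  elim: j => // j IH; rewrite ltnS leq_eqVlt => /predU1P [<-|pj] jN gj.
    by have := conv p.+1; rewrite jN /= => /(_ isT); lra.
  have [h|h] := leP (g j) (g j.+1).
    by have := conv j.+1; rewrite jN /= => /(_ isT); lra.
  by have := IH pj (ltnW jN) (le_trans gj (ltW h)); lra.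
move=> pi iq qN gi.
have all e : i + e.+1 <= N -> (g i < g (i + e.+1)%N)%R.
  elim: e => [|e IH] ieN; first by move: ieN; rewrite addn1 => ieN; apply: next.
  move: ieN; rewrite addnS => ieN; have h := IH (ltnW ieN).
  apply: (lt_trans h); apply: next => //.
    by apply: leq_trans pi _; rewrite leq_addr.
  exact: le_trans gi (ltW h).
have e : q = i + (q - i.+1).+1 by move: iq; clear; lia.
by rewrite e; apply: all; rewrite -e.
Qed.

(* Read along the spine: x i is the weight of u i; F i and G i are the masses on
   the two sides of the edge {u i, u (i+1)} and Y i that of its other vertices;
   S i is the mass of the star at u i. If x j > x (N - j), the comparison with the
   mirror image propagates inward to the middle when F j is at least its mirror
   value, and outward to the ends otherwise; both are absurd. *)
Section NumericReflection.
Local Open Scope ring_scope.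
Variables (R : realType) (N : nat) (r q X : R) (x F G Y S c : nat -> R).
Hypotheses (r0 : 0 < r) (q0 : 0 <= q) (X0 : 0 <= X) (x0 : forall i, 0 <= x i).
Hypothesis edge_eq : forall i, (i < N)%N -> r * x i + F i = r * x i.+1 + G i.
Hypothesis edge_sum : forall i, (i < N)%N -> F i + Y i + G i = X.
Hypothesis twig_eq : forall i, (i < N)%N -> Y i = q * (r * x i.+1 + G i).
Hypothesis vertex_eq : forall i, (i.+1 < N)%N -> F i.+1 + G i = X + x i.+1 + S i.+1.
Hypothesis star_eq : forall i, S i = c i * (r * x i + X).
Hypothesis c0 : forall i, 0 <= c i.
Hypothesis c_mono : forall i, (0 < i)%N -> (i.*2 < N)%N -> c (N - i)%N <= c i.
Hypotheses (F0 : F 0 = x 0) (GN : G N.-1 = x N).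

(** The data of the reversed spine: vertex [i] becomes [N - i], but edge [i] becomes [N - i - 1],
    and the two sides of an edge are exchanged. *)
Let x' i := x (N - i)%N.
Let F' i := G (N - i.+1)%N.
Let G' i := F (N - i.+1)%N.
Let Y' i := Y (N - i.+1)%N.
Let S' i := S (N - i)%N.

Let mirror i : (i < N)%N -> (N - i.+1 < N)%N /\ (N - i.+1).+1 = (N - i)%N.
Proof. by clear; lia. Qed.

Let edge_eq' i : (i < N)%N -> r * x' i + F' i = r * x' i.+1 + G' i.
Proof. by move=> iN; have [h e] := mirror iN; rewrite /x' -e -(edge_eq h). Qed.

Let edge_sum' i : (i < N)%N -> F' i + Y' i + G' i = X.
Proof. by move=> iN; have [h e] := mirror iN; rewrite -(edge_sum h) /F' /G' /Y'; ring. Qed.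

Let twig_eq' i : (i < N)%N -> Y' i = q * (r * x' i.+1 + G' i).
Proof.
by move=> iN; have [h e] := mirror iN; rewrite /Y' twig_eq // -(edge_eq h).
Qed.

Let twigF i : (i < N)%N -> Y i = q * (r * x i + F i).
Proof. by move=> iN; rewrite twig_eq // -edge_eq. Qed.

Let twigF' i : (i < N)%N -> Y' i = q * (r * x' i + F' i).
Proof. by move=> iN; rewrite twig_eq' // -edge_eq'. Qed.

Let vertex_eq' i : (i.+1 < N)%N -> F' i.+1 + G' i = X + x' i.+1 + S' i.+1.
Proof.
move=> iN; have e1 : (N - i.+1)%N = (N - i.+2).+1 by move: iN; clear; lia.
have h : ((N - i.+2).+1 < N)%N by move: iN; clear; lia.
by rewrite /F' /G' /x' /S' e1 -(vertex_eq h) addrC.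
Qed.

Let star_le i : (0 < i)%N -> (i.*2 < N)%N -> x' i <= x i -> S' i <= S i.
Proof.
move=> i0 iN xx; rewrite /S' !star_eq; apply: ler_pM => //.
- by rewrite addr_ge0 // mulr_ge0 // ltW.
- exact: c_mono.
- by rewrite lerD2r ler_pM2l.
Qed.

Lemma spine_reflect j : (j.*2 < N)%N -> x j <= x (N - j)%N.
Proof.
move=> jN; rewrite leNgt; apply/negP; rewrite -/(x' j) => xj.
have half i : (i.*2 < N)%N -> (i < N)%N by clear; lia.
have mulq a b : a <= b -> q * a <= q * b by apply: ler_wpM2l.
have mulr a b : a < b -> r * a < r * b by rewrite ltr_pM2l.
have divr a b : r * a < r * b -> a < b by rewrite ltr_pM2l.
have [FF|FF] := leP (F' j) (F j).
  have stp i : (i < N)%N -> x' i < x i -> F' i <= F i -> x' i.+1 < x i.+1 /\ Y' i <= Y i.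
    move=> iN xi Fi; have := mulr _ _ xi => rx.
    have YY : Y' i <= Y i by rewrite twigF // twigF' //; apply: mulq; lra.
    split=> //; apply: divr.
    by have := edge_eq iN; have := edge_eq' iN; have := edge_sum iN; have := edge_sum' iN; lra.
  have ind i : (i.*2 < N)%N -> (j <= i)%N -> x' i < x i /\ F' i <= F i.
    elim: i => [|i IH] iN; first by rewrite leqn0 => /eqP <-.
    rewrite leq_eqVlt => /predU1P [<- //|]; rewrite ltnS => ji.
    have iN' : (i.*2 < N)%N by move: iN; clear; lia.
    have i1N := half _ iN; have [xi Fi] := IH iN' ji.
    have [xi1 YY] := stp i (half _ iN') xi Fi; split=> //.
    have := vertex_eq i1N; have := vertex_eq' i1N.
    have := edge_sum (half _ iN'); have := edge_sum' (half _ iN').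
    have := star_le (ltn0Sn i) iN (ltW xi1); lra.
  (* [h] is the last index of the left half. One more step reaches the middle vertex for even [N],
     which is its own mirror image, or crosses the middle edge for odd [N], where the strict
     inequality meets its reverse. *)
  pose h := N.-1./2; have hN : (h.*2 < N)%N by rewrite /h; move: jN; clear; lia.
  have jh : (j <= h)%N by rewrite /h; move: jN; clear; lia.
  have [xh Fh] := ind h hN jh; have [xh1 _] := stp h (half _ hN) xh Fh.
  have [e|e] : (N - h.+1 = h.+1 \/ N - h.+1 = h /\ N - h = h.+1)%N.
  - by rewrite /h; move: jN; clear; lia.
  - by move: xh1; rewrite /x' e ltxx.
  by move: xh xh1; rewrite /x' !(proj1 e) (proj2 e) => /lt_trans a /a; rewrite ltxx.
have ind i : (i <= j)%N -> x' (j - i)%N < x (j - i)%N /\ F (j - i)%N < F' (j - i)%N.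
  elim: i => [|i IH] ij; first by rewrite subn0.
  have [] := IH (ltnW ij); have e : (j - i = (j - i.+1).+1)%N by move: ij; clear; lia.
  have l2 : ((j - i.+1).+1.*2 < N)%N by rewrite -e; move: jN; clear; lia.
  rewrite e; move: (j - i.+1)%N l2 => p l2 xp Fp; have pN := half _ l2.
  have pN' : (p < N)%N by apply: ltnW.
  have := star_le (ltn0Sn p) l2 (ltW xp); have := vertex_eq pN; have := vertex_eq' pN => v1 v2 v3.
  have GG : G' p < G p by lra.
  have rx := mulr _ _ xp.
  have YY : Y' p <= Y p by rewrite twig_eq // twig_eq' //; apply: mulq; lra.
  have h1 := edge_sum pN'; have h2 := edge_sum' pN'.
  split; last by lra.
  by apply: divr; have := edge_eq pN'; have := edge_eq' pN'; lra.
(* The ends are leaves, so the masses beyond them are their weights, and the two comparisons say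
   [x N < x 0] and [x 0 < x N]. *)
have := ind j (leqnn j); rewrite subnn F0 /F' subn1 GN /x' subn0 => -[a b].
by have := lt_trans a b; rewrite ltxx.
Qed.

End NumericReflection.

(** * Path edges and stars along a spine *)

Definition path_edge (V : finType) (E : {set {set V}}) (u : nat -> V) i : {set V} :=
  odflt set0 [pick e in E | (u i \in e) && (u i.+1 \in e)].

Definition star_edges (V : finType) (E : {set {set V}}) (u : nat -> V) i : {set {set V}} :=
  [set f in E | [&& u i \in f, f != path_edge E u i.-1 & f != path_edge E u i]].

Definition star_leaves (V : finType) (E : {set {set V}}) (u : nat -> V) i : {set V} :=
  [set v | (v != u i) && [exists f in star_edges E u i, v \in f]].

Section SpineStructure.
Variables (k m Delta n : nat) (V : finType) (E : {set {set V}}) (N : nat) (u : nat -> V).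
Hypotheses (k2 : 2 <= k) (m1 : 1 <= m).
Hypothesis cE : in_class E k m Delta n.
Hypothesis sp : spine E N u.
Hypothesis N1 : 1 < N.
Notation tE := (class_tree cE).
Notation d := (dist E).
Notation pe := (path_edge E u).
Notation side := (side E).

Lemma spine_dist i j : i <= N -> j <= N -> d (u i) (u j) = (i - j) + (j - i).
Proof. by case: sp => h _; apply: h. Qed.

Lemma spine_inner i : 0 < i < N -> 1 < hdeg E (u i).
Proof. by case: sp => _ h iN; apply/h; exists i. Qed.

Lemma spine_leaf v : (forall i, 0 < i < N -> v != u i) -> hdeg E v = 1.
Proof.
move=> h; apply: (deg1 k2 m1 cE); apply/negP; case: sp => _ sp2 /sp2 [i iN vi].
by have := h i iN; rewrite vi eqxx.
Qed.

Lemma spine_inj i j : i <= N -> j <= N -> u i = u j -> i = j.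
Proof.
move=> iN jN e; have := spine_dist iN jN; rewrite e dist_refl.
by clear; lia.
Qed.

Lemma spine_eq i j : i <= N -> j <= N -> (u i == u j) = (i == j).
Proof. by move=> iN jN; apply/eqP/eqP => [|-> //]; apply: spine_inj. Qed.

Lemma path_edgeP i : i < N -> [/\ pe i \in E, u i \in pe i & u i.+1 \in pe i].
Proof.
move=> iN; rewrite /path_edge; case: pickP => [e /and3P [] //|] /=.
have [e [eE e1 e2]] : exists e, [/\ e \in E, u i \in e & u i.+1 \in e].
  by apply: (dist1_edge cE); rewrite spine_dist // ?(ltnW iN) //; clear; lia.
by move/(_ e); rewrite eE e1 e2.
Qed.

Lemma path_edge_unique i e : i < N -> e \in E -> u i \in e -> u i.+1 \in e -> e = pe i.
Proof.
move=> iN eE e1 e2; have [pE p1 p2] := path_edgeP iN.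
apply: (edge_unique cE eE pE e1 e2 p1 p2).
by rewrite spine_eq // ?(ltnW iN) //; clear; lia.
Qed.

Lemma two_on_edge e i j : e \in E -> i < j -> j <= N -> u i \in e -> u j \in e ->
  j = i.+1 /\ e = pe i.
Proof.
move=> eE ij jN ei ej; have iN : i < N by apply: leq_trans ij jN.
have ji : j = i.+1.
  have := dist_edge_le cE eE ei ej; rewrite spine_dist // ?(ltnW iN) //.
  by move: ij; clear; lia.
by split=> //; apply: path_edge_unique => //; rewrite -ji.
Qed.

Lemma mem_path_edge i j : i < N -> j <= N -> (u j \in pe i) = (j == i) || (j == i.+1).
Proof.
move=> iN jN; have [pE p1 p2] := path_edgeP iN; apply/idP/orP; last first.
  by case=> /eqP ->.
move=> pj; have [ij|ji|->] := ltngtP i j; last by left.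
  by have [-> _] := two_on_edge pE ij jN p1 pj; right.
have [e _] := two_on_edge pE (ltnW ji : j < i.+1) iN pj p2.
by move: ji; rewrite -[i]/(i.+1.-1) e ltnn.
Qed.

Lemma path_edge_inj i j : i < N -> j < N -> pe i = pe j -> i = j.
Proof.
move=> iN jN e; have [_ p1 p2] := path_edgeP iN; move: p1 p2; rewrite e.
by rewrite !mem_path_edge ?(ltnW iN) //; clear; lia.
Qed.

Lemma path_edge_leaf i c : i < N -> c \in pe i -> c != u i -> c != u i.+1 -> hdeg E c = 1.
Proof.
move=> iN ce c1 c2; apply: spine_leaf => j /andP [_ jN]; apply/eqP => cj.
move: ce c1 c2; rewrite cj mem_path_edge ?(ltnW jN) // !spine_eq ?(ltnW jN) ?(ltnW iN) //.
by case: eqP => //=; case: eqP.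
Qed.

Lemma star_edgesP i f : reflect [/\ f \in E, u i \in f, f != pe i.-1 & f != pe i]
  (f \in star_edges E u i).
Proof. by rewrite inE; apply: and4P. Qed.

Lemma star_edges_spine i j f : i <= N -> j <= N -> f \in star_edges E u i ->
  (u j \in f) = (j == i).
Proof.
move=> iN jN /star_edgesP [fE fi f1 f2]; apply/idP/eqP => [fj|-> //].
have [ij|ji|//] := ltngtP i j.
  by have [_ e] := two_on_edge fE ij jN fi fj; rewrite e eqxx in f2.
have [e1 e2] := two_on_edge fE ji iN fj fi.
by rewrite e2 e1 eqxx in f1.
Qed.

Lemma star_leavesP i v : reflect (v != u i /\ exists2 f, f \in star_edges E u i & v \in f)
  (v \in star_leaves E u i).
Proof.
rewrite inE; apply: (iffP andP) => -[vi h]; split=> //.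
  by case/existsP: h => f /andP [fs vf]; exists f.
by case: h => f fs vf; apply/existsP; exists f; rewrite fs.
Qed.

Lemma star_edges_leaf i f v : i <= N -> f \in star_edges E u i -> v \in f -> v != u i ->
  hdeg E v = 1.
Proof.
move=> iN fs vf vi; apply: spine_leaf => j /andP [_ jN]; apply/eqP => vj.
by move: vf vi; rewrite vj (star_edges_spine iN (ltnW jN) fs) spine_eq ?(ltnW jN) // => ->.
Qed.

Lemma star_leaves_spine i j : i <= N -> j <= N -> u j \notin star_leaves E u i.
Proof.
move=> iN jN; apply/star_leavesP => -[ji [f fs]].
by rewrite (star_edges_spine iN jN fs) -spine_eq // (negPf ji).
Qed.

Lemma hang_star i : i <= N -> hang E (u i) (star_leaves E u i).
Proof.
move=> iN; split; first exact: star_leaves_spine.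
move=> f fE; have [df|/pred0Pn [v /= /andP [vf /star_leavesP [vi [g gs vg]]]]] :=
  boolP [disjoint f & star_leaves E u i]; first by left.
right; have [gE _ _ _] := star_edgesP _ _ gs.
have fg : f = g := deg1_edge (star_edges_leaf iN gs vg vi) fE gE vf vg.
apply/subsetP => t tf; rewrite in_setU1; have [//|ti] := eqVneq t (u i).
by apply/star_leavesP; split=> //; exists g; rewrite // -fg.
Qed.

Lemma card_star_edges i : 0 < i < N -> #|star_edges E u i| = hdeg E (u i) - 2.
Proof.
case/andP=> i0 iN; have i1 : i.-1 < N by apply: leq_ltn_trans (leq_pred i) iN.
have [p1E _ p1] := path_edgeP i1; have [p2E p2 _] := path_edgeP iN.
rewrite prednK // in p1.
have n12 : pe i != pe i.-1.
  by apply/eqP => e; have := path_edge_inj iN i1 e; move: i0; clear; lia.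
rewrite /hdeg [in RHS](cardsD1 (pe i.-1)) [in RHS]inE p1E p1 [in RHS](cardsD1 (pe i)).
rewrite [in RHS]in_setD1 [in RHS]inE n12 p2E p2 /= !add1n !subSS subn0.
congr #|pred_of_set _|; apply/setP => f; rewrite !inE.
by case: (f \in E); case: (u i \in f); case: (f == pe i.-1); case: (f == pe i).
Qed.

Lemma nmoved_star i : 0 < i < N ->
  nmoved E (u i) (star_leaves E u i) = hdeg E (u i) - 2.
Proof.
move=> iN; rewrite -card_star_edges //; have iN' : i <= N by case/andP: iN => _ /ltnW.
congr #|pred_of_set _|; apply/setP => f; rewrite inE; apply/and3P/idP.
  case=> fE fi /pred0Pn [v /= /andP [vf /star_leavesP [vi [g gs vg]]]].
  have [gE _ _ _] := star_edgesP _ _ gs.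
  by rewrite (deg1_edge (star_edges_leaf iN' gs vg vi) fE gE vf vg).
move=> fs; have [fE fi _ _] := star_edgesP _ _ fs; split=> //.
have [c cf ci] := edge_other k2 cE (u i) fE; apply/pred0Pn; exists c => /=.
by rewrite cf; apply/star_leavesP; split=> //; exists f.
Qed.

Lemma card_star_leaves i : 0 < i < N ->
  #|star_leaves E u i| = (hdeg E (u i) - 2) * k.-1.
Proof.
move=> iN; rewrite -card_star_edges //; have iN' : i <= N by case/andP: iN => _ /ltnW.
pose P := [set f :\ u i | f in star_edges E u i].
have sub f : f \in star_edges E u i -> #|f :\ u i| = k.-1.
  by case/star_edgesP => fE fi _ _; apply: (edge_card_D1 cE).
have inj : {in star_edges E u i &, injective (fun f => f :\ u i)}.
  move=> f g fs gs fg; have [fE fi _ _] := star_edgesP _ _ fs; have [gE gi _ _] := star_edgesP _ _ gs.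
  by rewrite -(setD1K fi) fg setD1K.
have part : partition P (star_leaves E u i).
  apply/and3P; split.
  - rewrite eqEsubset; apply/andP; split; apply/subsetP => v.
      case/bigcupP => A /imsetP [f fs ->]; rewrite in_setD1 => /andP [vi vf].
      by apply/star_leavesP; split=> //; exists f.
    case/star_leavesP => vi [f fs vf]; apply/bigcupP; exists (f :\ u i); first exact: imset_f.
    by rewrite in_setD1 vi.
  - apply/trivIsetP => A A' /imsetP [f fs ->] /imsetP [g gs ->] fg.
    apply/pred0P => v /=; apply/negP; rewrite !in_setD1 => /andP [/andP [vi vf] /andP [_ vg]].
    have [fE _ _ _] := star_edgesP _ _ fs; have [gE _ _ _] := star_edgesP _ _ gs.
    by case/eqP: fg; rewrite (deg1_edge (star_edges_leaf iN' fs vf vi) fE gE vf vg).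
  apply/imsetP => -[f fs] /esym e0; have := sub f fs; rewrite e0 cards0.
  by move: k2; clear; lia.
have uni : forall A, A \in P -> #|A| = k.-1 by move=> A /imsetP [f fs ->]; apply: sub.
by rewrite (card_uniform_partition uni part) card_in_imset.
Qed.

(** An edge without inner spine vertices would consist of leaves and hence contain every vertex,
    even [u 1], which is not a leaf. *)
Lemma edge_cases e : e \in E ->
  (exists2 i, i < N & e = pe i) \/ (exists2 i, 0 < i < N & e \in star_edges E u i).
Proof.
move=> eE.
have [i iN ei] : exists2 i, 0 < i < N & u i \in e.
  have [/existsP [i /andP [iN ei]]|] := boolP [exists i : 'I_N, (0 < i < N) && (u i \in e)].
    by exists i.
  rewrite negb_exists => /forallP none; exfalso.
  have lf c : c \in e -> hdeg E c = 1.
    move=> ce; apply: spine_leaf => i iN; apply/eqP => ci; case/andP: (iN) => _ iN'.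
    by have := none (Ordinal iN'); rewrite iN /= -ci ce.
  have e0 : e != set0 by rewrite -card_gt0 (class_card cE eE) ltnW.
  have all v : v \in e.
    have [c ce vS] := side_cover tE v eE e0.
    by move: vS; rewrite (side_leaf (lf c ce)) // inE => /eqP ->.
  have inner1 : 0 < 1 < N by rewrite N1.
  by have := lf _ (all (u 1)); have := spine_inner inner1 => /[swap] ->.
have iN' : i < N by case/andP: iN.
have [->|n1] := eqVneq e (pe i.-1).
  by left; exists i.-1 => //; apply: leq_ltn_trans (leq_pred i) iN'.
have [->|n2] := eqVneq e (pe i); first by left; exists i.
by right; exists i => //; apply/star_edgesP.
Qed.

Lemma pendant_side f b : f \in E -> b \in f ->
  (forall c, c \in f -> c != b -> hdeg E c = 1) -> side f b = ~: (f :\ b).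
Proof.
move=> fE bf leaf; apply/setP => a; rewrite in_setC in_setD1.
have f0 : f != set0 by apply/set0Pn; exists b.
have [c cf aS] := side_cover tE a fE f0.
have [cb|cb] := eqVneq c b.
  rewrite -cb aS; symmetry; apply/negP => /andP [ac af].
  by move: aS; rewrite (side_edge_mem tE fE cf af) (negPf ac).
rewrite (side_disj tE fE cf bf cb aS); move: aS; rewrite (side_leaf (leaf c cf cb)) //.
by rewrite in_set1 => /eqP ->; rewrite cb cf.
Qed.

(** At most one of the two path edges at [u i] separates it from a given vertex. If neither does,
    the first edge towards that vertex belongs to the star, and its other vertices are leaves. *)
Lemma spine_vertex_sides i : 0 < i < N ->
  side (pe i.-1) (u i) :|: side (pe i) (u i) = [set: V] /\
  side (pe i.-1) (u i) :&: side (pe i) (u i) = u i |: star_leaves E u i.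
Proof.
case/andP=> i0 iN; have i1 : i.-1 < N by apply: leq_ltn_trans (leq_pred i) iN.
have iN' := ltnW iN.
have [p1E _ p1] := path_edgeP i1; have [p2E p2 _] := path_edgeP iN.
rewrite prednK // in p1.
have n12 : pe i.-1 != pe i.
  by apply/eqP => e; have := path_edge_inj i1 iN e; move: i0; clear; lia.
split; apply/setP => v.
  rewrite in_setU in_setT !mem_side; apply/orP.
  by have [s1|] := boolP (sep E (pe i.-1) (u i) v); [right; apply: (sep_excl tE p1E) s1 | left].
rewrite in_setI in_setU1 !mem_side; apply/andP/orP => [[s1 s2]|[/eqP ->|]].
- have [|vi] := eqVneq v (u i); [by left | right].
  have iv : u i != v by rewrite eq_sym.
  have [f [b [fE uf bf h]]] := dist_pred cE iv.
  have [sf nb] := closer_sep fE uf bf (esym h).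
  have fs : f \in star_edges E u i.
    by apply/star_edgesP; split=> //; apply/eqP => ef; move: s1 s2; rewrite -ef sf.
  apply/star_leavesP; split=> //; exists f => //.
  have bi : b != u i by apply/eqP => bi; move: h; rewrite bi; move: (d _ _); clear; lia.
  have : v \in side f b by rewrite mem_side.
  by rewrite (side_leaf (star_edges_leaf iN' fs bf bi)) // in_set1 => /eqP ->.
- by rewrite !sep_refl.
case/star_leavesP => vi [f /star_edgesP [fE uf f1 f2] vf].
by rewrite !(sep_other fE).
Qed.

End SpineStructure.

(** * The Perron vector along a spine *)

Section SpinePerron.
Local Open Scope ring_scope.
Variables (R : realType) (k m Delta n : nat) (V : finType) (E : {set {set V}}).
Variables (r : R) (x : V -> R) (N : nat) (u : nat -> V).
Hypotheses (k2 : (2 <= k)%N) (m1 : (1 <= m)%N) (N1 : (1 < N)%N).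
Hypothesis cE : in_class E k m Delta n.
Hypothesis sp : spine E N u.
Hypothesis pE : perron E r x.
Notation tE := (class_tree cE).
Notation d := (dist E).
Notation pe := (path_edge E u).
Notation side := (side E).
Notation X := (\sum_u x u).
Notation T := (transmission E x).
Notation mu := (mass x).

Lemma massUI (A A' : {set V}) : mu A + mu A' = mu (A :|: A') + mu (A :&: A').
Proof.
rewrite -!mass_ind_tot -!big_split; apply: eq_bigr => a _ /=.
rewrite -!mulrDr; congr (_ * _); rewrite -!natrD in_setU in_setI.
by case: (a \in A); case: (a \in A').
Qed.

(** This is [tr_leaf] with the mass on the side of the centre written as [X - (k - 1) x z], all
    leaves of the edge having weight [x z]. *)
Lemma star_leaf_weight i z : (0 < i < N)%N -> z \in star_leaves E u i ->
  (r + k%:R) * x z = r * x (u i) + X.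
Proof.
case/andP=> i0 iN /star_leavesP [zi [f fs zf]]; have iN' := ltnW iN.
have [fE uf _ _] := star_edgesP _ _ _ _ fs.
have lf c : c \in f -> c != u i -> hdeg E c = 1%N := star_edges_leaf k2 m1 cE sp iN' fs.
have := tr_leaf x fE zf uf (lf z zf zi).
rewrite (pendant_side cE fE uf lf) massC (pendant_mass k2 m1 cE pE fE zf uf zi lf) !(trE pE).
have -> : k%:R = k.-1%:R + 1 :> R by rewrite natr1 prednK // ltnW.
rewrite !mulrDl mul1r; lra.
Qed.

Lemma star_mass i : (0 < i < N)%N ->
  mu (star_leaves E u i) = #|star_leaves E u i|%:R / (r + k%:R) * (r * x (u i) + X).
Proof.
move=> iN; have rk : r + k%:R != 0.
  by rewrite gt_eqF // ltr_wpDr // (r_gt0 k2 m1 cE pE).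
rewrite -mulrA mulr_natl -sumr_const; apply: eq_bigr => z zs.
by rewrite -(star_leaf_weight iN zs) mulKf.
Qed.

(** An instance of [spine_reflect]: the coefficient [q = (k - 2) / (r + 1)] comes from [twigs_mass],
    and [c i], the number of star leaves over [r + k], from [star_mass]. Extremality is not assumed,
    so that the lemma also applies after a move. *)
Lemma spine_heavier j :
  (forall i, (0 < i)%N -> (i.*2 < N)%N -> (hdeg E (u (N - i)) <= hdeg E (u i))%N) ->
  (j.*2 < N)%N -> x (u j) <= x (u (N - j)%N).
Proof.
move=> mono jN; have r0 := r_gt0 k2 m1 cE pE.
have X0 : 0 <= X by apply: sumr_ge0 => v _; apply: (x_ge0 pE).
have leafE i : (i == 0%N) || (i == N) -> hdeg E (u i) = 1%N.
  move=> h; have iN : (i <= N)%N by case/orP: h => /eqP ->.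
  apply: (spine_leaf k2 m1 cE sp) => l /andP [l0 lN].
  by rewrite (spine_eq sp) ?(ltnW lN) //; move: h l0 lN; clear; lia.
have lf i : (i < N)%N -> forall c, c \in pe i -> c != u i -> c != u i.+1 -> hdeg E c = 1%N.
  by move=> iN c; apply: (path_edge_leaf k2 m1 cE sp iN).
have neq i : (i < N)%N -> u i.+1 != u i.
  by move=> iN; rewrite (spine_eq sp) ?(ltnW iN) //; clear; lia.
pose c i : R := #|star_leaves E u i|%:R / (r + k%:R).
have rk : 0 < r + k%:R by rewrite ltr_wpDr.
pose Y i := mu (twigs (pe i) (u i) (u i.+1)).
apply: (@spine_reflect R N r ((k - 2)%:R / (r + 1)) X (fun i => x (u i))
  (fun i => mu (side (pe i) (u i))) (fun i => mu (side (pe i) (u i.+1))) Y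
  (fun i => c i * (r * x (u i) + X)) c) => //.
- by rewrite divr_ge0 // addr_ge0 // ltW.
- by move=> i; apply: (x_ge0 pE).
- move=> i iN; have [pE' p1 p2] := path_edgeP cE sp iN.
  by have := tr_edge x pE' p1 p2; rewrite !(trE pE).
- move=> i iN; have [pE' p1 p2] := path_edgeP cE sp iN.
  rewrite (side_twigs x cE pE' p1 p2 (neq i iN)); last exact: lf.
  rewrite /Y; ring.
- move=> i iN; have [pE' p1 p2] := path_edgeP cE sp iN.
  have r1 : r + 1 != 0 by rewrite gt_eqF // ltr_wpDr.
  apply: (mulfI r1); rewrite (twigs_mass cE pE pE' p1 p2 (neq i iN)); last exact: lf.
  by rewrite mulrA; congr (_ * _); rewrite mulrC divfK.
(* Inclusion-exclusion for the two sides at [u i.+1], which cover everything and overlap in that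
   vertex and its star. *)
- move=> i iN; have iN' : (0 < i.+1 < N)%N by rewrite iN.
  have [sU sI] := spine_vertex_sides k2 m1 cE sp iN'.
  rewrite addrC massUI sU sI massU; last first.
    rewrite disjoints1; apply: (star_leaves_spine cE sp) => //; exact: ltnW.
  rewrite mass1 -(star_mass iN') addrA; congr (_ + _ + _).
  by apply: eq_bigl => v; rewrite in_setT.
- by move=> i; rewrite divr_ge0 // ltW.
- move=> i i0 iN; have iN' : (0 < i < N)%N by move: i0 iN; clear; lia.
  have iN2 : (0 < N - i < N)%N by move: i0 iN; clear; lia.
  rewrite /c ler_wpM2r ?invr_ge0 ?(ltW rk) // ler_nat.
  rewrite !(card_star_leaves k2 m1 cE sp) // leq_mul2r leq_sub2r ?orbT //.
  exact: mono.
- have [pE' p1 p2] := path_edgeP cE sp (ltnW N1).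
  by rewrite (side_leaf (leafE 0%N _)) // mass1.
have N1' : (N.-1 < N)%N by move: N1; clear; lia.
have e : (N.-1.+1 = N)%N by move: N1; clear; lia.
have [pE' p1 p2] := path_edgeP cE sp N1'; rewrite e in p2 *.
by rewrite (side_leaf (leafE N _)) ?mass1 // eqxx orbT.
Qed.

Lemma outer_convex_spine (B : {set V}) j : (0 < j < N)%N -> u j \notin B ->
  2 * outer_tr E x B (u j) < outer_tr E x B (u j.-1) + outer_tr E x B (u j.+1).
Proof.
case/andP=> j0 jN jB; have j1 : (j.-1 < N)%N by apply: leq_ltn_trans (leq_pred j) jN.
have [p1E p0 p1] := path_edgeP cE sp j1; have [p2E p2 p3] := path_edgeP cE sp jN.
rewrite prednK // in p1.
have n12 : pe j.-1 != pe j.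
  by apply/eqP => e; have := path_edge_inj cE sp j1 jN e; move: j0; clear; lia.
apply: (outer_convex cE pE p1E p2E n12 p1 p2 p0 p3) => //.
  by rewrite (spine_eq sp) ?(ltnW jN) ?(ltnW j1) //; move: j0; clear; lia.
by rewrite (spine_eq sp) ?(ltnW jN) //; clear; lia.
Qed.

Lemma spine_convex j : (0 < j < N)%N -> 2 * x (u j) < x (u j.-1) + x (u j.+1).
Proof.
move=> jN; have r0 := r_gt0 k2 m1 cE pE.
have oE v : outer_tr E x set0 v = r * x v.
  by rewrite -(trE pE); apply: eq_bigl => a; rewrite in_setC in_set0.
have := outer_convex_spine jN (negbT (in_set0 (u j))); rewrite !oE -mulrDr mulrCA.
by rewrite ltr_pM2l.
Qed.

Lemma spine_between p i q : (p < i)%N -> (i < q)%N -> (q <= N)%N ->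
  x (u p) <= x (u q) -> x (u i) < x (u q).
Proof.
move=> pi iq qN h; rewrite ltNge; apply/negP => le.
have := convex_increasing (g := fun i => x (u i)) spine_convex pi iq qN (le_trans h le).
by rewrite ltNge le.
Qed.

End SpinePerron.

(** * Positions of the stars on the spine *)

Section ExtremalSpine.
Local Open Scope ring_scope.
Variables (R : realType) (k m Delta n : nat) (V : finType) (E : {set {set V}}).
Variables (r : R) (x : V -> R) (N : nat) (u : nat -> V).
Hypotheses (k2 : (2 <= k)%N) (m1 : (1 <= m)%N) (n1 : (1 <= n)%N) (D3 : (3 <= Delta)%N).
Hypothesis cE : in_class E k m Delta n.
Hypothesis pE : perron E r x.
Hypothesis sp : spine E N u.
Notation tE := (class_tree cE).
Notation d := (dist E).
Notation pe := (path_edge E u).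
Notation mu := (mass x).

Lemma spine_long : (1 < N)%N.
Proof.
case: cE => _ _ _ _ cn; move: n1; rewrite -cn => /card_gt0P [v]; rewrite inE => /eqP dv.
have v2 : (1 < hdeg E v)%N by rewrite dv ltnW.
by case: sp => _ /(_ v) [/(_ v2) [i /andP [i0 iN] _] _]; apply: leq_ltn_trans i0 iN.
Qed.

Section StarMove.
Variables (i q : nat).
Hypotheses (iN : (0 < i < N)%N) (qN : (0 < q < N)%N).
Hypotheses (di : hdeg E (u i) = Delta) (dq : hdeg E (u q) = 2%N).
Notation B := (star_leaves E u i).
Notation E' := (move_branch (u i) (u q) B E).

Let iN' : (i <= N)%N. Proof. by case/andP: iN => _ /ltnW. Qed.
Let qN' : (q <= N)%N. Proof. by case/andP: qN => _ /ltnW. Qed.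

Lemma star_hang : hang E (u i) B.
Proof. exact: (hang_star k2 m1 cE sp). Qed.

Lemma star_target : u q \notin B.
Proof. exact: (star_leaves_spine cE sp). Qed.

Lemma star_target_neq : u q != u i.
Proof.
apply: contra_eqN di => /eqP <-; rewrite dq eq_sym gtn_eqF //.
Qed.

Lemma star_nonempty : B != set0.
Proof.
rewrite -card_gt0 (card_star_leaves k2 m1 cE sp) // di muln_gt0 subn_gt0 D3 /=.
by move: k2; clear; lia.
Qed.

Lemma star_move_class : in_class E' k m Delta n.
Proof.
apply: (move_class_swap n1 cE star_hang star_target star_target_neq).
by rewrite (nmoved_star k2 m1 cE sp) // di dq subnKC // ltnW.
Qed.

Lemma star_move_deg j : (0 < j < N)%N ->
  hdeg E' (u j) = if j == i then 2%N else if j == q then Delta else hdeg E (u j).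
Proof.
case/andP=> j0 jN.
have nm : nmoved E (u i) B = (Delta - 2)%N by rewrite (nmoved_star k2 m1 cE sp) // di.
have [->|ji] := eqVneq j i.
  have := move_hdeg_w star_hang star_target star_target_neq; rewrite nm di.
  by move: D3; clear; lia.
have [->|jq] := eqVneq j q.
  rewrite (move_hdeg_w' star_hang star_target star_target_neq) nm dq.
  by rewrite subnKC // ltnW.
by rewrite (move_hdeg star_hang star_target) // (spine_eq sp) // ltnW.
Qed.

(** Only leaves move, and the degrees [Delta] and 2 are exchanged between two inner vertices. So
    [spine_heavier] and [spine_between] apply to the moved hypertree with the same [u]. *)
Lemma star_move_spine : spine E' N u.
Proof.
split=> [a b aN bN|v].
  by rewrite (move_dist_out tE star_hang star_target) ?(spine_dist sp) //;
    apply: (star_leaves_spine cE sp).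
have same : (1 < hdeg E' v)%N = (1 < hdeg E v)%N.
  have [->|vi] := eqVneq v (u i).
    by rewrite star_move_deg // eqxx di (ltnW D3).
  have [->|vq] := eqVneq v (u q).
    rewrite star_move_deg // dq eqxx -(spine_eq sp) //.
    by rewrite (negPf star_target_neq) (ltnW D3).
  by rewrite (move_hdeg star_hang star_target).
by rewrite same; case: sp.
Qed.

Lemma star_move_outer_lt : max_dsr k m Delta n r ->
  outer_tr E x B (u q) < outer_tr E x B (u i).
Proof.
move=> maxE; apply: (move_max k2 m1 cE maxE pE star_hang star_target star_target_neq).
  exact: star_nonempty.
exact: star_move_class.
Qed.

Lemma star_move_perron_gt r' x' : perron E' r' x' ->
  x (u i) < x (u q) -> x' (u i) <= x' (u q) -> r < r'.
Proof.
move=> pE' lx lx'; have r0 := r_gt0 k2 m1 cE pE.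
have r'0 := r_gt0 k2 m1 star_move_class pE'.
have h := bform_move_perron tE star_hang star_target pE pE'.
have pos (y : V -> R) : (forall v, 0 < y v) -> 0 < mass y B.
  move=> y0; have /set0Pn [b bB] := star_nonempty.
  by rewrite /mass (bigD1 b) //= ltr_wpDr // sumr_ge0 // => c _; apply: ltW.
have m0 := pos x (x_gt0 pE); have m0' := pos x' (x_gt0 pE').
have h1 : 0 <= mass x B * (r' * (x' (u q) - x' (u i))).
  by apply: mulr_ge0; [apply: ltW | apply: mulr_ge0; [apply: ltW | rewrite subr_ge0]].
have h2 : 0 < mass x' B * (r * (x (u q) - x (u i))).
  by apply: mulr_gt0 => //; apply: mulr_gt0; rewrite ?subr_gt0.
have s0 : 0 <= \sum_v x v * x' v.
  by apply: sumr_ge0 => v _; rewrite mulr_ge0 ?(x_ge0 pE) ?(x_ge0 pE').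
rewrite ltNge; apply/negP => le; have : (r' - r) * \sum_v x v * x' v <= 0.
  by rewrite mulr_le0_ge0 // subr_le0.
rewrite h; lra.
Qed.

End StarMove.

Hypothesis maxE : max_dsr k m Delta n r.

Lemma spine_deg i : (0 < i < N)%N -> hdeg E (u i) = 2%N \/ hdeg E (u i) = Delta.
Proof.
move=> iN; have := spine_inner sp iN.
by case/or3P: (deg_trichotomy k2 m1 n1 D3 cE maxE pE (u i)) => /eqP ->; [|left|right].
Qed.

(** Moving the star to [u p] or to [u q] stays in the class, so the outer transmission at [u i]
    would exceed both values, against convexity. *)
Lemma no_star_between p i q : (0 < p)%N -> (p < i)%N -> (i < q)%N -> (q < N)%N ->
  hdeg E (u p) = 2%N -> hdeg E (u i) = Delta -> hdeg E (u q) = 2%N -> False.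
Proof.
move=> p0 pi iq qN dp di dq.
have iN : (0 < i < N)%N by rewrite (leq_trans _ pi) // (ltn_trans iq qN).
have pN : (0 < p < N)%N by rewrite p0 (ltn_trans pi) //; case/andP: iN.
have qN' : (0 < q < N)%N by rewrite qN (leq_trans _ iq).
have lp := star_move_outer_lt iN pN di dp maxE.
have lq := star_move_outer_lt iN qN' di dq maxE.
have iN' : (i <= N)%N by case/andP: iN => _ /ltnW.
have := @convex_increasing R (fun j => outer_tr E x (star_leaves E u i) (u j)) N p i q _ pi iq (ltnW qN) (ltW lp).
rewrite ltNge (ltW lq) /= => /(_ _)/negP; case=> // j jN.
apply: (outer_convex_spine cE sp pE) => //; apply: (star_leaves_spine cE sp) => //.
by case/andP: jN => _ /ltnW.
Qed.

(* For a > b + 1, moving the star at u a to u (N - b - 1) raises the spectral radius: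
   by spine_heavier, applied before and after the move, both Perron vectors are
   larger at the target. *)
Lemma balanced a b :
  (forall i, (0 < i < N)%N ->
     hdeg E (u i) = if (i <= a)%N || (N - b <= i)%N then Delta else 2%N) ->
  (a + b + 1 < N)%N -> (a <= b + 1)%N.
Proof.
move=> dg abN; rewrite leqNgt; apply/negP => ab.
pose j := (b + 1)%N; pose q := (N - j)%N.
have aN : (0 < a < N)%N by move: ab abN; clear; lia.
have qN : (0 < q < N)%N by rewrite /q /j; move: ab abN; clear; lia.
have da : hdeg E (u a) = Delta by rewrite dg // leqnn.
have dq : hdeg E (u q) = 2%N.
  rewrite dg //; have -> : (q <= a)%N = false by rewrite /q /j; move: ab abN; clear; lia.
  by have -> : (N - b <= q)%N = false by rewrite /q /j; move: ab abN; clear; lia.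
have D2 : (2 <= Delta)%N by apply: ltnW.
have j2 : (j.*2 < N)%N by rewrite /j; move: ab abN; clear; lia.
have ja : (j < a)%N by rewrite /j; move: ab; clear; lia.
have aq : (a < q)%N by rewrite /q /j; move: abN; clear; lia.
have qN' : (q <= N)%N by case/andP: qN => _ /ltnW.
have cE' := star_move_class aN qN da dq.
have sp' := star_move_spine aN qN da dq.
set E' := move_branch _ _ _ _ in cE' sp'.
have [r' [x' [pE' dE' _]]] := perron_exists R (class_tree cE') (class_card_gt1 k2 m1 cE').
pose st i := (i <= a)%N || (N - b <= i)%N.
have dg' i : (0 < i < N)%N -> hdeg E (u i) = if st i then Delta else 2%N by exact: dg.
have key i : (i.*2 < N)%N -> st (N - i)%N -> st i.
  by rewrite /st; move: ab; clear; lia.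
have le_st (s t : bool) : (s -> t) -> ((if s then Delta else 2) <= (if t then Delta else 2))%N.
  by case: s; case: t => // /(_ isT).
have hx : x (u j) <= x (u q).
  apply: (spine_heavier k2 m1 spine_long cE sp pE) => // i i0 iN.
  rewrite !dg'; try by move: i0 iN; clear; lia.
  exact/le_st/key.
have hx' : x' (u j) <= x' (u q).
  apply: (spine_heavier k2 m1 spine_long cE' sp' pE') => // i i0 iN.
  have i1 : (0 < i < N)%N by move: i0 iN; clear; lia.
  have i2 : (0 < N - i < N)%N by move: i0 iN; clear; lia.
  rewrite !(star_move_deg aN qN da dq) // !dg' //.
  have dE1 s : (if (s == a)%N then 2%N else if (s == q)%N then Delta else if st s then Delta else 2%N)
      = if (s != a) && ((s == q) || st s) then Delta else 2%N.
    by case: (s == a); case: (s == q).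
  (* After the move the stars on the left are at [1, ..., a - 1] and those on the right mirror to
     [1, ..., b + 1]; the left end is still no poorer because [b + 1 < a]. *)
  rewrite !dE1; apply: le_st; move: ja i2 iN ab; rewrite /st /q /j; clear; lia.
(* The reflection only compares [u q] with [u j]; as [u a] lies strictly between them, convexity
   carries the inequality over to [u a]. *)
have lx := spine_between k2 m1 cE sp pE ja aq qN' hx.
have lx' := spine_between k2 m1 cE' sp' pE' ja aq qN' hx'.
have := star_move_perron_gt aN qN da dq pE' lx (ltW lx').
by rewrite ltNge (maxE cE' dE').
Qed.

End ExtremalSpine.

(** * Identification with C_k *)

Lemma spine_rev (V : finType) (E : {set {set V}}) N (u : nat -> V) :
  spine E N u -> spine E N (fun i => u (N - i)).
Proof.
case=> du iu; split=> [i j iN jN|v].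
  by rewrite du ?leq_subr //; move: iN jN; clear; lia.
split=> [/iu [i iN ->]|[i iN ->]].
  have e : N - (N - i) = i by move: iN; clear; lia.
  by exists (N - i); [move: iN; clear; lia | rewrite e].
by apply/iu; exists (N - i) => //; move: iN; clear; lia.
Qed.

Section SpineIso.
Variables (k m Delta n : nat) (V : finType) (E : {set {set V}}) (N : nat) (u : nat -> V).
Variables (a b : nat).
Hypotheses (k2 : 2 <= k) (m1 : 1 <= m) (D3 : 3 <= Delta) (N1 : 1 < N).
Hypothesis cE : in_class E k m Delta n.
Hypothesis sp : spine E N u.
Hypothesis dg : forall i, 0 < i < N -> hdeg E (u i) = if attached N a b i then Delta else 2.
Hypothesis att_inner : forall i, attached N a b i -> 0 < i < N.
Notation pe := (path_edge E u).
Notation C := (CV k N Delta a b).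

Definition star_edge i j : {set V} := nth set0 (enum (star_edges E u i)) j.
Notation se := star_edge.

Lemma attached_card i : attached N a b i -> #|star_edges E u i| = Delta - 2.
Proof.
by move=> at_i; have iN := att_inner at_i; rewrite (card_star_edges cE sp) // dg // at_i.
Qed.

Lemma star_edge_in i j : attached N a b i -> j < Delta - 2 -> se i j \in star_edges E u i.
Proof. by move=> at_i jD; rewrite -mem_enum mem_nth // -cardE attached_card. Qed.

Lemma star_edge_index i f : 0 < i < N -> f \in star_edges E u i ->
  attached N a b i /\ exists2 j, j < Delta - 2 & f = se i j.
Proof.
move=> iN fs; have c := card_star_edges cE sp iN; rewrite dg // in c.
have at_i : attached N a b i.
  by move: c; case: attached => // /eqP; rewrite subnn cards_eq0 => /eqP s0; rewrite s0 inE in fs.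
split=> //; exists (index f (enum (star_edges E u i))); last by rewrite /se nth_index // mem_enum.
by rewrite -(attached_card at_i) cardE index_mem mem_enum.
Qed.

Lemma star_edge_inj i i' j j' : attached N a b i -> attached N a b i' ->
  j < Delta - 2 -> j' < Delta - 2 -> se i j = se i' j' -> i = i' /\ j = j'.
Proof.
move=> ai ai' jD jD' e.
have s := star_edge_in ai jD; have s' := star_edge_in ai' jD'.
have /andP [_ iN] := att_inner ai; have /andP [_ iN'] := att_inner ai'.
have ii : i = i'.
  apply/eqP; rewrite -(star_edges_spine cE sp (ltnW iN') (ltnW iN) s') -e.
  by case/star_edgesP: s.
have sz : size (enum (star_edges E u i)) = Delta - 2 by rewrite -cardE attached_card.
by split=> //; apply/eqP; rewrite -(nth_uniq set0 _ _ (enum_uniq (star_edges E u i))) ?sz //; apply/eqP; rewrite -[LHS]/(se i j) e /se ii.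
Qed.

Lemma path_edge_not_star i i' : i < N -> i' <= N -> pe i \notin star_edges E u i'.
Proof.
move=> iN iN'; apply/star_edgesP => -[pE p f1 f2].
move: p; rewrite (mem_path_edge cE sp iN iN') => /orP [] /eqP e.
  by rewrite e eqxx in f2.
by rewrite e eqxx in f1.
Qed.

Lemma spine_card_star : #|[set i : 'I_N.+1 | attached N a b i]| = n.
Proof.
case: (cE) => _ _ _ _ <-.
rewrite -(card_in_imset (f := fun i : 'I_N.+1 => u i)); last first.
  move=> i j _ _; have iN : i <= N by rewrite -ltnS. have jN : j <= N by rewrite -ltnS.
  by move/(spine_inj sp iN jN); apply: val_inj.
congr #|pred_of_set _|; apply/setP => v; rewrite inE; apply/imsetP/eqP => [[i]|dv].
  by rewrite inE => ai ->; rewrite dg ?ai //; apply: att_inner.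
have v2 : 1 < hdeg E v by rewrite dv ltnW.
case: (sp) => _ /(_ v) [/(_ v2) [i iN vi] _].
have iN' : i < N.+1 by case/andP: iN => _ /ltnW.
exists (Ordinal iN') => //; rewrite inE /=.
move: dv; rewrite vi dg //; case: attached => // /eqP.
by rewrite ltn_eqF.
Qed.

Lemma spine_edges : E = [set pe i | i : 'I_N] :|:
  [set se (val p.1) (val p.2) | p in [set p : 'I_N.+1 * 'I_(Delta - 2) | attached N a b p.1]].
Proof.
apply/setP => e; rewrite inE; apply/idP/orP.
  move=> eE; case: (edge_cases k2 m1 cE sp N1 eE) => [[i iN ->]|[i iN es]].
    by left; apply/imsetP; exists (Ordinal iN).
  right; have [ai [j jD ej]] := star_edge_index iN es.
  have iN' : i < N.+1 by case/andP: iN => _ /ltnW.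
  by apply/imsetP; exists (Ordinal iN', Ordinal jD); rewrite ?inE.
case=> /imsetP [p].
  by move=> _ ->; have [] := path_edgeP cE sp (ltn_ord p).
rewrite inE => ap ->; have := star_edge_in ap (ltn_ord p.2).
by case/star_edgesP.
Qed.

(** Counting path edges and star edges identifies [N] with [m - n (Delta - 2)]. *)
Lemma spine_size : m = N + n * (Delta - 2).
Proof.
case: (cE) => _ _ <- _ _; rewrite {1}spine_edges cardsU.
have -> : [set pe i | i : 'I_N] :&: [set se (val p.1) (val p.2) |
    p in [set p : 'I_N.+1 * 'I_(Delta - 2) | attached N a b p.1]] = set0.
  apply/setP => e; rewrite inE in_set0; apply/andP => -[/imsetP [i _ ->] /imsetP [p]].
  rewrite inE => ap ep; have := star_edge_in ap (ltn_ord p.2); rewrite -ep.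
  by apply/negP; apply: path_edge_not_star => //; rewrite -ltnS.
rewrite cards0 subn0 card_imset; last first.
  by move=> i j /(path_edge_inj cE sp (ltn_ord i) (ltn_ord j)) /val_inj.
rewrite card_ord card_in_imset; last first.
  move=> [i j] [i' j']; rewrite !inE /= => ai ai' e.
  have [ii jj] := star_edge_inj ai ai' (ltn_ord j) (ltn_ord j') e.
  by congr pair; apply: val_inj.
congr (_ + _).
have -> : [set p : 'I_N.+1 * 'I_(Delta - 2) | attached N a b p.1] =
   setX [set i : 'I_N.+1 | attached N a b i] [set: 'I_(Delta - 2)].
  by apply/setP => -[i j]; rewrite !inE andbT.
by rewrite cardsX spine_card_star cardsT card_ord.
Qed.

(** On valid vertices the default of [nth] is never reached, since [card_twigs] and [card_star_edge]
    match the index ranges. *)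
Definition iso_pre (x : CVpre k N Delta) : V :=
  match x with
  | inl (inl i) => u i
  | inl (inr (i, j)) => nth (u 0) (enum (twigs (pe i) (u i) (u i.+1))) j
  | inr (i, j, l) => nth (u 0) (enum (se i j :\ u i)) l
  end.

Lemma card_twigs i : i < N -> #|twigs (pe i) (u i) (u i.+1)| = k - 2.
Proof.
move=> iN; have [pE p1 p2] := path_edgeP cE sp iN.
have ne : u i.+1 != u i by rewrite (spine_eq sp) ?(ltnW iN) //; clear; lia.
have := class_card cE pE; rewrite (cardsD1 (u i)) p1 (cardsD1 (u i.+1)) in_setD1 ne p2 /= => <-.
by rewrite addnA addKn.
Qed.

Lemma iso_twig i j : i < N -> j < k - 2 ->
  nth (u 0) (enum (twigs (pe i) (u i) (u i.+1))) j \in twigs (pe i) (u i) (u i.+1).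
Proof. by move=> iN jk; rewrite -mem_enum mem_nth // -cardE card_twigs. Qed.

Lemma card_star_edge i j : attached N a b i -> j < Delta - 2 -> #|se i j :\ u i| = k - 1.
Proof.
move=> ai jD; have /star_edgesP [fE fi _ _] := star_edge_in ai jD.
by rewrite (edge_card_D1 cE) // subn1.
Qed.

Lemma iso_star i j l : attached N a b i -> j < Delta - 2 -> l < k - 1 ->
  nth (u 0) (enum (se i j :\ u i)) l \in se i j :\ u i.
Proof. by move=> ai jD lk; rewrite -mem_enum mem_nth // -cardE card_star_edge. Qed.

Definition iso_map (x : C) : V := iso_pre (val x).

Lemma iso_path_edge (i : 'I_N) : iso_map @: [set x : C | pedge i (val x)] = pe i.
Proof.
have iN := ltn_ord i; have [pE p1 p2] := path_edgeP cE sp iN.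
apply/setP => v; apply/imsetP/idP => [[[[[j|[j l]]|[[j t] l]] vx]]|vp].
- by rewrite inE /= => h ->; rewrite /iso_map /= (mem_path_edge cE sp iN) // -ltnS.
- rewrite inE /= => /eqP ji ->; rewrite /iso_map /= ji.
  by have := iso_twig iN (ltn_ord l); rewrite in_twigs => /and3P [].
- by rewrite inE.
have [v0|v0] := eqVneq v (u i).
  have iN' : i < N.+1 by apply: ltnW.
  by exists (exist _ (inl (inl (Ordinal iN'))) isT : C); rewrite ?inE //= eqxx.
have [v1|v1] := eqVneq v (u i.+1).
  have iN' : i.+1 < N.+1 by [].
  by exists (exist _ (inl (inl (Ordinal iN'))) isT : C); rewrite ?inE //= eqxx orbT.
have vt : v \in twigs (pe i) (u i) (u i.+1) by rewrite in_twigs v1 v0.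
have jk : index v (enum (twigs (pe i) (u i) (u i.+1))) < k - 2.
  by rewrite -(card_twigs iN) cardE index_mem mem_enum.
exists (exist _ (inl (inr (i, Ordinal jk))) isT : C); first by rewrite inE /=.
by rewrite /iso_map /= nth_index // mem_enum.
Qed.

Lemma iso_star_edge (i : 'I_N.+1) (j : 'I_(Delta - 2)) : attached N a b i ->
  iso_map @: [set x : C | sedge i j (val x)] = se i j.
Proof.
move=> ai; have fs := star_edge_in ai (ltn_ord j); have /star_edgesP [fE fi _ _] := fs.
apply/setP => v; apply/imsetP/idP => [[[[[i'|[i' l]]|[[i' j'] l]] vx]]|vf].
- by rewrite inE /= => /eqP h ->; rewrite /iso_map /= h.
- by rewrite inE.
- rewrite inE /= => /andP [/eqP ii /eqP jj] ->; rewrite /iso_map /= ii jj.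
  by have := iso_star ai (ltn_ord j) (ltn_ord l); rewrite in_setD1 => /andP [].
have [v0|v0] := eqVneq v (u i).
  by exists (exist _ (inl (inl i)) isT : C); rewrite ?inE //= eqxx.
have vt : v \in se i j :\ u i by rewrite in_setD1 v0.
have lk : index v (enum (se i j :\ u i)) < k - 1.
  by rewrite -(card_star_edge ai (ltn_ord j)) cardE index_mem mem_enum.
exists (exist _ (inr (i, j, Ordinal lk)) ai : C); first by rewrite inE /= !eqxx.
by rewrite /iso_map /= nth_index // mem_enum.
Qed.

Lemma iso_edges : E = [set iso_map @: c | c : {set C} in C_edges k N Delta a b].
Proof.
rewrite {1}spine_edges /C_edges imsetU; congr (_ :|: _).
  rewrite -imset_comp; apply: eq_imset => i /=; by rewrite iso_path_edge.
rewrite -imset_comp; apply: eq_in_imset => -[i j]; rewrite inE /= => ai.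
by rewrite iso_star_edge.
Qed.

(** A vertex off the spine has degree 1, so it determines its edge; the edge determines the outer
    indices and the enumeration of its leaves the last one. *)
Lemma iso_inj : injective iso_map.
Proof.
have twig_leaf i v : i < N -> v \in twigs (pe i) (u i) (u i.+1) ->
    [/\ pe i \in E, v \in pe i, hdeg E v = 1 & forall j, j <= N -> v != u j].
  move=> iN; rewrite in_twigs => /and3P [v1 v0 vp]; have [pE _ _] := path_edgeP cE sp iN.
  split=> //; first exact: (path_edge_leaf k2 m1 cE sp iN).
  move=> j jN; apply/eqP => vj; move: vp; rewrite vj (mem_path_edge cE sp iN jN).
  by case/orP => /eqP ji; move: v0 v1; rewrite vj ji eqxx.
have star_leaf i j v : attached N a b i -> j < Delta - 2 -> v \in se i j :\ u i ->
    [/\ se i j \in E, v \in se i j, hdeg E v = 1 & forall j, j <= N -> v != u j].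
  move=> ai jD; rewrite in_setD1 => /andP [vi vs].
  have /andP [_ /ltnW iN] := att_inner ai.
  have fs := star_edge_in ai jD; have [fE _ _ _] := star_edgesP _ _ _ _ fs.
  split=> //; first exact: (star_edges_leaf k2 m1 cE sp iN fs).
  move=> l lN; apply/eqP => vl; move: vs vi.
  by rewrite vl (star_edges_spine cE sp iN lN fs) => /eqP ->; rewrite eqxx.
have uN (i : 'I_N.+1) : i <= N by rewrite -ltnS.
move=> [x px] [y py]; rewrite /iso_map /= => e; apply: val_inj => /=.
case: x px e => [[i|[i j]]|[[i j] l]] px; case: y py => [[i'|[i' j']]|[[i' j'] l']] py /= e.
- by congr (inl (inl _)); apply: val_inj; apply: (spine_inj sp) e.
- have [_ _ _ h] := twig_leaf _ _ (ltn_ord i') (iso_twig (ltn_ord i') (ltn_ord j')).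
  by have := h i (uN i); rewrite e eqxx.
- have [_ _ _ h] := star_leaf _ _ _ py (ltn_ord j') (iso_star py (ltn_ord j') (ltn_ord l')).
  by have := h i (uN i); rewrite e eqxx.
- have [_ _ _ h] := twig_leaf _ _ (ltn_ord i) (iso_twig (ltn_ord i) (ltn_ord j)).
  by have := h i' (uN i'); rewrite e eqxx.
- have t := iso_twig (ltn_ord i) (ltn_ord j); have t' := iso_twig (ltn_ord i') (ltn_ord j').
  have [pE vp v1 _] := twig_leaf _ _ (ltn_ord i) t; rewrite e in vp v1.
  have [pE' vp' _ _] := twig_leaf _ _ (ltn_ord i') t'.
  have /(path_edge_inj cE sp (ltn_ord i) (ltn_ord i')) /val_inj ii := deg1_edge v1 pE pE' vp vp'.
  rewrite -ii in e *; congr (inl (inr (_, _))); apply: val_inj.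
  by move/eqP: e; rewrite nth_uniq ?enum_uniq -?cardE ?card_twigs // => /eqP.
- have t := iso_twig (ltn_ord i) (ltn_ord j); have t' := iso_star py (ltn_ord j') (ltn_ord l').
  have [pE vp v1 _] := twig_leaf _ _ (ltn_ord i) t; rewrite e in vp v1.
  have [pE' vp' _ _] := star_leaf _ _ _ py (ltn_ord j') t'.
  have ee := deg1_edge v1 pE pE' vp vp'; have := star_edge_in py (ltn_ord j').
  by rewrite -ee (negPf (path_edge_not_star (ltn_ord i) (uN i'))).
- have [_ _ _ h] := star_leaf _ _ _ px (ltn_ord j) (iso_star px (ltn_ord j) (ltn_ord l)).
  by have := h i' (uN i'); rewrite e eqxx.
- have t := iso_star px (ltn_ord j) (ltn_ord l); have t' := iso_twig (ltn_ord i') (ltn_ord j').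
  have [pE vp v1 _] := star_leaf _ _ _ px (ltn_ord j) t; rewrite e in vp v1.
  have [pE' vp' _ _] := twig_leaf _ _ (ltn_ord i') t'.
  have ee := deg1_edge v1 pE pE' vp vp'; have := star_edge_in px (ltn_ord j).
  by rewrite ee (negPf (path_edge_not_star (ltn_ord i') (uN i))).
have t := iso_star px (ltn_ord j) (ltn_ord l); have t' := iso_star py (ltn_ord j') (ltn_ord l').
have [pE vp v1 _] := star_leaf _ _ _ px (ltn_ord j) t; rewrite e in vp v1.
have [pE' vp' _ _] := star_leaf _ _ _ py (ltn_ord j') t'.
have ee := deg1_edge v1 pE pE' vp vp'.
have [/val_inj ii /val_inj jj] := star_edge_inj px py (ltn_ord j) (ltn_ord j') ee.
rewrite -ii -jj in e *; congr (inr (_, _, _)); apply: val_inj.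
by move/eqP: e; rewrite nth_uniq ?enum_uniq -?cardE ?card_star_edge // => /eqP.
Qed.

Lemma spine_hiso : hiso E (C_edges k N Delta a b).
Proof.
(* Every vertex lies on an edge, and by [iso_edges] every edge is an image. *)
have surj v : exists x, iso_map x = v.
  have /card_gt0P [e] := deg_gt0 k2 m1 cE v; rewrite inE => /andP [eE ve].
  move: eE; rewrite iso_edges => /imsetP [c _ ec]; move: ve; rewrite ec.
  by case/imsetP => x _ ->; exists x.
have [f fK Kf] : bijective iso_map.
  apply: (inj_card_bij iso_inj); rewrite -(cardsT C) -cardsT.
  have -> : [set: V] = iso_map @: [set: C].
    by apply/setP => v; have [x <-] := surj v; rewrite in_setT imset_f.
  exact: leq_imset_card.
exists f; split; first by exists iso_map.
have gf (e : {set V}) : iso_map @: (f @: e) = e.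
  by rewrite -imset_comp (eq_imset _ Kf) imset_id.
have fg (c : {set C}) : f @: (iso_map @: c) = c.
  by rewrite -imset_comp (eq_imset _ fK) imset_id.
move=> e; rewrite {1}iso_edges; apply/imsetP/idP => [[c cC ->]|h]; first by rewrite fg.
by exists (f @: e).
Qed.

End SpineIso.

Lemma attached_count N a b : a + b < N -> #|[set i : 'I_N.+1 | attached N a b i]| = a + b.
Proof.
(* [g] lists the positions [1, ..., a] and then [N - b, ..., N - 1]; [a + b < N] keeps the two runs
   disjoint. *)
move=> abN; pose g t := if t < a then t.+1 else N - b + (t - a).
have gN (t : 'I_(a + b)) : g t < N.+1.
  by have := ltn_ord t; rewrite /g; case: ifP; move: abN; move: (nat_of_ord t); clear; lia.
pose f t := Ordinal (gN t).
have fi : injective f.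
  move=> s t /(congr1 val) /= e; apply: val_inj => /=; move: e (ltn_ord s) (ltn_ord t).
  by rewrite /g; move: abN; move: (nat_of_ord s) (nat_of_ord t); clear=> s t; do 2 case: ifP; lia.
rewrite -[RHS]card_ord -[RHS]cardsT -(card_imset _ fi).
congr #|pred_of_set _|; apply/setP => i; rewrite inE; apply/idP/imsetP => [at_i|[t _ ->]] /=.
  pose t := if i <= a then i.-1 else i - (N - b) + a.
  have tl : t < a + b.
    by move: at_i abN; rewrite /attached /t; move: (nat_of_ord i); clear=> i; case: ifP; lia.
  exists (Ordinal tl) => //; apply: val_inj; rewrite /= /g /t; move: at_i abN; rewrite /attached.
  by move: (nat_of_ord i); clear=> i; do ![case: ifP]; lia.
by have := ltn_ord t; rewrite /attached /g; move: abN; move: (nat_of_ord t); clear=> t; case: ifP; lia.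
Qed.

(** * Numbers of stars at the two ends *)

Section DegreePattern.
Variables (R : realType) (k m Delta n : nat) (V : finType) (E : {set {set V}}).
Variables (r : R) (x : V -> R).
Hypotheses (k2 : 2 <= k) (m1 : 1 <= m) (n1 : 1 <= n) (D3 : 3 <= Delta).
Hypothesis cE : in_class E k m Delta n.
Hypothesis maxE : max_dsr k m Delta n r.
Hypothesis pE : perron E r x.

Lemma pattern_inner N u : spine E N u -> exists a b, a + b < N /\
  (forall i, 0 < i < N -> hdeg E (u i) = if attached N a b i then Delta else 2) /\
  (a + b + 1 = N \/ (a + b + 1 < N)).
Proof.
move=> sp; have N1 := spine_long n1 D3 cE sp.
have dg i : 0 < i < N -> hdeg E (u i) = 2 \/ hdeg E (u i) = Delta.
  exact: (spine_deg k2 m1 n1 D3 cE pE sp maxE).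
pose P i := (0 < i < N) && (hdeg E (u i) == 2).
have [/existsP [i0 Pi0]|none] := boolP [exists i : 'I_N, P i]; last first.
  (* All inner vertices carry stars. They are counted as left stars here; [degree_pattern] splits
     them evenly. *)
  exists N.-1, 0; split; first by move: N1; clear; lia.
  split; last by left; move: N1; clear; lia.
  move=> i iN; have -> : attached N N.-1 0 i by rewrite /attached; move: iN; clear; lia.
  case: (dg i iN) => // d2; case/negP: none; case/andP: (iN) => _ iN'.
  by apply/existsP; exists (Ordinal iN'); rewrite /P iN d2.
have exP : exists i, P i by exists i0.
have bound i : P i -> i <= N by case/andP=> /andP [_ /ltnW].
case: (ex_minnP exP) => p Pp pmin; case: (ex_maxnP exP bound) => q Pq qmax.
case/andP: (Pp) => pN /eqP dp; case/andP: (Pq) => qN /eqP dq.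
have pq := pmin q Pq.
(* [p] and [q] are the first and last inner positions of degree 2, and [no_star_between] excludes
   stars between them. *)
exists p.-1, (N.-1 - q); split; first by move: pN qN pq; clear; lia.
split; last by move: pN qN pq; clear; lia.
move=> i iN; case: ifP => at_i.
  case: (dg i iN) => // di; have Pi : P i by rewrite /P iN di.
  have := pmin i Pi; have := qmax i Pi; move: at_i pN qN iN; rewrite /attached; clear; lia.
case: (dg i iN) => // di; exfalso.
have D2 : Delta <> 2 by move=> D2; move: D3; rewrite D2.
have ip : i <> p by move=> e; apply: D2; rewrite -di e.
have iq : i <> q by move=> e; apply: D2; rewrite -di e.
have pi : p < i by move: at_i ip iN pN; rewrite /attached; clear; lia.
have qi : i < q by move: at_i iq iN qN; rewrite /attached; clear; lia.
case/andP: pN => p0 _; case/andP: qN => _ qN'.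
exact: (no_star_between k2 m1 n1 D3 cE pE sp maxE p0 pi qi qN' dp di dq).
Qed.

Lemma degree_pattern : exists N u, [/\ 1 < N, spine E N u, n./2 + uphalf n < N &
  forall i, 0 < i < N ->
    hdeg E (u i) = if attached N n./2 (uphalf n) i then Delta else 2].
Proof.
have [N [u sp]] := spine_exists k2 m1 n1 cE maxE pE.
have N1 := spine_long n1 D3 cE sp.
have [a [b [abN [dg ab]]]] := pattern_inner sp.
have cnt : n = a + b.
  rewrite -(attached_count abN); apply/esym/(spine_card_star D3 cE sp dg) => i.
  by rewrite /attached; move: abN; clear; lia.
case: ab => [full|gap].
  exists N, u; split=> //; first by move: full cnt; clear; lia.
  move=> i iN; rewrite dg //.
  (* With stars at all inner positions, every split with [a + b = N - 1] describes the same
     positions. *)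
  have -> : attached N a b i by rewrite /attached; move: iN full; clear; lia.
  have -> // : attached N n./2 (uphalf n) i.
  by rewrite /attached; move: iN full cnt; clear; lia.
have dg1 i : 0 < i < N -> hdeg E (u i) = if (i <= a) || (N - b <= i) then Delta else 2.
  move=> iN; rewrite dg //; congr (if _ then _ else _).
  by rewrite /attached; move: iN; clear; lia.
(* Read backwards, the spine gives the opposite bound [b <= a + 1]. The reversed spine is also the
   final answer if [a > b], as the end with fewer stars has to come first. *)
have sp' := spine_rev sp.
have dg2 i : 0 < i < N -> hdeg E (u (N - i)) = if (i <= b) || (N - a <= i) then Delta else 2.
  move=> iN; rewrite dg1; last by move: iN; clear; lia.
  by congr (if _ then _ else _); move: iN gap; clear; lia.
have bal1 := balanced k2 m1 n1 D3 cE pE sp maxE dg1 gap.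
have gap' : b + a + 1 < N by rewrite [b + a]addnC.
have bal2 := balanced k2 m1 n1 D3 cE pE sp' maxE dg2 gap'.
have [le|lt] := leqP a b.
  have [ea eb] : n./2 = a /\ uphalf n = b by move: cnt le bal2; clear; lia.
  by exists N, u; rewrite ea eb; split.
have [ea eb] : n./2 = b /\ uphalf n = a by move: cnt lt bal1; clear; lia.
exists N, (fun i => u (N - i)); rewrite ea eb; split=> //.
  by move: gap; clear; lia.
move=> i iN; rewrite dg2 //; congr (if _ then _ else _).
by rewrite /attached; move: iN; clear; lia.
Qed.

End DegreePattern.

Unset Implicit Arguments.
Local Open Scope ring_scope.

Theorem theorem2 (R : realType) (k m Delta n : nat)
  (V : finType) (E : {set {set V}}) (r : R) :
  (2 <= k)%N -> (1 <= m)%N -> (3 <= Delta)%N -> (2 <= n)%N ->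
  in_class E k m Delta n ->
  is_dsr E r ->
  (forall (V' : finType) (E' : {set {set V'}}) (r' : R),
      in_class E' k m Delta n -> is_dsr E' r' -> r' <= r) ->
  hiso E (C_edges k (m - n * (Delta - 2)) Delta n./2 (uphalf n)).
Proof.
move=> k2 m1 D3 n2 cE dE maxE; have n1 : (1 <= n)%N := ltnW n2.
have tE := class_tree cE.
have [s [x [pE dE' _]]] := perron_exists R tE (class_card_gt1 k2 m1 cE).
rewrite (is_dsr_unique dE' dE) in pE.
have [N [u [N1 sp ab dg]]] := degree_pattern k2 m1 n1 D3 cE maxE pE.
have inner i : attached N n./2 (uphalf n) i -> (0 < i < N)%N.
  by rewrite /attached; move: ab; clear; lia.
have mN := spine_size k2 m1 D3 N1 cE sp dg inner.
have -> : (m - n * (Delta - 2))%N = N by rewrite [in LHS]mN addnK.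
exact: (spine_hiso k2 m1 N1 cE sp dg inner).
Qed.
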